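(* Let $H \in \mathcal{H}_2^{n_i \times n_i}$ and let $\Sigma_{\mathrm{D\text{-}pH}}$ be the set of diagonal port-Hamiltonian models $(\hat J, \hat R, \hat B)$ such that $\hat J, \hat R \in \mathbb{C}^{r \times r}$ are diagonal, $\hat J = -\hat J^*$, $\hat R = \hat R^* \succ 0$, and $\hat B \in \mathbb{C}^{r \times n_i}$. Let $(\hat J, \hat R, \hat B)$ be $\mathcal{H}_2$-optimal for $H$ in $\Sigma_{\mathrm{D\text{-}pH}}$, let its transfer function $\hat H$ have $r$ distinct poles, and write $\hat J - \hat R = \operatorname{diag}(\lambda_i)$ and $b_i^* = e_i^{\mathrm{T}} \hat B$. Define $G(s) = H(s) + H(s)^*$ and $\hat G(s) = \hat H(s) + \hat H(s)^*$. Then, for $i = 1, 2, \dots, r$, $$G(-\overline{\lambda_i}) b_i = \hat G(-\overline{\lambda_i}) b_i,$$ $$b_i^* G(-\overline{\lambda_i}) = b_i^* \hat G(-\overline{\lambda_i}),$$ $$b_i^* \frac{\partial G}{\partial s}(-\overline{\lambda_i}) \, b_i = b_i^* \frac{\partial \hat G}{\partial s}(-\overline{\lambda_i}) \, b_i.$$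
   Context: $n_i, r$ are positive integers; $\boldsymbol{\imath}$ is the imaginary unit; $\mathbb{C}_+$ is the open right half-plane; $(\cdot)^*$ is the conjugate transpose; $e_i$ is the $i$th canonical basis vector; $\succ 0$ denotes positive definite. A (complex) port-Hamiltonian model $(\hat J, \hat R, \hat B)$ is the system $\dot{\hat x}(t) = (\hat J - \hat R) \hat x(t) + \hat B u(t)$, $\hat y(t) = \hat B^* \hat x(t)$, with transfer function $\hat H(s) = \hat B^* (s \hat I - \hat J + \hat R)^{-1} \hat B$. $\mathcal{H}_2^{n_i \times n_i}$ is the Hardy space of $\mathbb{C}^{n_i \times n_i}$-valued functions analytic on $\mathbb{C}_+$ with finite $\mathcal{H}_2$ norm, where $\|F\|_{\mathcal{H}_2}^2 = \frac{1}{2\pi} \int_{-\infty}^{\infty} \|F(\boldsymbol{\imath}\omega)\|_F^2 \, d\omega$ (boundary values on the imaginary axis). A model is $\mathcal{H}_2$-optimal for $H$ in a set of models if its transfer function $\hat H$ minimizes $\|H - \hat H\|_{\mathcal{H}_2}$ over that set. $\partial/\partial s$ denotes the Wirtinger derivative, $\frac{\partial}{\partial s} = \frac12 \bigl( \frac{\partial}{\partial x} - \boldsymbol{\imath} \frac{\partial}{\partial y} \bigr)$ for $s = x + \boldsymbol{\imath} y$, applied entrywise. *)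

(* Defs.v *)
From HB Require Import structures.
From mathcomp Require Import all_boot all_order all_algebra.
From mathcomp Require Import all_classical all_reals all_analysis.
From mathcomp Require Import complex.

Set Implicit Arguments.
Unset Strict Implicit.
Unset Printing Implicit Defensive.

Import Order.TTheory GRing.Theory Num.Theory.
Import numFieldNormedType.Exports.

Local Open Scope classical_set_scope.
Local Open Scope ring_scope.
Local Open Scope complex_scope.
Local Open Scope sesquilinear_scope.

Definition Cplus (R : realType) : set R[i] := [set s | 0 < complex.Re s].

Definition modulus (R : realType) (z : R[i]) : R := ComplexField.Normc.normc z.

Definition frobenius2 (R : realType) m n (A : 'M[R[i]]_(m, n)) : R :=
  \sum_i \sum_j modulus (A i j) ^+ 2.

(* [R[i]^o] is [R[i]] seen as a normed module over itself, so that [derivable]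
   is complex differentiability. *)
Definition analytic_on (R : realType) m n (D : set R[i])
    (F : R[i] -> 'M[R[i]]_(m, n)) : Prop :=
  forall s, D s -> forall i j,
    derivable (fun z : R[i]^o => F z i j : R[i]^o) s 1.

(* Boundary value at the point 'i * w, as a limit from inside the right
   half-plane. By Fatou's theorem the limit exists for almost every w when F
   is in the Hardy space; [lim] takes an arbitrary value elsewhere. *)
Definition boundary_value (R : realType) m n (F : R[i] -> 'M[R[i]]_(m, n))
    (w : R) : 'M[R[i]]_(m, n) :=
  \matrix_(i, j) lim ((F (x +i* w) i j : R[i]^o) @[x --> (0 : R)^'+]).

Definition h2norm (R : realType) m n (F : R[i] -> 'M[R[i]]_(m, n)) : \bar R :=
  ((((2 * pi)^-1)%:E *
      \int[lebesgue_measure]_w (frobenius2 (boundary_value F w))%:E)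
   `^ (2^-1)%R)%E.

(* The uniform bound over vertical lines is the usual meaning of a finite H_2
   norm. Finiteness of [h2norm] alone would not do: it does not see growth
   inside the half-plane, as s |-> exp s / (s + 1) shows. *)
Definition hardy2 (R : realType) m n : set (R[i] -> 'M[R[i]]_(m, n)) :=
  [set F | analytic_on (@Cplus R) F /\
    exists M : R, forall x : R, 0 < x ->
      (\int[lebesgue_measure]_w (frobenius2 (F (x +i* w)))%:E <= M%:E)%E].

Record ph_model (R : realType) (r n : nat) := PHModel {
  phJ : 'M[R[i]]_r;
  phR : 'M[R[i]]_r;
  phB : 'M[R[i]]_(r, n) }.

Definition transfer (R : realType) r n (m : ph_model R r n) (s : R[i])
    : 'M[R[i]]_n :=
  (phB m)^t* *m invmx (s%:M - phJ m + phR m) *m phB m.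

(* The order of [R[i]] makes [0 < z] mean that z is real and positive. *)
Definition posdefmx (R : realType) n (A : 'M[R[i]]_n) : Prop :=
  A = A^t* /\ forall x : 'cV[R[i]]_n, x != 0 -> 0 < (x^t* *m A *m x) 0 0.

Definition diag_ph (R : realType) r n : set (ph_model R r n) :=
  [set m | [/\ is_diag_mx (phJ m), is_diag_mx (phR m),
               phJ m = - (phJ m)^t* & posdefmx (phR m)]].

Definition h2_optimal (R : realType) r n (H : R[i] -> 'M[R[i]]_n)
    (S : set (ph_model R r n)) (m : ph_model R r n) : Prop :=
  S m /\ forall m', S m' ->
    (h2norm (fun s => H s - transfer m s)%R
       <= h2norm (fun s => H s - transfer m' s)%R)%E.

Definition is_pole (R : realType) m n (F : R[i] -> 'M[R[i]]_(m, n))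
    (p : R[i]) : Prop :=
  exists i j, modulus (F s i j) @[s --> (p : R[i]^o)^'] --> +oo.

(* Derivative of a complex-valued function of a real variable. *)
Definition rderiv (R : realType) (g : R -> R[i]) (t : R) : R[i] :=
  derive1 (fun u => complex.Re (g u)) t +i* derive1 (fun u => complex.Im (g u)) t.

Definition wirtinger (R : realType) (f : R[i] -> R[i]) (s : R[i]) : R[i] :=
  let: x +i* y := s in
  2^-1 * (rderiv (fun u => f (u +i* y)) x
          - 'i%C * rderiv (fun u => f (x +i* u)) y).

Definition mx_wirtinger (R : realType) m n (F : R[i] -> 'M[R[i]]_(m, n))
    (s : R[i]) : 'M[R[i]]_(m, n) :=
  \matrix_(i, j) wirtinger (fun z => F z i j) s.

(* Main.v *)
Require Import Defs.
From mathcomp Require Import all_boot all_order all_algebra.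
From mathcomp Require Import all_classical all_reals all_analysis.
From mathcomp Require Import complex measurable_realfun.
From mathcomp Require Import ring lra.

(** Write E for the error H - Hhat. The objective is a squared distance in the
    space of square-integrable functions on the imaginary axis, so optimality
    of Hhat says that 2 Re <E, D> <= |D|^2 for every difference D between
    another model of the class and Hhat ([optimal_variation]). A diagonal model
    has the transfer function with entries
    [\sum_l (B l p)^* * B l q / (s - lam l)] ([transferE]), and the simple
    fractions reproduce values: <F, 1 / (s - l)> = 2 pi F (- l^* ) when
    Re l < 0. Hence a variation of row i of B or of lambda_i, which changes one
    fraction, only sees E near sigma = - (lambda_i)^*.

    Replace b_i by b_i + e v. The first-order term of D has residue
    b_i v^* + v b_i^*, in which v occurs linearly and antilinearly; it follows
    that the Hermitian combination E + E^* annihilates b_i at sigma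
    ([row_condition]), although E itself need not. This is where G and Ghat come
    from, and it gives the first two conditions, which are adjoint to each
    other. Moving lambda_i instead yields b_i^* E'(sigma) b_i = 0
    ([variation_of_pole]); since the Wirtinger derivative kills the
    antiholomorphic summand of G ([wirtingerE]), this is the third condition.

    The analytic content is the pairing formula with the boundary values that
    the norm is made of, that is, pointwise limits on the imaginary axis
    ([hardy_boundary]). Their existence almost everywhere, their integrability
    and the formula all come from the following chain.
    - Goursat's argument gives Cauchy's theorem for rectangles ([goursat],
      [goursat_removable]). The horizontal sides are sent to infinity along
      heights where F is small on average ([small_slice], [line_shift]). For a
      Hardy function this yields Poisson's formula for Re F on each vertical
      line ([hardy_poisson]) and the orthogonality of F to the fractions with
      reflected poles ([hardy_orthogonal]).
    - Then only the real functions u_x (w) = Re F (x + i w) matter, with the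
      rule that u_(a + x) is the Poisson integral of u_a ([poisson_field]).
      The Poisson kernel is symmetric, so <u_(a + x), u_b> = <u_a, u_(b + x)>,
      and |u_p - u_q|^2 is a second difference of the bounded nonincreasing
      function x |-> |u_x|^2: the u_x are a Cauchy family as x tends to 0
      ([field_cauchy]).
    - The Hardy-Littlewood maximal inequality, applied to u_x - u_(x + d),
      turns this into convergence almost everywhere ([field_limit]), and
      Fatou's lemma identifies the two limits ([field_boundary]).
    - Cauchy's formula on the line Re = x passes to the limit. *)

Set Implicit Arguments.
Unset Strict Implicit.
Unset Printing Implicit Defensive.

Import Order.TTheory GRing.Theory Num.Theory.
Import numFieldNormedType.Exports.

Local Open Scope classical_set_scope.
Local Open Scope ring_scope.
Local Open Scope complex_scope.
Local Open Scope sesquilinear_scope.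

(** * Integrals over segments *)

Section Segment.
Context {R : realType}.
Implicit Types (f g : R -> R) (a b c k : R).

Definition segint f a b : R := \int[lebesgue_measure]_(x in `[a, b]) f x.

Lemma segint_integrable f a b : {in `[a, b], continuous f} ->
  (@lebesgue_measure R).-integrable `[a, b] (EFin \o f).
Proof.
move=> cf; apply: continuous_compact_integrable; first exact: segment_compact.
by apply: continuous_in_subspaceT => x; rewrite inE => /cf.
Qed.

Lemma segint_cst a b k : a <= b -> segint (fun=> k) a b = k * (b - a).
Proof.
move=> ab; rewrite /segint Rintegral_cst//= lebesgue_measure_itv/= lte_fin.
by case: ltP => //= ba; rewrite (@le_anti _ _ a b) ?ab ?ba// subrr.
Qed.

Lemma segint_near_cst f a b k (e : R) : a <= b -> {in `[a, b], continuous f} ->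
  (forall x, a <= x <= b -> `|f x - k| <= e) ->
  `|segint f a b - k * (b - a)| <= e * (b - a).
Proof.
move=> ab cf fk; rewrite -(segint_cst k ab) /segint.
have intk c : (@lebesgue_measure R).-integrable `[a, b] (EFin \o (fun=> c)).
  by apply: segint_integrable => x _; exact: cvg_cst.
have intf := segint_integrable cf.
have cfk : {in `[a, b], continuous (fun x => f x - k)}.
  by move=> x /cf cfx; apply: cvgB => //; exact: cvg_cst.
rewrite -RintegralB//; apply: (le_trans (le_normr_Rintegral _ _)) => //.
  exact: segint_integrable.
rewrite -(segint_cst e ab); apply: le_Rintegral => //.
  apply: (segint_integrable (f := fun x => `|f x - k|)) => x /cfk.
  exact: cvg_norm.
Qed.

Lemma segint_cat f a c b : a <= c -> c <= b -> {in `[a, b], continuous f} ->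
  segint f a b = segint f a c + segint f c b.
Proof.
move=> ac cb /segint_integrable intf.
have /= := @Rintegral_itvB R f (BLeft a) (BRight b) c intf.
rewrite !bnd_simp => /(_ ac cb) H; rewrite /segint.
apply/eqP; rewrite addrC -subr_eq; apply/eqP; rewrite H.
apply: Rintegral_itv_obnd_cbnd; apply: integrableS intf => //=.
by apply: subset_itv; rewrite bnd_simp.
Qed.

Lemma segintD f g a b : {in `[a, b], continuous f} -> {in `[a, b], continuous g} ->
  segint (fun x => f x + g x) a b = segint f a b + segint g a b.
Proof. by move=> /segint_integrable ? /segint_integrable ?; exact: RintegralD. Qed.

Lemma segintB f g a b : {in `[a, b], continuous f} -> {in `[a, b], continuous g} ->
  segint (fun x => f x - g x) a b = segint f a b - segint g a b.
Proof. by move=> /segint_integrable ? /segint_integrable ?; exact: RintegralB. Qed.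

Lemma nested_intervals (u v : nat -> R) :
  {homo u : i j / (i <= j)%N >-> i <= j} ->
  {homo v : i j / (i <= j)%N >-> j <= i} ->
  (forall i, u i <= v i) -> exists p, forall i, u i <= p <= v i.
Proof.
move=> hu hv uv; exists (sup (range u)) => i.
have ubv j : ubound (range u) (v j).
  move=> _ [l _ <-]; apply: (le_trans (hu _ _ (leq_maxl l j))).
  exact: (le_trans (uv _) (hv _ _ (leq_maxr l j))).
apply/andP; split; first by apply: ub_le_sup; [exists (v 0%N)|exists i].
by apply: ge_sup => //; exists (u 0%N), 0%N.
Qed.

End Segment.

(** * Cauchy's theorem for rectangles *)

Section Goursat.
Context {R : realType}.
Implicit Types (U V : R -> R -> R) (A B c d p q : R).

(** Differentiability of [(U, V)] at [(p, q)], with the Cauchy-Riemann equations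
    built in: the differential is multiplication by the complex number a + i b. *)
Definition cr_at U V p q := exists a b : R, forall e : R, 0 < e ->
  exists2 r : R, 0 < r & forall x y, `|x - p| <= r -> `|y - q| <= r ->
    `|U x y - U p q - (a * (x - p) - b * (y - q))| <= e * (`|x - p| + `|y - q|) /\
    `|V x y - V p q - (b * (x - p) + a * (y - q))| <= e * (`|x - p| + `|y - q|).

(** The imaginary part of the integral of U + i V counterclockwise around the
    rectangle with corners A + i c and B + i d. Replacing U + i V by - i (U + i V)
    would give the real part up to sign, so nothing is lost by keeping one of the two. *)
Definition contour U V A B c d :=
  segint (fun x => V x c - V x d) A B + segint (fun y => U B y - U A y) c d.

Lemma contour_catx U V A m B c d : A <= m -> m <= B ->
  {in `[A, B], continuous (V^~ c)} -> {in `[A, B], continuous (V^~ d)} ->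
  {in `[c, d], continuous (U A)} -> {in `[c, d], continuous (U m)} ->
  {in `[c, d], continuous (U B)} ->
  contour U V A B c d = contour U V A m c d + contour U V m B c d.
Proof.
move=> Am mB Vc Vd UA Um UB; rewrite /contour (@segint_cat _ _ A m B)//; last first.
  by move=> x xAB; apply: cvgB; [exact: Vc|exact: Vd].
rewrite addrACA -segintD; last 2 first.
- by move=> x xAB; apply: cvgB; [exact: Um|exact: UA].
- by move=> x xAB; apply: cvgB; [exact: UB|exact: Um].
by congr (_ + _); apply: eq_Rintegral => y _; lra.
Qed.

Lemma contour_caty U V A B c m d : c <= m -> m <= d ->
  {in `[A, B], continuous (V^~ c)} -> {in `[A, B], continuous (V^~ m)} ->
  {in `[A, B], continuous (V^~ d)} ->
  {in `[c, d], continuous (U A)} -> {in `[c, d], continuous (U B)} ->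
  contour U V A B c d = contour U V A B c m + contour U V A B m d.
Proof.
move=> cm md Vc Vm Vd UA UB; rewrite /contour (@segint_cat _ _ c m d)//; last first.
  by move=> x xAB; apply: cvgB; [exact: UB|exact: UA].
rewrite [RHS]addrACA -segintD; last 2 first.
- by move=> x xAB; apply: cvgB; [exact: Vc|exact: Vm].
- by move=> x xAB; apply: cvgB; [exact: Vm|exact: Vd].
by congr (_ + _); apply: eq_Rintegral => y _; lra.
Qed.

Lemma cr_at_sub U V p q : cr_at U V p q -> exists2 K : R, 0 < K &
  exists2 r : R, 0 < r & forall x y, `|x - p| <= r -> `|y - q| <= r ->
    `|U x y - U p q| <= K * (`|x - p| + `|y - q|) /\
    `|V x y - V p q| <= K * (`|x - p| + `|y - q|).
Proof.
move=> [a [b /(_ 1 ltr01)[r r0 H]]].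
exists (1 + `|a| + `|b|); first by rewrite -addrA ltr_pwDl// addr_ge0.
exists r => // x y xr yr; have [HU HV] := H x y xr yr.
have bd (s t : R) : `|s * (x - p)| + `|t * (y - q)| <= (`|s| + `|t|) * (`|x - p| + `|y - q|).
  rewrite !normrM; have := normr_ge0 s; have := normr_ge0 t.
  have := normr_ge0 (x - p); have := normr_ge0 (y - q); nra.
split.
- have := ler_normD (U x y - U p q - (a * (x - p) - b * (y - q))) (a * (x - p) - b * (y - q)).
  rewrite subrK; have := ler_normB (a * (x - p)) (b * (y - q)).
  have := bd a b; nra.
- have := ler_normD (V x y - V p q - (b * (x - p) + a * (y - q))) (b * (x - p) + a * (y - q)).
  rewrite subrK; have := ler_normD (b * (x - p)) (a * (y - q)).
  have := bd b a; nra.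
Qed.

Lemma cr_at_cvgU U V p q : cr_at U V p q -> {for q, continuous (U p)}.
Proof.
move=> /cr_at_sub[K K0 [r r0 H]]; apply/cvgrPdist_le => /= e e0.
near=> y.
have yr : `|y - q| <= r.
  by rewrite distrC; near: y; apply: cvgr_dist_le => //; exact: cvg_id.
have ye : `|y - q| <= e / K.
  rewrite distrC; near: y; apply: cvgr_dist_le; [exact: cvg_id|exact: divr_gt0].
have := H p y; rewrite subrr normr0 => /(_ (ltW r0) yr)[+ _].
rewrite add0r distrC => /le_trans; apply.
by rewrite mulrC -ler_pdivlMr.
Unshelve. all: by end_near. Qed.

Lemma cr_at_cvgV U V p q : cr_at U V p q -> {for p, continuous (V^~ q)}.
Proof.
move=> /cr_at_sub[K K0 [r r0 H]]; apply/cvgrPdist_le => /= e e0.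
near=> y.
have yr : `|y - p| <= r.
  by rewrite distrC; near: y; apply: cvgr_dist_le => //; exact: cvg_id.
have ye : `|y - p| <= e / K.
  rewrite distrC; near: y; apply: cvgr_dist_le; [exact: cvg_id|exact: divr_gt0].
have := H y q; rewrite subrr normr0 => /(_ yr (ltW r0))[_].
rewrite addr0 distrC => /le_trans; apply.
by rewrite mulrC -ler_pdivlMr.
Unshelve. all: by end_near. Qed.

(** The affine part of U + i V contributes a (c - d) (B - A) + a (B - A) (d - c),
    which vanishes; the remainder is o(diameter), integrated over a perimeter
    proportional to the diameter. *)
Lemma contour_small U V p q : cr_at U V p q -> forall e : R, 0 < e ->
  exists2 r : R, 0 < r & forall A B c d, A <= p <= B -> c <= q <= d ->
    (B - A) + (d - c) <= r ->
    {in `[A, B], continuous (V^~ c)} -> {in `[A, B], continuous (V^~ d)} ->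
    {in `[c, d], continuous (U A)} -> {in `[c, d], continuous (U B)} ->
    `|contour U V A B c d| <= e * (B - A + (d - c)) ^+ 2.
Proof.
move=> [a [b H]] e e0; have e20 : 0 < e / 2 by rewrite divr_gt0.
have [r r0 {}H] := H _ e20.
exists r => // A B c d /andP[Ap pB] /andP[cq qd] small Vc Vd UA UB.
have AB : A <= B by lra.
have cd : c <= d by lra.
have bnd x y : A <= x <= B -> c <= y <= d ->
    `|U x y - U p q - (a * (x - p) - b * (y - q))| <= e / 2 * (B - A + (d - c)) /\
    `|V x y - V p q - (b * (x - p) + a * (y - q))| <= e / 2 * (B - A + (d - c)).
  move=> /andP[Ax xB] /andP[cy yd].
  have xp : `|x - p| <= B - A by rewrite ler_norml; lra.
  have yq : `|y - q| <= d - c by rewrite ler_norml; lra.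
  have [||hU hV] := H x y; [lra|lra|].
  by split; [apply: (le_trans hU)|apply: (le_trans hV)]; rewrite ler_pM2l// lerD.
have cc : c <= c <= d by rewrite lexx cd.
have dd : c <= d <= d by rewrite lexx cd.
have AA : A <= A <= B by rewrite lexx AB.
have BB : A <= B <= B by rewrite lexx AB.
have H1 : `|segint (fun x => V x c - V x d) A B - a * (c - d) * (B - A)|
    <= e * (B - A + (d - c)) * (B - A).
  apply: segint_near_cst => //.
    by move=> x xAB; apply: cvgB; [exact: Vc|exact: Vd].
  move=> x xAB; have [_ +] := bnd x c xAB cc; have [_] := bnd x d xAB dd.
  rewrite !ler_norml => /andP[? ?] /andP[? ?]; lra.
have H2 : `|segint (fun y => U B y - U A y) c d - a * (B - A) * (d - c)|
    <= e * (B - A + (d - c)) * (d - c).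
  apply: segint_near_cst => //.
    by move=> x xAB; apply: cvgB; [exact: UB|exact: UA].
  move=> y ycd; have [+ _] := bnd A y AA ycd; have [+ _] := bnd B y BB ycd.
  rewrite !ler_norml => /andP[? ?] /andP[? ?]; lra.
move: H1 H2; rewrite /contour expr2 !ler_norml => /andP[? ?] /andP[? ?]; lra.
Qed.

End Goursat.

Section GoursatTheorem.
Context {R : realType}.
Implicit Types (U V : R -> R -> R) (A B c d p q : R).

Let sub_bounds A B a b x : A <= a -> b <= B -> a <= x <= b -> A <= x <= B.
Proof. by move=> Aa bB /andP[ax xb]; rewrite (le_trans Aa)//= (le_trans xb). Qed.

(** The integrals around the four quarters add up to the whole, so one of them
    carries at least a quarter of it. *)
Lemma contour_quarter U V A B c d :
  (forall p q, A <= p <= B -> c <= q <= d -> cr_at U V p q) ->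
  A <= B -> c <= d ->
  exists A' B' c' d', [/\ A <= A', A' <= B', B' <= B, c <= c' /\ c' <= d' /\ d' <= d &
    [/\ B' - A' = (B - A) / 2, d' - c' = (d - c) / 2 &
    `|contour U V A B c d| <= 4 * `|contour U V A' B' c' d'| ]].
Proof.
move=> H AB cd.
set m := (A + B) / 2; set n := (c + d) / 2.
have Am : A <= m by rewrite /m; lra.
have mB : m <= B by rewrite /m; lra.
have cn : c <= n by rewrite /n; lra.
have nd : n <= d by rewrite /n; lra.
have VE y : c <= y <= d -> {in `[A, B], continuous (V^~ y)}.
  by move=> ycd x; rewrite in_itv/= => xAB; exact: cr_at_cvgV (H _ _ xAB ycd).
have UE x : A <= x <= B -> {in `[c, d], continuous (U x)}.
  by move=> xAB y; rewrite in_itv/= => ycd; exact: cr_at_cvgU (H _ _ xAB ycd).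
have sub (a1 b1 a2 b2 : R) (f : R -> R) : a1 <= a2 -> b2 <= b1 ->
    {in `[a1, b1], continuous f} -> {in `[a2, b2], continuous f}.
  move=> h1 h2 hf x; rewrite in_itv/= => /andP[? ?]; apply: hf.
  by rewrite in_itv/=; apply/andP; split; lra.
have lb (u v : R) : u <= v -> u <= u <= v by rewrite lexx.
have ub (u v : R) : u <= v -> u <= v <= v by rewrite lexx => ->.
have md (u v w : R) : u <= v -> v <= w -> u <= v <= w by move=> -> ->.
have E : contour U V A B c d =
    (contour U V A m c n + contour U V A m n d) +
    (contour U V m B c n + contour U V m B n d).
  rewrite (@contour_catx _ U V A m B c d)//; [|by apply: VE; auto|by apply: VE; auto|
    by apply: UE; auto..].
  congr (_ + _).
  - apply: contour_caty => //; [apply: (sub A B); auto..|apply: UE; auto|apply: UE; auto].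
  - apply: contour_caty => //; [apply: (sub A B); auto..|apply: UE; auto|apply: UE; auto].
have T : `|contour U V A B c d| <=
    (`|contour U V A m c n| + `|contour U V A m n d|) +
    (`|contour U V m B c n| + `|contour U V m B n d|).
  rewrite E (le_trans (ler_normD _ _))// lerD//; exact: ler_normD.
have hm1 : m - A = (B - A) / 2 by rewrite /m; lra.
have hm2 : B - m = (B - A) / 2 by rewrite /m; lra.
have hn1 : n - c = (d - c) / 2 by rewrite /n; lra.
have hn2 : d - n = (d - c) / 2 by rewrite /n; lra.
have [h|h1] := leP `|contour U V A B c d| (4 * `|contour U V A m c n|).
  by exists A, m, c, n.
have [h|h2] := leP `|contour U V A B c d| (4 * `|contour U V A m n d|).
  by exists A, m, n, d.
have [h|h3] := leP `|contour U V A B c d| (4 * `|contour U V m B c n|).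
  by exists m, B, c, n.
have [h|h4] := leP `|contour U V A B c d| (4 * `|contour U V m B n d|).
  by exists m, B, n, d.
exfalso; clear -T h1 h2 h3 h4; lra.
Qed.

(** Quartering forever produces nested rectangles around a point where
    [contour_small] applies. The integral loses at most a factor 4 at each step and
    the squared diameter exactly a factor 4, so that the integral is smaller than
    any multiple of the squared diameter. *)
Lemma goursat U V A B c d :
  (forall p q, A <= p <= B -> c <= q <= d -> cr_at U V p q) ->
  A <= B -> c <= d -> contour U V A B c d = 0.
Proof.
move=> H AB cd.
pose X := (R * R * R * R)%type.
pose good (t : X) := [/\ A <= t.1.1.1, t.1.1.1 <= t.1.1.2, t.1.1.2 <= B, c <= t.1.2 &
  t.1.2 <= t.2 /\ t.2 <= d].
pose ctr (t : X) := contour U V t.1.1.1 t.1.1.2 t.1.2 t.2.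
pose step (s t : X) := [/\ s.1.1.1 <= t.1.1.1, t.1.1.2 <= s.1.1.2,
  s.1.2 <= t.1.2, t.2 <= s.2 & [/\ t.1.1.2 - t.1.1.1 = (s.1.1.2 - s.1.1.1) / 2,
  t.2 - t.1.2 = (s.2 - s.1.2) / 2 & `|ctr s| <= 4 * `|ctr t| ]].
have nxt (s : {t : X | good t}) : {t : {t : X | good t} | step (sval s) (sval t)}.
  apply: cid; case: s => -[[[a b] u] v] gs /=.
  have [/= g1 g2 g3 g4 [g5 g6]] := gs.
  have [|//|//|a' [b' [u' [v' [? ? ? [? [? ?]] [? ? ?]]]]]] := @contour_quarter U V a b u v.
    by move=> p q hp hq; apply: H; [exact: sub_bounds hp|exact: sub_bounds hq].
  have g' : good (a', b', u', v') by split; rewrite /=; [apply: le_trans g1 _| |apply: le_trans g3|apply: le_trans g4 _|split=> //; apply: le_trans g6].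
  by exists (exist _ _ g').
have g0 : good (A, B, c, d) by [].
have [f [f0 fS]] := dependent_choice nxt (exist _ _ g0).
pose t n := sval (f n).
have gt n : good (t n) := svalP (f n).
have mono n m : (n <= m)%N -> [/\ (t n).1.1.1 <= (t m).1.1.1, (t m).1.1.2 <= (t n).1.1.2,
    (t n).1.2 <= (t m).1.2 & (t m).2 <= (t n).2].
  elim: m => [|m IH]; first by rewrite leqn0 => /eqP->.
  rewrite leq_eqVlt => /predU1P[->//|/IH[h1 h2 h3 h4]].
  have [s1 s2 s3 s4 _] := fS m; split;
    [exact: le_trans h1 s1|exact: le_trans s2 h2|exact: le_trans h3 s3|exact: le_trans s4 h4].
have [p hp] : exists p, forall n, (t n).1.1.1 <= p <= (t n).1.1.2.
  apply: nested_intervals => [i j ij|i j ij|i].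
  - by have [] := mono i j ij.
  - by have [] := mono i j ij.
  - by have [] := gt i.
have [q hq] : exists q, forall n, (t n).1.2 <= q <= (t n).2.
  apply: nested_intervals => [i j ij|i j ij|i].
  - by have [] := mono i j ij.
  - by have [] := mono i j ij.
  - by have [_ _ _ _ []] := gt i.
have sz n : (t n).1.1.2 - (t n).1.1.1 + ((t n).2 - (t n).1.2) = (B - A + (d - c)) / 2 ^+ n /\
    `|contour U V A B c d| <= 4 ^+ n * `|ctr (t n)|.
  elim: n => [|n [IH1 IH2]].
    by rewrite !expr0 divr1 mul1r /t f0.
  have [_ _ _ _ [h1 h2 h3]] := fS n; split.
    by rewrite h1 h2 -mulrDl IH1 exprSr invfM mulrA.
  by rewrite (le_trans IH2)// exprSr -mulrA ler_pM2l// exprn_gt0.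
have crpq : cr_at U V p q.
  by apply: H; [have := hp 0%N|have := hq 0%N]; rewrite /t f0.
apply/eqP; rewrite -normr_eq0; apply/negPn/negP => K0'.
set K := `|contour U V A B c d| in K0'.
have K0 : 0 < K by rewrite lt_def K0' normr_ge0.
set L := B - A + (d - c).
have L0 : 0 <= L by rewrite /L; lra.
have e0 : 0 < K / 2 / (L ^+ 2 + 1).
  by rewrite divr_gt0// ?divr_gt0// ltr_wpDl// sqr_ge0.
have [r r0 hr] := contour_small crpq e0.
have [n hn] : exists n, L / 2 ^+ n <= r.
  have : (GRing.exp (2^-1 : R) x) @[x --> \oo] --> 0.
    by apply: cvg_expr; rewrite gtr0_norm//; lra.
  move=> /cvgrPdist_le/(_ (r / (L + 1)))[|n _ hn]; first by rewrite divr_gt0//; lra.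
  exists n; have := hn n (leqnn n); rewrite /= sub0r normrN ger0_norm ?exprn_ge0//.
  rewrite ler_pdivlMr; last lra.
  rewrite exprVn; apply: le_trans; rewrite mulrC ler_wpM2l ?invr_ge0 ?exprn_ge0//; lra.
have [s1 s2] := sz n; have [g1 g2 g3 g4 [g5 g6]] := gt n.
have := hr _ _ _ _ (hp n) (hq n); rewrite s1 => /(_ hn) H1.
have {}H1 : `|ctr (t n)| <= K / 2 / (L ^+ 2 + 1) * (L / 2 ^+ n) ^+ 2.
  apply: H1.
  - by move=> x; rewrite in_itv/= => hx; apply: (@cr_at_cvgV _ U); apply: H;
      [exact: sub_bounds hx|rewrite g4 (le_trans g5)].
  - by move=> x; rewrite in_itv/= => hx; apply: (@cr_at_cvgV _ U); apply: H;
      [exact: sub_bounds hx|rewrite g6 (le_trans g4)].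
  - by move=> x; rewrite in_itv/= => hx; apply: (@cr_at_cvgU _ _ V); apply: H;
      [rewrite g1 (le_trans g2)|exact: sub_bounds hx].
  - by move=> x; rewrite in_itv/= => hx; apply: (@cr_at_cvgU _ _ V); apply: H;
      [rewrite g3 (le_trans g1)|exact: sub_bounds hx].
have : K <= 4 ^+ n * (K / 2 / (L ^+ 2 + 1) * (L / 2 ^+ n) ^+ 2).
  by rewrite (le_trans s2)// ler_pM2l// exprn_gt0.
have e4 : (2 : R) ^+ 2 = 4 by ring.
rewrite expr_div_n -exprM mulnC exprM e4.
have n40 : (4 : R) ^+ n != 0 by rewrite expf_neq0.
have -> : 4 ^+ n * (K / 2 / (L ^+ 2 + 1) * (L ^+ 2 / 4 ^+ n)) = K / 2 * (L ^+ 2 / (L ^+ 2 + 1)).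
  by field; rewrite n40/= gt_eqF// ltr_wpDl// sqr_ge0.
apply/negP; rewrite -ltNge.
have : L ^+ 2 / (L ^+ 2 + 1) <= 1.
  by rewrite ler_pdivrMr ?mul1r ?lerDl// ltr_wpDl// sqr_ge0.
by move: K0; clear; move: (L ^+ 2 / _) => x; nra.
Qed.

End GoursatTheorem.

Section Removable.
Context {R : realType}.
Implicit Types (U V : R -> R -> R) (A B c d p q : R).

(** A square of half-side e around the exceptional point carries the whole
    integral, by [goursat] on the rest of the rectangle, and its contribution is at
    most a constant times e because the integrand is bounded there. *)
Lemma goursat_removable U V A B c d p q (K r : R) :
  A < p < B -> c < q < d ->
  (forall x y, A <= x <= B -> c <= y <= d -> (x != p) || (y != q) -> cr_at U V x y) ->
  0 < r ->
  (forall x y, `|x - p| <= r -> `|y - q| <= r -> `|U x y| <= K /\ `|V x y| <= K) ->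
  contour U V A B c d = 0.
Proof.
move=> /andP[Ap pB] /andP[cq qd] H r0 HK.
have AB : A <= B by lra.
have cd : c <= d by lra.
have K0 : 0 <= K.
  have [||+ _] := HK p q; [by rewrite subrr normr0 ltW..|].
  exact: le_trans.
have VE y : y != q -> c <= y <= d -> {in `[A, B], continuous (V^~ y)}.
  move=> yq ycd x; rewrite in_itv/= => xAB; apply: (@cr_at_cvgV _ U).
  by apply: H => //; rewrite yq orbT.
have UE x : x != p -> A <= x <= B -> {in `[c, d], continuous (U x)}.
  by move=> xp xAB y; rewrite in_itv/= => ycd; apply: (@cr_at_cvgU _ _ V); apply: H => //; rewrite xp.
have sub (a1 b1 a2 b2 : R) (f : R -> R) : a1 <= a2 -> b2 <= b1 ->
    {in `[a1, b1], continuous f} -> {in `[a2, b2], continuous f}.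
  move=> h1 h2 hf x; rewrite in_itv/= => /andP[? ?]; apply: hf.
  by rewrite in_itv/=; apply/andP; split; lra.
have zero A' B' c' d' : A <= A' -> A' <= B' -> B' <= B -> c <= c' -> c' <= d' -> d' <= d ->
    ((B' < p) || (p < A')) || ((d' < q) || (q < c')) -> contour U V A' B' c' d' = 0.
  move=> h1 h2 h3 h4 h5 h6 hpq; apply: goursat => // x y /andP[x1 x2] /andP[y1 y2]; apply: H.
  - by rewrite (le_trans h1 x1) (le_trans x2 h3).
  - by rewrite (le_trans h4 y1) (le_trans y2 h6).
  - rewrite -negb_and; apply/negP => /andP[/eqP xp /eqP yq]; subst x y.
    by move: hpq; rewrite !ltNge x1 x2 y1 y2.
have small e : 0 < e -> e <= r -> A <= p - e -> p + e <= B -> c <= q - e -> q + e <= d ->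
    `|contour U V A B c d| <= 8 * K * e.
  move=> e0 er h1 h2 h3 h4.
  have pe : p - e != p by move: e0; clear; lra.
  have pe' : p + e != p by move: e0; clear; lra.
  have qe : q - e != q by move: e0; clear; lra.
  have qe' : q + e != q by move: e0; clear; lra.
  have cq' : c != q by move: cq; clear; lra.
  have dq' : d != q by move: qd; clear; lra.
  have Ap' : A != p by move: Ap; clear; lra.
  have Bp' : B != p by move: pB; clear; lra.
  have a1 : p - e <= p + e by move: e0; clear; lra.
  have a2 : q - e <= q + e by move: e0; clear; lra.
  have a3 : p - e <= B by move: e0 pB; clear; lra.
  have a4 : A <= p + e by move: e0 Ap; clear; lra.
  have a5 : q - e <= d by move: e0 qd; clear; lra.
  have a6 : c <= q + e by move: e0 cq; clear; lra.
  have [Vc Vd] : {in `[A, B], continuous (V^~ c)} /\ {in `[A, B], continuous (V^~ d)}.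
    by split; apply: VE => //; rewrite lexx cd.
  have [Vc' Vd'] : {in `[A, B], continuous (V^~ (q - e))} /\
      {in `[A, B], continuous (V^~ (q + e))}.
    by split; apply: VE => //; rewrite ?h3 ?h4 ?a5 ?a6.
  have [UA UB] : {in `[c, d], continuous (U A)} /\ {in `[c, d], continuous (U B)}.
    by split; apply: UE => //; rewrite lexx AB.
  have [UA' UB'] : {in `[c, d], continuous (U (p - e))} /\
      {in `[c, d], continuous (U (p + e))}.
    by split; apply: UE => //; rewrite ?h1 ?h2 ?a3 ?a4.
  have lxx := @lexx _ R.
  rewrite (contour_catx h1 a3)// zero ?add0r//; last by rewrite ltrBlDr ltrDl e0.
  rewrite (contour_catx a1 h2)//; last 2 first.
  - exact: sub Vc.
  - exact: sub Vd.
  rewrite (zero (p + e))//; last by rewrite ltrDl e0 orbT.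
  rewrite addr0 (contour_caty h3 a5)//; try by apply: (sub A B).
  rewrite zero ?add0r//; last by rewrite [q - e < q]ltrBlDr ltrDl e0 !orbT.
  rewrite (contour_caty a2 h4)//; try by [apply: (sub A B)|apply: (sub c d)].
  rewrite (zero _ _ (q + e))//; last by rewrite [q < q + e]ltrDl e0 !orbT.
  rewrite addr0 /contour.
  have bd x y : p - e <= x <= p + e -> q - e <= y <= q + e -> `|U x y| <= K /\ `|V x y| <= K.
    move=> /andP[x1 x2] /andP[y1 y2]; apply: HK; rewrite ler_norml;
      [move: x1 x2 er|move: y1 y2 er]; clear; lra.
  have H1 : `|segint (fun x => V x (q - e) - V x (q + e)) (p - e) (p + e)
       - 0 * (p + e - (p - e))| <= 2 * K * (p + e - (p - e)).
    apply: segint_near_cst => //.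
      by apply: (sub A B) => // x xAB; apply: cvgB; [exact: Vc'|exact: Vd'].
    move=> x xpe; rewrite subr0 (le_trans (ler_normB _ _))// mulrDl mul1r lerD//.
    - by have [] := bd x (q - e) xpe; rewrite ?lxx ?a2.
    - by have [] := bd x (q + e) xpe; rewrite ?lxx ?a2.
  have H2 : `|segint (fun y => U (p + e) y - U (p - e) y) (q - e) (q + e)
       - 0 * (q + e - (q - e))| <= 2 * K * (q + e - (q - e)).
    apply: segint_near_cst => //.
      by apply: (sub c d) => // x xAB; apply: cvgB; [exact: UB'|exact: UA'].
    move=> x xpe; rewrite subr0 (le_trans (ler_normB _ _))// mulrDl mul1r lerD//.
    - by have [] := bd (p + e) x _ xpe; rewrite ?lxx ?a1.
    - by have [] := bd (p - e) x _ xpe; rewrite ?lxx ?a1.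
  apply: (le_trans (ler_normD _ _)); move: H1 H2; clear; rewrite !mul0r !subr0.
  move: `|_| `|_| => X Y; nra.
apply/eqP; rewrite -normr_eq0; apply/negPn/negP => K0'.
set L := `|contour U V A B c d| in K0' small.
have L0 : 0 < L by rewrite lt_def K0' normr_ge0.
have K1 : 0 < 8 * K + 1 by lra.
(* small enough for the square to fit and for its contribution to be below L *)
pose e := Num.min (Num.min r (L / 2 / (8 * K + 1)))
  (Num.min (Num.min (p - A) (B - p)) (Num.min (q - c) (d - q))).
have e0 : 0 < e.
  by rewrite !lt_min r0 !subr_gt0 Ap pB cq qd !andbT/= !divr_gt0.
have : e <= e by [].
rewrite {2}/e !le_min -!andbA => /and5P[e1 + e3 e4 /andP[e5 e6]].
rewrite ler_pdivlMr// => e2.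
have : 8 * K * e < L by move: e0 e2 L0; clear; lra.
apply/negP; rewrite -leNgt; apply: small => //.
- by rewrite lerBrDr addrC -lerBrDr.
- by rewrite -lerBrDl.
- by rewrite lerBrDr addrC -lerBrDr.
- by rewrite -lerBrDl.
Qed.

End Removable.

(** * Complex derivatives in real coordinates *)

Section ComplexBridge.
Context {R : realType}.
Implicit Types (z s : R[i]) (f g : R[i] -> R[i]).

Lemma normC_modulus z : `|z| = (modulus z)%:C.
Proof. by []. Qed.

Lemma modulus_ge0 z : 0 <= modulus z.
Proof. by rewrite -ler0c -normC_modulus. Qed.

Lemma modulus_Re z : `|complex.Re z| <= modulus z.
Proof. by rewrite -lecR -normC_modulus; exact: normc_ge_Re. Qed.

Lemma modulus_Im z : `|complex.Im z| <= modulus z.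
Proof.
case: z => a b /=; rewrite /modulus /= -(sqrtr_sqr b).
by rewrite ler_wsqrtr// lerDr sqr_ge0.
Qed.

Lemma modulusM z s : modulus (z * s) = modulus z * modulus s.
Proof. by rewrite /modulus ComplexField.Normc.normcM. Qed.

Lemma modulusV z : modulus z^-1 = (modulus z)^-1.
Proof. by rewrite /modulus ComplexField.Normc.normcV. Qed.

Lemma modulusD z s : modulus (z + s) <= modulus z + modulus s.
Proof. exact: le_normcD. Qed.

Lemma modulusN z : modulus (- z) = modulus z.
Proof. exact: normcN. Qed.

Lemma modulus_sqr z : modulus z ^+ 2 = complex.Re z ^+ 2 + complex.Im z ^+ 2.
Proof. by case: z => a b; rewrite /modulus/= sqr_sqrtr// addr_ge0 ?sqr_ge0. Qed.

Lemma modulus_real (x : R) : modulus x%:C = `|x|.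
Proof. by rewrite /modulus/= expr0n addr0 sqrtr_sqr. Qed.

Lemma modulus_imag (y : R) : modulus (0 +i* y) = `|y|.
Proof. by rewrite /modulus/= expr0n add0r sqrtr_sqr. Qed.

Lemma modulus_le_sum (x y : R) : modulus (x +i* y) <= `|x| + `|y|.
Proof.
have -> : x +i* y = x%:C + (0 +i* y) by apply/eqP; rewrite eq_complex/= addr0 add0r !eqxx.
by rewrite (le_trans (modulusD _ _))// modulus_real modulus_imag.
Qed.

Lemma modulus0_eq0 z : modulus z = 0 -> z = 0.
Proof. exact: ComplexField.Normc.eq0_normc. Qed.

Lemma modulus_gt0 z : (0 < modulus z) = (z != 0).
Proof. by rewrite -ltcR -normC_modulus normr_gt0. Qed.

Definition holomorphic_at f s := derivable (f : R[i]^o -> R[i]^o) s 1.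

(** Stating the derivative without a quotient keeps the estimate valid at
    [z = s], which matters for the removable singularity of a difference quotient. *)
Definition has_cderiv f s (l : R[i]) := forall e : R, 0 < e ->
  exists2 r : R, 0 < r & forall z, modulus (z - s) <= r ->
    modulus (f z - f s - l * (z - s)) <= e * modulus (z - s).

Lemma holomorphic_cderiv f s : holomorphic_at f s -> exists l, has_cderiv f s l.
Proof.
move=> /cvg_ex[/= l /cvgrPdist_le H]; exists l => e e0.
have [|/= d d0 Hd] := H e%:C; first by rewrite ltcR.
have [d1 dE] : 0 < complex.Re d /\ d = (complex.Re d)%:C.
  move: d0; rewrite /= ltcE/= => /andP[/eqP dI ?]; split=> //.
  by case: (d) dI => u v /= ->.
exists (complex.Re d / 2); first by rewrite divr_gt0.
move=> z zr; have [->|zs] := eqVneq z s.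
  by rewrite !subrr mulr0 subrr /modulus ComplexField.Normc.normc0 mulr0.
have t0 : z - s != 0 by rewrite subr_eq0.
have := Hd (z - s); rewrite /ball_/= sub0r normrN normC_modulus.
have -> : ((modulus (z - s))%:C < d) by rewrite dE ltcR; lra.
move=> /(_ isT t0); rewrite /= scaler1 subrK => H1.
have {}H1 : modulus (l - (z - s)^-1 * (f z - f s)) <= e by rewrite -lecR.
have -> : f z - f s - l * (z - s) = - ((z - s) * (l - (z - s)^-1 * (f z - f s))).
  by field.
by rewrite modulusN modulusM mulrC ler_wpM2r// modulus_ge0.
Qed.

Lemma cderiv_cr f p q l : has_cderiv f (p +i* q) l ->
  cr_at (fun x y => complex.Re (f (x +i* y))) (fun x y => complex.Im (f (x +i* y))) p q.
Proof.
case: l => a b H; exists a, b => e e0; have [r r0 Hr] := H e e0.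
exists (r / 2); first by rewrite divr_gt0.
move=> x y xr yr.
have hs : modulus ((x +i* y) - (p +i* q)) <= `|x - p| + `|y - q|.
  exact: modulus_le_sum.
have := Hr (x +i* y); have -> : modulus ((x +i* y) - (p +i* q)) <= r by lra.
move=> /(_ isT) H1.
have {}H1 : modulus (f (x +i* y) - f (p +i* q) -
    (a +i* b) * ((x +i* y) - (p +i* q))) <= e * (`|x - p| + `|y - q|).
  by rewrite (le_trans H1)// ler_pM2l.
split.
- rewrite (le_trans _ H1)// (le_trans _ (modulus_Re _))// le_eqVlt; apply/orP; left; apply/eqP.
  congr `|_|; case: (f (x +i* y)) => u1 v1; case: (f (p +i* q)) => u2 v2 /=; ring.
- rewrite (le_trans _ H1)// (le_trans _ (modulus_Im _))// le_eqVlt; apply/orP; left; apply/eqP.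
  congr `|_|; case: (f (x +i* y)) => u1 v1; case: (f (p +i* q)) => u2 v2 /=; ring.
Qed.

Lemma holomorphic_cr f p q : holomorphic_at f (p +i* q) ->
  cr_at (fun x y => complex.Re (f (x +i* y))) (fun x y => complex.Im (f (x +i* y))) p q.
Proof. by move=> /holomorphic_cderiv[l /cderiv_cr]. Qed.

Lemma holomorphic_cst (k : R[i]) s : holomorphic_at (fun=> k) s.
Proof. exact: derivable_cst. Qed.

Lemma holomorphic_id s : holomorphic_at id s.
Proof. exact: derivable_id. Qed.

Lemma holomorphicD f g s : holomorphic_at f s -> holomorphic_at g s ->
  holomorphic_at (fun z => f z + g z) s.
Proof. exact: derivableD. Qed.

Lemma holomorphicB f g s : holomorphic_at f s -> holomorphic_at g s ->
  holomorphic_at (fun z => f z - g z) s.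
Proof. exact: derivableB. Qed.

Lemma holomorphicM f g s : holomorphic_at f s -> holomorphic_at g s ->
  holomorphic_at (fun z => f z * g z) s.
Proof. exact: (@derivableM R[i] R[i]^o). Qed.

Lemma holomorphicV f s : f s != 0 -> holomorphic_at f s ->
  holomorphic_at (fun z => (f z)^-1) s.
Proof. exact: (@derivableV R[i] R[i]^o). Qed.

End ComplexBridge.

(** * Integrable and square-integrable functions on the line *)

Section RealIntegral.
Context {R : realType}.
Local Notation mu := (@lebesgue_measure R).
Implicit Types (f g h : R -> R).

(** The computations with integrals over the line involve finite quantities only;
    they are carried out on total real-valued functions, away from the extended
    reals. *)
Definition L1 f := mu.-integrable setT (EFin \o f).
Definition rint f : R := \int[mu]_x f x.
Definition mble f := measurable_fun [set: R] f.

Lemma L1_mble f : L1 f -> mble f.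
Proof. by move=> /integrableP[/measurable_EFinP]. Qed.

Lemma mble_continuous f : continuous f -> mble f.
Proof. exact: continuous_measurable_fun. Qed.

Lemma mbleD f g : mble f -> mble g -> mble (fun x => f x + g x).
Proof. exact: measurable_funD. Qed.

Lemma mbleB f g : mble f -> mble g -> mble (fun x => f x - g x).
Proof. exact: measurable_funB. Qed.

Lemma mbleM f g : mble f -> mble g -> mble (fun x => f x * g x).
Proof. exact: measurable_funM. Qed.

Lemma mbleZ (k : R) f : mble f -> mble (fun x => k * f x).
Proof. by move=> mf; apply: mbleM => //; exact: measurable_cst. Qed.

Lemma mble_sqr f : mble f -> mble (fun x => f x ^+ 2).
Proof. exact: measurable_funX. Qed.

Lemma L1_le f g : mble f -> (forall x, `|f x| <= g x) -> L1 g -> L1 f.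
Proof.
move=> mf fg; apply: le_integrable => //; first exact/measurable_EFinP.
by move=> x _ /=; rewrite lee_fin (le_trans (fg x))// ler_norm.
Qed.

Lemma L1D f g : L1 f -> L1 g -> L1 (fun x => f x + g x).
Proof.
move=> f1 g1; have := integrableD measurableT f1 g1.
by apply: eq_integrable => // x _.
Qed.

Lemma L1Z (k : R) f : L1 f -> L1 (fun x => k * f x).
Proof.
move=> f1; have := integrableZl measurableT k f1.
by apply: eq_integrable => // x _.
Qed.

Lemma L1N f : L1 f -> L1 (fun x => - f x).
Proof. by move=> /(L1Z (-1)); apply: eq_integrable => // x _ /=; rewrite mulN1r. Qed.

Lemma L1B f g : L1 f -> L1 g -> L1 (fun x => f x - g x).
Proof. by move=> f1 g1; apply: L1D => //; exact: L1N. Qed.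

Lemma L1_norm f : L1 f -> L1 (fun x => `|f x|).
Proof. by move=> /integrable_norm; apply: eq_integrable => // x _. Qed.

Lemma rintD f g : L1 f -> L1 g -> rint (fun x => f x + g x) = rint f + rint g.
Proof. by move=> f1 g1; exact: RintegralD. Qed.

Lemma rintB f g : L1 f -> L1 g -> rint (fun x => f x - g x) = rint f - rint g.
Proof. by move=> f1 g1; exact: RintegralB. Qed.

Lemma rintZ (k : R) f : L1 f -> rint (fun x => k * f x) = k * rint f.
Proof. by move=> f1; exact: RintegralZl. Qed.

Lemma eq_rint f g : f =1 g -> rint f = rint g.
Proof. by move=> fg; apply: eq_Rintegral => x _. Qed.

Lemma le_rint f g : L1 f -> L1 g -> (forall x, f x <= g x) -> rint f <= rint g.
Proof. by move=> f1 g1 fg; apply: le_Rintegral. Qed.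

Lemma rint_ge0 f : (forall x, 0 <= f x) -> 0 <= rint f.
Proof. by move=> f0; apply: Rintegral_ge0. Qed.

Lemma le_norm_rint f g : L1 f -> L1 g -> (forall x, `|f x| <= g x) -> `|rint f| <= rint g.
Proof.
move=> f1 g1 fg; apply: (le_trans (le_normr_Rintegral _ _)) => //.
by apply: le_rint => //; exact: L1_norm.
Qed.

Lemma EFin_rint f : L1 f -> (\int[mu]_x (f x)%:E)%E = (rint f)%:E.
Proof. by move=> f1; rewrite /rint /Rintegral fineK//; exact: integrable_fin_num. Qed.

Lemma L1_ge0 f : mble f -> (forall x, 0 <= f x) -> (\int[mu]_x (f x)%:E < +oo)%E -> L1 f.
Proof.
move=> mf f0 foo; apply/integrableP; split; first exact/measurable_EFinP.
by under eq_integral do rewrite /= ger0_norm//.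
Qed.

Lemma rint_le f (M : R) : L1 f -> (\int[mu]_x (f x)%:E <= M%:E)%E -> rint f <= M.
Proof. by move=> f1; rewrite EFin_rint// lee_fin. Qed.

Definition L2 f := mble f /\ L1 (fun x => f x ^+ 2).

Lemma L2_mble f : L2 f -> mble f. Proof. by case. Qed.

Lemma L2_sqr f : L2 f -> L1 (fun x => f x ^+ 2). Proof. by case. Qed.

Lemma ltoo_L2 f (M : R) : mble f -> (\int[mu]_x (f x ^+ 2)%:E <= M%:E)%E -> L2 f.
Proof.
move=> mf fM; split=> //; apply: L1_ge0 => //; first exact: mble_sqr.
  by move=> x; exact: sqr_ge0.
by rewrite (le_lt_trans fM)// ltry.
Qed.

Lemma L2M f g : L2 f -> L2 g -> L1 (fun x => f x * g x).
Proof.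
move=> [mf f2] [mg g2]; apply: (L1_le _ _ (L1D f2 g2)); first exact: mbleM.
move=> x; rewrite ler_norml; have := sqr_ge0 (f x - g x); have := sqr_ge0 (f x + g x).
have := sqr_ge0 (f x); have := sqr_ge0 (g x); nra.
Qed.

Lemma L2Z (k : R) f : L2 f -> L2 (fun x => k * f x).
Proof.
move=> [mf f2]; split; first exact: mbleZ.
by under eq_fun do rewrite exprMn; exact: L1Z.
Qed.

Lemma L2D f g : L2 f -> L2 g -> L2 (fun x => f x + g x).
Proof.
move=> Lf Lg; have [mf f2] := Lf; have [mg g2] := Lg; split; first exact: mbleD.
under eq_fun do rewrite sqrrD -mulr_natl.
by apply: L1D => //; apply: L1D => //; apply: L1Z; exact: L2M.
Qed.

Lemma L2N f : L2 f -> L2 (fun x => - f x).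
Proof. by move=> /(L2Z (-1)); under eq_fun do rewrite mulN1r. Qed.

Lemma L2B f g : L2 f -> L2 g -> L2 (fun x => f x - g x).
Proof. by move=> Lf Lg; apply: L2D => //; exact: L2N. Qed.

Lemma rint_sqrB f g : L2 f -> L2 g -> rint (fun x => (f x - g x) ^+ 2) =
  rint (fun x => f x ^+ 2) - 2 * rint (fun x => f x * g x) + rint (fun x => g x ^+ 2).
Proof.
move=> Lf Lg; rewrite -rintZ; last exact: L2M.
rewrite -rintB; [|exact: L2_sqr|by apply: L1Z; exact: L2M].
rewrite -rintD; [by apply: eq_rint => x; ring| |exact: L2_sqr].
by apply: L1B; [exact: L2_sqr|apply: L1Z; exact: L2M].
Qed.

Lemma cauchy_schwarz f g : L2 f -> L2 g ->
  rint (fun x => f x * g x) ^+ 2 <= rint (fun x => f x ^+ 2) * rint (fun x => g x ^+ 2).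
Proof.
move=> Lf Lg; set a := rint (fun x => f x ^+ 2); set b := rint (fun x => g x ^+ 2).
set c := rint _.
have H (t : R) : 0 <= a - 2 * (t * c) + t ^+ 2 * b.
  have -> : a - 2 * (t * c) + t ^+ 2 * b = rint (fun x => (f x - t * g x) ^+ 2).
    rewrite rint_sqrB//; last exact: L2Z.
    congr (_ - 2 * _ + _).
      by rewrite -rintZ; [apply: eq_rint => x; ring|exact: L2M].
    by rewrite -rintZ; [apply: eq_rint => x; ring|exact: L2_sqr].
  by apply: rint_ge0 => x; exact: sqr_ge0.
have a0 : 0 <= a by apply: rint_ge0 => x; exact: sqr_ge0.
have b0 : 0 <= b by apply: rint_ge0 => x; exact: sqr_ge0.
have [bE|b1] := eqVneq b 0.
  have [->|c1] := eqVneq c 0; first by rewrite expr0n mulr_ge0.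
  have := H ((a + 1) / (2 * c)); rewrite bE mulr0 addr0.
  have -> : 2 * ((a + 1) / (2 * c) * c) = a + 1 by field.
  lra.
have b2 : 0 < b by rewrite lt_def b1.
have := H (c / b).
have -> : a - 2 * (c / b * c) + (c / b) ^+ 2 * b = (a * b - c ^+ 2) / b by field.
by rewrite pmulr_lge0 ?invr_gt0// subr_ge0.
Qed.

End RealIntegral.

(** * The Poisson kernel *)

Section Kernel.
Context {R : realType}.
Local Notation mu := (@lebesgue_measure R).

(** [x / pi * kernel x w0] is the Poisson kernel of a half-plane for a point
    at distance x from the boundary line and at height w0. *)
Definition kernel (x w0 w : R) : R := (x ^+ 2 + (w - w0) ^+ 2)^-1.

Lemma kernel_den_gt0 (x w0 w : R) : 0 < x -> 0 < x ^+ 2 + (w - w0) ^+ 2.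
Proof. by move=> x0; rewrite ltr_pwDl ?sqr_ge0 ?exprn_gt0. Qed.

Lemma kernel_ge0 (x w0 w : R) : 0 <= kernel x w0 w.
Proof. by rewrite invr_ge0 addr_ge0 ?sqr_ge0. Qed.

Lemma kernel_le (x w0 w : R) : 0 < x -> kernel x w0 w <= (x ^+ 2)^-1.
Proof.
move=> x0; rewrite /kernel lef_pV2 ?posrE ?exprn_gt0 ?kernel_den_gt0//.
by rewrite lerDl sqr_ge0.
Qed.

Lemma continuous_kernel (x w0 : R) : 0 < x -> continuous (kernel x w0).
Proof.
move=> x0 w; apply: cvgV; first by rewrite gt_eqF// kernel_den_gt0.
apply: cvgD; first exact: cvg_cst.
have c : (fun w => w - w0) @ w --> w - w0 by apply: cvgB; [exact: cvg_id|exact: cvg_cst].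
by rewrite expr2; under eq_fun do rewrite expr2; apply: cvgM.
Qed.

Lemma integral_inv1D_sqr :
  (\int[mu]_t ((1 + t ^+ 2)^-1 : R)%:E)%E = (pi : R)%:E.
Proof.
have ge0 (t : R) : 0 <= (1 + t ^+ 2)^-1 by rewrite invr_ge0 addr_ge0 ?sqr_ge0.
have cG : continuous (fun t : R => (1 + t ^+ 2)^-1).
  have := @continuous_kernel 1 0 ltr01; rewrite /kernel expr1n.
  by under eq_fun do rewrite subr0.
rewrite ge0_symfun_integralT//; last by move=> t /=; rewrite sqrrN.
rewrite -set_itvcy (@ge0_continuous_FTC2y _ _ atan 0 (pi / 2))//.
- by rewrite atan0 sube0 -EFinM; congr (_ %:E); field.
- exact: continuous_subspaceT.
- exact: cvgy_atan.
- by apply: cvg_at_right_filter; exact: continuous_atan.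
- by move=> t _; rewrite derive1_atan.
Qed.

Lemma integral_kernel (x w0 : R) : 0 < x ->
  (\int[mu]_w (kernel x w0 w)%:E)%E = (pi / x)%:E.
Proof.
move=> x0; pose F (t : R) := x^-1 * (t - w0).
pose G (t : R) : R := (1 + t ^+ 2)^-1.
have dF (t : R) : is_derive t 1 F x^-1.
  by rewrite /F; apply: is_derive_eq; rewrite subr0 [_ *: _]mulr1.
have F'E : F^`()%classic = cst x^-1.
  by apply/funext => t; rewrite derive1E; have [_ ->] := dF t.
have ge0 (t : R) : 0 <= G t by rewrite invr_ge0 addr_ge0 ?sqr_ge0.
have cG : continuous G.
  have := @continuous_kernel 1 0 ltr01; rewrite /kernel expr1n /G.
  by under eq_fun do rewrite subr0.
have H := @increasing_ge0_integration_by_substitutionT R F G.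
have {}H : (\int[mu]_t (G t)%:E = \int[mu]_t (((G \o F) * F^`()%classic) t)%:E)%E.
  apply: H => //.
  - by move=> s t st; rewrite /F ltr_pM2l ?invr_gt0// ltrD2r.
  - by rewrite F'E => t; exact: cvg_cst.
  - by rewrite F'E; exact: is_cvg_cst.
  - by rewrite F'E; exact: is_cvg_cst.
  - apply/cvgrNyPle => A; near=> t.
    have : t <= x * A + w0 by near: t; apply: nbhs_ninfty_le; exact: num_real.
    by rewrite -lerBlDr /F ler_pdivrMl.
  - apply/cvgryPge => A; near=> t.
    have : x * A + w0 <= t by near: t; apply: nbhs_pinfty_ge; exact: num_real.
    by rewrite -lerBrDr /F ler_pdivlMl.
transitivity (x^-1%:E * \int[mu]_t (G t)%:E)%E; last first.
  by rewrite integral_inv1D_sqr -EFinM mulrC.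
have E : (\int[mu]_t (G t)%:E = \int[mu]_t (G (F t) * x^-1)%:E)%E.
  by rewrite H; apply: eq_integral => t _; rewrite -[x^-1]/(cst x^-1 t) -F'E.
rewrite {H}E -ge0_integralZl//; last 3 first.
- apply/measurable_EFinP; apply: (@mble_continuous R (fun t => G (F t) * x^-1)) => t.
  apply: cvgM; last exact: cvg_cst.
  apply: continuous_comp; last exact: cG.
  by apply: cvgM; [exact: cvg_cst|apply: cvgB; [exact: cvg_id|exact: cvg_cst]].
- by move=> t _; rewrite lee_fin mulr_ge0// invr_ge0 ltW.
- by rewrite lee_fin invr_ge0 ltW.
apply: eq_integral => t _; rewrite -EFinM; congr (_ %:E).
rewrite /kernel /G /F.
field; rewrite gt_eqF//= gt_eqF ?kernel_den_gt0//.
Unshelve. all: by end_near. Qed.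

Lemma L1_kernel (x w0 : R) : 0 < x -> L1 (kernel x w0).
Proof.
move=> x0; apply: L1_ge0 => [| t|]; last by rewrite integral_kernel// ltry.
- by apply: mble_continuous; exact: continuous_kernel.
- exact: kernel_ge0.
Qed.

Lemma rint_kernel (x w0 : R) : 0 < x -> rint (kernel x w0) = pi / x.
Proof. by move=> x0; rewrite /rint /Rintegral integral_kernel. Qed.

End Kernel.

(** * Moving a line of integration *)

Section Plane.
Context {R : realType}.
Local Notation mu := (@lebesgue_measure R).

(** The measurable sets of the plane are generated by products, and an open set is
    the union of the rectangles with rational corners that it contains. *)
Lemma open_measurable_plane (O : set (R * R)) : open O -> measurable O.
Proof.
move=> oO.
pose box (q : rat * rat * rat * rat) : set (R * R) :=
  `]ratr q.1.1.1, ratr q.1.1.2[ `*` `]ratr q.1.2, ratr q.2[.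
pose F q := if pselect (box q `<=` O) then box q else set0.
have -> : O = \bigcup_q F q.
  apply/seteqP; split=> [z Oz|z [q _]]; last first.
    by rewrite /F; case: pselect => // sub /sub.
  move: oO; rewrite openE => /(_ _ Oz); rewrite /interior /= => -[[A B] /= [Az Bz] AB].
  move: Az Bz; rewrite -!nbhs_ballE => -[/= r r0 rA] [/= s s0 sB].
  have [a /andP[]] : exists q : rat, ratr q \in `]z.1 - r, z.1[.
    by apply: rat_in_itvoo; lra.
  rewrite !bnd_simp => a1 a2.
  have [b /andP[]] : exists q : rat, ratr q \in `]z.1, z.1 + r[.
    by apply: rat_in_itvoo; lra.
  rewrite !bnd_simp => b1 b2.
  have [c /andP[]] : exists q : rat, ratr q \in `]z.2 - s, z.2[.
    by apply: rat_in_itvoo; lra.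
  rewrite !bnd_simp => c1 c2.
  have [d /andP[]] : exists q : rat, ratr q \in `]z.2, z.2 + s[.
    by apply: rat_in_itvoo; lra.
  rewrite !bnd_simp => d1 d2.
  exists (a, b, c, d) => //; rewrite /F; case: pselect => [?|[]].
    by split; rewrite /= in_itv/=; apply/andP.
  move=> [x y] [/=]; rewrite !in_itv/= => /andP[x1 x2] /andP[y1 y2].
  by apply: AB; split=> /=; [apply: rA|apply: sB]; rewrite /ball/= ltr_norml; lra.
apply: countable_bigcupT_measurable => // q; rewrite /F; case: pselect => ? /=; last exact: measurable0.
by apply: measurableX; exact: measurable_itv.
Qed.

Lemma continuous_measurable_plane (f : R * R -> R) : continuous f ->
  measurable_fun setT f.
Proof.
move=> /continuousP cf; apply: (measurability _ (RGenOpens.measurableE R)).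
move=> _ [_ [a [b ->] <-]]; rewrite setTI; apply: open_measurable_plane.
exact/cf/interval_open.
Qed.

Lemma integral_itv_cst (a b M : R) : a < b ->
  (\int[mu]_(x in `[a, b]) M%:E = (M * (b - a))%:E)%E.
Proof.
by move=> ab; rewrite integral_cst//= lebesgue_measure_itv/= lte_fin ab.
Qed.

(** By Tonelli the double integral of Phi over [a, b] x S is at most M (b - a); it
    would be infinite if all horizontal slices over the infinite set S had an
    integral greater than 1. *)
Lemma small_slice (Phi : R * R -> R) (a b M : R) (S : set R) :
  measurable_fun setT Phi -> (forall z, 0 <= Phi z) -> a < b ->
  (forall x, a <= x <= b -> (\int[mu]_y (Phi (x, y))%:E <= M%:E)%E) ->
  measurable S -> mu S = +oo%E ->
  exists2 Y, S Y & (\int[mu]_(x in `[a, b]) (Phi (x, Y))%:E <= 1)%E.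
Proof.
move=> mPhi Phi0 ab HM mS Soo; apply: contrapT => H.
have {}H Y : S Y -> (1 < \int[mu]_(x in `[a, b]) (Phi (x, Y))%:E)%E.
  by move=> SY; rewrite ltNge; apply/negP => le; apply: H; exists Y.
pose f (z : R * R) : \bar R := (Phi z * \1_(`[a, b]%classic) z.1)%:E.
have f0 z : (0 <= f z)%E by rewrite lee_fin mulr_ge0// indicE.
have mf : measurable_fun setT f.
  apply/measurable_EFinP; apply: measurable_funM => //.
  by apply: measurableT_comp => //; exact: measurable_indic.
have sliceE Y : (\int[mu]_x f (x, Y) = \int[mu]_(x in `[a, b]) (Phi (x, Y))%:E)%E.
  rewrite [RHS]integral_mkcond; apply: eq_integral => x _ /=.
  rewrite /f /= patchE indicE; case: ifPn => _; rewrite ?mulr1 ?mulr0//.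
have up : (\int[mu]_x \int[mu]_y f (x, y) <= (M * (b - a))%:E)%E.
  rewrite -integral_itv_cst//.
  rewrite [leRHS]integral_mkcond; apply: ge0_le_integral => //.
  - by move=> x _; apply: integral_ge0 => y _.
  - exact: measurable_fun_fubini_tonelli_F.
  - by apply/(measurable_restrictT _ _).1.
  - move=> x _ /=; rewrite patchE; case: ifPn => xab.
      apply: le_trans (HM x _); last by move: xab; rewrite inE/= in_itv.
      apply: ge0_le_integral => //.
      + exact: (measurableT_comp mf (pair1_measurable x)).
      + apply/measurable_EFinP; exact: (measurableT_comp mPhi (pair1_measurable x)).
      + by move=> y _; rewrite /f /= indicE xab mulr1.
    by rewrite integral0_eq// => y _; rewrite /f /= indicE (negbTE xab) mulr0.
have lo : (+oo <= \int[mu]_y \int[mu]_x f (x, y))%E.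
  rewrite -Soo -[mu S]mul1e -integral_cst// integral_mkcond.
  apply: ge0_le_integral => //.
  - by move=> y _; rewrite patchE; case: ifP.
  - by apply/(measurable_restrictT _ _).1.
  - exact: measurable_fun_fubini_tonelli_G.
  - move=> y _ /=; rewrite patchE; case: ifPn => [yS|_]; last exact: integral_ge0.
    by rewrite sliceE ltW// H// -inE.
by move: lo; rewrite -(@fubini_tonelli _ _ _ _ _ mu mu f mf f0) => /le_trans/(_ up).
Qed.

End Plane.

Section Tails.
Context {R : realType}.
Local Notation mu := (@lebesgue_measure R).
Implicit Types f : R -> R.

Lemma rint_cvg0 (f_ : nat -> R -> R) (g : R -> R) : (forall n, mble (f_ n)) -> L1 g ->
  (forall n x, `|f_ n x| <= g x) -> (forall x, f_ n x @[n --> \oo] --> 0) ->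
  rint (f_ n) @[n --> \oo] --> 0.
Proof.
move=> mf g1 fg f0.
have H := @dominated_cvg _ _ _ mu setT measurableT
  (fun n x => (f_ n x)%:E) (cst 0%E) (EFin \o g).
have {}H : (\int[mu]_x (f_ n x)%:E)%E @[n --> \oo] --> (\int[mu]_x (cst 0 x))%E.
  apply: H => //.
  - by move=> n; apply/measurable_EFinP; exact: mf.
  - by move=> x _; apply: cvg_EFin; [exact: nearW|exact: f0].
  - by move=> n x _; rewrite /= lee_fin.
move: H; rewrite integral0 => /fine_cvg; apply: cvg_trans.
by apply: near_eq_cvg; apply: nearW.
Qed.

Lemma segint_rint f a b : segint f a b = rint (f \_ `[a, b]).
Proof. by rewrite /segint Rintegral_mkcond. Qed.

Lemma segint_cvg f : L1 f -> forall e : R, 0 < e -> exists2 N : R, 0 < N &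
  forall Y1 Y2, N <= Y1 -> N <= Y2 -> `|rint f - segint f (- Y1) Y2| <= e.
Proof.
move=> f1 e e0.
pose g n := (fun x => `|f x|) \_ (~` `[- n%:R, n%:R]).
have mg n : mble (g n).
  apply/(measurable_restrictT _ _).1; first exact: measurableC.
  exact: measurable_funTS (L1_mble (L1_norm f1)).
have : rint (g n) @[n --> \oo] --> 0.
  apply: (rint_cvg0 mg (L1_norm f1)) => [n x|x].
    by rewrite /g patchE; case: ifP => _; rewrite ?normr_id ?normr0.
  apply/cvgrPdist_le => /= d d0; near=> n.
  rewrite sub0r normrN /g patchE memNset ?normr0 ?ltW//=.
  have xn : `|x| <= n%:R by near: n; exact: nbhs_infty_ger.
  by move=> /(_ _); apply; rewrite /= in_itv/= -ler_norml.
move=> /cvgrPdist_le/(_ e e0)[n _ /(_ n (leqnn n))].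
rewrite /= sub0r normrN => gn.
exists n.+1%:R => // Y1 Y2 nY1 nY2.
have mI := measurable_itv `[- Y1, Y2].
have i1 : L1 (f \_ `[- Y1, Y2]).
  apply: (L1_le _ _ (L1_norm f1)).
    by apply/(measurable_restrictT _ _).1 => //; exact: measurable_funTS (L1_mble f1).
  by move=> x; rewrite patchE; case: ifP => _; rewrite ?normr0.
rewrite segint_rint -rintB//; apply: (le_trans _ (le_trans (ler_norm _) gn)).
apply: le_norm_rint; first exact: L1B.
  apply: (L1_le (mg n) _ (L1_norm f1)) => x.
  by rewrite /g patchE; case: ifP => _; rewrite ?normr_id ?normr0.
move=> x; rewrite /g !patchE; case: (boolP (x \in `[- Y1, Y2]%classic)) => h1.
  by rewrite subrr normr0; case: ifP.
case: ifPn => [_|h2]; first by rewrite subr0.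
exfalso; move: h1; rewrite notin_setE; apply.
move: h2; rewrite notin_setE => /contrapT; rewrite /= !in_itv/= => /andP[a1 a2].
have : n%:R <= n.+1%:R :> R by rewrite ler_nat.
lra.
Unshelve. all: by end_near. Qed.

End Tails.

Section LineShift.
Context {R : realType}.
Local Notation mu := (@lebesgue_measure R).

Lemma infinite_halflines (N : R) :
  mu `[N, +oo[ = +oo%E /\ mu `]-oo, N] = +oo%E.
Proof. by rewrite !lebesgue_measure_itv/= ltry ltNyr. Qed.

(** Cauchy's theorem on a vertical strip. A function bounded in mean square on
    vertical lines need not tend to zero uniformly at infinity, so the horizontal
    sides are placed at heights provided by [small_slice], where they are O(1 / |y|).
    In the applications U + i V is F or F minus a constant, divided by a polynomial,
    and Phi is |F|^2. *)
Lemma line_shift (U V : R -> R -> R) (Phi : R * R -> R) (a b M N0 k : R) : a < b ->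
  continuous Phi -> (forall z, 0 <= Phi z) ->
  (forall x, a <= x <= b -> (\int[mu]_y (Phi (x, y))%:E <= M%:E)%E) ->
  (forall c d, c < - N0 -> N0 < d -> contour U V a b c d = 0) ->
  0 < N0 ->
  (forall x y, a <= x <= b -> N0 < `|y| -> `|V x y| <= k / `|y| * (1 + Phi (x, y))) ->
  (forall y, N0 < `|y| -> {in `[a, b], continuous (V^~ y)}) ->
  continuous (U a) -> continuous (U b) -> L1 (U a) -> L1 (U b) ->
  rint (U a) = rint (U b).
Proof.
move=> ab cPhi Phi0 HM ctr N00 HV cV cUa cUb Ua Ub.
have slice := small_slice (continuous_measurable_plane cPhi) Phi0 ab HM.
pose cst1 := (b - a + 1) * `|k|.
have cst10 : 0 <= cst1 by rewrite mulr_ge0//; lra.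
(* at a height where the slice of Phi has an integral at most 1 *)
have side y : N0 < `|y| -> (\int[mu]_(x in `[a, b]) (Phi (x, y))%:E <= 1)%E ->
    `|segint (V^~ y) a b| <= cst1 / `|y|.
  move=> y0 hy; have yy : 0 < `|y| by lra.
  have cP : {in `[a, b], continuous (fun x => Phi (x, y))}.
    move=> x _; apply: (@continuous_comp _ _ _ (fun x => (x, y))); last exact: cPhi.
    by apply: (@cvg_pair _ _ _ _ (nbhs x) (nbhs y)); [exact: cvg_id|exact: cvg_cst].
  have iP := segint_integrable cP.
  have c1P : {in `[a, b], continuous (fun x => `|k| / `|y| * (1 + Phi (x, y)))}.
    move=> x xab; apply: cvgM; first exact: cvg_cst.
    by apply: cvgD; [exact: cvg_cst|exact: cP].
  apply: le_trans (_ : segint (fun x => `|k| / `|y| * (1 + Phi (x, y))) a b <= _).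
    rewrite /segint; apply: (le_trans (le_normr_Rintegral _ _)) => //.
      exact: segint_integrable (cV _ y0).
    apply: le_Rintegral => //.
    - apply: (segint_integrable (f := fun x => `|V x y|)) => x xab.
      by apply: cvg_norm; exact: cV.
    - exact: (segint_integrable c1P).
    - move=> x; rewrite /= in_itv/= => xab; apply: (le_trans (HV x y xab y0)).
      rewrite ler_wpM2r//; first by rewrite addr_ge0.
      by rewrite ler_pM2r ?invr_gt0// ler_norm.
  rewrite /segint RintegralZl//; last first.
    by apply: (segint_integrable (f := fun x => 1 + Phi (x, y))) => x xab;
      apply: cvgD; [exact: cvg_cst|exact: cP].
  rewrite RintegralD//; last by apply: (segint_integrable (f := fun=> 1)) => x _; exact: cvg_cst.
  have -> : \int[mu]_(x in `[a, b]) 1 = b - a.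
    by have := @segint_cst R a b 1 (ltW ab); rewrite mul1r.
  have h1 : \int[mu]_(x in `[a, b]) Phi (x, y) <= 1.
    rewrite -lee_fin /Rintegral fineK//; exact: integrable_fin_num.
  have -> : cst1 / `|y| = `|k| / `|y| * (b - a + 1) by rewrite /cst1; ring.
  by rewrite ler_wpM2l// ?divr_ge0// lerD2l.
apply/eqP; rewrite -subr_eq0 -normr_eq0; apply/negPn/negP => K0'.
set K := `|_| in K0'.
have K0 : 0 < K by rewrite lt_def K0' normr_ge0.
have [N1 N10 H1] := @segint_cvg R _ (L1B Ub Ua) (K / 4) (divr_gt0 K0 (ltr0Sn _ 3)).
(* the two horizontal sides then cost at most K / 8 each and the tails of the
   vertical lines at most K / 4 *)
pose N := N0 + N1 + 8 * cst1 / K + 1.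
have cK : 0 <= 8 * cst1 / K by apply: divr_ge0; [exact: mulr_ge0|exact: ltW].
have N0' : N0 < N by rewrite /N; lra.
have [Y2 + sY2] := slice `[N, +oo[%classic (measurable_itv _) (infinite_halflines N).1.
have [Y1 + sY1] := slice `]-oo, - N]%classic (measurable_itv _) (infinite_halflines (- N)).2.
rewrite /= !in_itv/= andbT => Y1N Y2N.
have nY2 : `|Y2| = Y2 by rewrite ger0_norm//; move: N00 N0' Y2N; clear; lra.
have nY1 : `|Y1| = - Y1 by rewrite ler0_norm//; move: N00 N0' Y1N; clear; lra.
have y1N : N0 < `|Y1| by rewrite nY1; move: N0' Y1N; clear; lra.
have y2N : N0 < `|Y2| by rewrite nY2; exact: lt_le_trans Y2N.
have s1 := side Y1 y1N sY1; have s2 := side Y2 y2N sY2.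
have bd (Y : R) : N <= Y -> cst1 / Y <= K / 8.
  move=> NY; rewrite ler_pdivrMr; last lra.
  have : 8 * cst1 / K <= Y by rewrite /N in NY; lra.
  by rewrite ler_pdivrMr//; lra.
have b1 : cst1 / - Y1 <= K / 8 by apply: bd; lra.
have b2 := bd Y2 Y2N.
have NN1 : N1 <= N by rewrite /N; lra.
have h31 : N1 <= - Y1 by move: NN1 Y1N; clear; lra.
have h3 := H1 (- Y1) Y2 h31 (le_trans NN1 Y2N).
have c1 : Y1 < - N0 by move: N0' Y1N; clear; lra.
have c2 : N0 < Y2 by exact: lt_le_trans Y2N.
have := ctr Y1 Y2 c1 c2; rewrite /contour.
rewrite segintB; [|exact: (cV _ y1N)|exact: (cV _ y2N)].
rewrite opprK rintB// in h3; move=> E.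
have KE : K = `|rint (U b) - rint (U a)| by rewrite /K distrC.
have := ler_normD (rint (U b) - rint (U a) - segint (fun x => U b x - U a x) Y1 Y2)
  (segint (fun x => U b x - U a x) Y1 Y2).
rewrite subrK -KE.
have E2 : segint (fun x => U b x - U a x) Y1 Y2 = segint (V^~ Y2) a b - segint (V^~ Y1) a b.
  by move: E; clear; lra.
rewrite E2; rewrite E2 in h3.
have := ler_normB (segint (V^~ Y2) a b) (segint (V^~ Y1) a b).
rewrite nY1 in s1; rewrite nY2 in s2.
clear -K0 h3 s1 s2 b1 b2; lra.
Qed.

End LineShift.

(** * Hardy functions on vertical lines *)

Section HardyStrip.
Context {R : realType}.
Local Notation mu := (@lebesgue_measure R).
Implicit Types (F g : R[i] -> R[i]) (M x y : R) (s z : R[i]).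

Definition rp F x y : R := complex.Re (F (x +i* y)).
Definition ip F x y : R := complex.Im (F (x +i* y)).

Definition hardy_bound F M :=
  (forall s, 0 < complex.Re s -> holomorphic_at F s) /\
  (forall x, 0 < x -> (\int[mu]_w (modulus (F (x +i* w)) ^+ 2)%:E <= M%:E)%E).

Lemma holomorphic_cr_at F x y : holomorphic_at F (x +i* y) -> cr_at (rp F) (ip F) x y.
Proof. exact: holomorphic_cr. Qed.

Lemma cr_at_joint (U V W : R -> R -> R) p q : cr_at U V p q -> W = U \/ W = V ->
  forall e : R, 0 < e -> exists2 r : R, 0 < r & forall x y, `|x - p| <= r -> `|y - q| <= r ->
    `|W x y - W p q| <= e.
Proof.
move=> /cr_at_sub[K K0 [r r0 H]] WE e e0.
exists (Num.min r (e / (2 * K))); first by rewrite lt_min r0 divr_gt0// mulr_gt0.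
move=> x y; rewrite !le_min !ler_pdivlMr ?mulr_gt0// => /andP[xr xe] /andP[yr ye].
have [HU HV] := H x y xr yr.
case: WE => ->; [apply: (le_trans HU)|apply: (le_trans HV)]; rewrite mulrDr; lra.
Qed.

(** Functions are only controlled on a closed half-plane; clamping the abscissa
    turns them into continuous functions on the plane, which is what measurability
    and [line_shift] ask for. *)
Lemma continuous_halfplane (U V W : R -> R -> R) (a : R) :
  (forall p q, a <= p -> cr_at U V p q) -> W = U \/ W = V ->
  continuous (fun z : R * R => W (Num.max z.1 a) z.2).
Proof.
move=> H WE [p q]; have ap : a <= Num.max p a by rewrite le_max lexx orbT.
have J := cr_at_joint (H _ q ap) WE.
apply/cvgrPdist_le => /= e e0; have [r r0 Hr] := J e e0.
near=> z.
have z1 : `|p - z.1| <= r.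
  near: z; apply: (@cvgr_dist_le _ _ _ (nbhs (p, q)) _ fst p) => //; exact: cvg_fst.
have z2 : `|q - z.2| <= r.
  near: z; apply: (@cvgr_dist_le _ _ _ (nbhs (p, q)) _ snd q) => //; exact: cvg_snd.
rewrite distrC; apply: Hr; last by rewrite distrC.
apply: le_trans z1; rewrite ler_norml.
have := ler_norm (z.1 - p); have := ler_norm (p - z.1); rewrite [`|z.1 - p|]distrC.
by case: (leP z.1 a); case: (leP p a); lra.
Unshelve. all: by end_near. Qed.

Lemma hardy_cr F M x y : hardy_bound F M -> 0 < x -> cr_at (rp F) (ip F) x y.
Proof. by move=> [H _] x0; apply/holomorphic_cr_at/H. Qed.

Lemma hardy_continuous_sqr F M (a : R) : hardy_bound F M -> 0 < a ->
  continuous (fun z : R * R => modulus (F (Num.max z.1 a +i* z.2)) ^+ 2).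
Proof.
move=> HF a0.
have H p q : a <= p -> cr_at (rp F) (ip F) p q.
  by move=> ap; apply: (hardy_cr _ HF); exact: lt_le_trans ap.
under eq_fun do rewrite modulus_sqr !expr2.
move=> z; apply: cvgD; apply: cvgM;
  first [exact: (continuous_halfplane H (or_introl erefl))|
         exact: (continuous_halfplane H (or_intror erefl))].
Qed.

Lemma hardy_continuous F M x : hardy_bound F M -> 0 < x ->
  continuous (rp F x) /\ continuous (ip F x).
Proof.
move=> HF x0; split=> y; first exact: (cr_at_cvgU (hardy_cr y HF x0)).
have -> : ip F x = (fun y => - (- ip F x y)) by apply/funext => t; rewrite opprK.
apply: cvgN.
have := @holomorphic_cr R (fun z => F z * 'i%C) x y.
have hi : holomorphic_at (fun z => F z * 'i%C) (x +i* y).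
  by apply: holomorphicM; [exact: HF.1|exact: holomorphic_cst].
have E : (fun t => complex.Re (F (x +i* t) * 'i%C)) = (fun t => - ip F x t).
  by apply/funext => t; exact: ReiNIm.
by move=> /(_ hi)/cr_at_cvgU; rewrite E.
Qed.

Lemma hardy_L2 F M x : hardy_bound F M -> 0 < x ->
  [/\ L2 (rp F x), L2 (ip F x),
      rint (fun y => rp F x y ^+ 2) <= M & rint (fun y => ip F x y ^+ 2) <= M].
Proof.
move=> HF x0; have [c1 c2] := hardy_continuous HF x0.
have m1 := mble_continuous c1; have m2 := mble_continuous c2.
have HM := HF.2 x x0.
have l1 : (\int[mu]_y (rp F x y ^+ 2)%:E <= M%:E)%E.
  apply: le_trans HM; apply: ge0_le_integral => //.
  - by move=> y _; rewrite lee_fin sqr_ge0.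
  - by apply/measurable_EFinP; exact: mble_sqr.
  - apply/measurable_EFinP; under eq_fun do rewrite modulus_sqr.
    by apply: mbleD; exact: mble_sqr.
  - by move=> y _; rewrite lee_fin modulus_sqr lerDl sqr_ge0.
have l2 : (\int[mu]_y (ip F x y ^+ 2)%:E <= M%:E)%E.
  apply: le_trans HM; apply: ge0_le_integral => //.
  - by move=> y _; rewrite lee_fin sqr_ge0.
  - by apply/measurable_EFinP; exact: mble_sqr.
  - apply/measurable_EFinP; under eq_fun do rewrite modulus_sqr.
    by apply: mbleD; exact: mble_sqr.
  - by move=> y _; rewrite lee_fin modulus_sqr lerDr sqr_ge0.
have L1' := ltoo_L2 m1 l1; have L2' := ltoo_L2 m2 l2.
by split=> //; apply: rint_le => //; [case: L1'|case: L2'].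
Qed.

End HardyStrip.

Section StripVanish.
Context {R : realType}.
Local Notation mu := (@lebesgue_measure R).
Implicit Types (F g : R[i] -> R[i]) (M x y : R) (s z : R[i]).

Lemma complex_neq s x y : (x != complex.Re s) || (y != complex.Im s) -> x +i* y != s.
Proof. by rewrite eq_complex negb_and. Qed.

(** The integral over the line Re = x0 equals the one over any line Re = b to the
    right of s, by [line_shift], and the last hypothesis makes the latter
    arbitrarily small. The point s is a removable singularity of g. *)
Lemma strip_vanish F g M x0 s (N0 k K r : R) :
  hardy_bound F M -> 0 < x0 -> x0 < complex.Re s -> `|complex.Im s| <= N0 -> 0 < N0 ->
  (forall z, x0 <= complex.Re z -> z != s -> holomorphic_at g z) ->
  0 < r -> (forall z, modulus (z - s) <= r -> modulus (g z) <= K) ->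
  (forall x y, x0 <= x -> N0 < `|y| ->
    modulus (g (x +i* y)) <= k / `|y| * (1 + modulus (F (x +i* y)) ^+ 2)) ->
  L1 (rp g x0) ->
  (forall e : R, 0 < e -> exists b G, [/\ complex.Re s < b, L1 G,
     forall y, modulus (g (b +i* y)) <= G y & rint G <= e]) ->
  rint (rp g x0) = 0.
Proof.
move=> HF x00 x0s sN0 N00 Hg r0 HK Hk L1g Hb.
have line x : x0 <= x -> x != complex.Re s -> continuous (rp g x).
  move=> x0x xs y; apply: (@cr_at_cvgU _ _ (ip g)); apply: holomorphic_cr_at.
  by apply: Hg => //; apply: complex_neq; rewrite xs.
apply/eqP; rewrite -normr_eq0; apply/negPn/negP => A0'.
have A0 : 0 < `|rint (rp g x0)| by rewrite lt_def A0' normr_ge0.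
have [b [G [sb L1G gG Ge]]] := Hb (`|rint (rp g x0)| / 2) (divr_gt0 A0 (ltr0Sn _ 1)).
have x0b : x0 < b by exact: lt_trans sb.
have cb : continuous (rp g b) by apply: line; [exact: ltW|rewrite gt_eqF].
have L1b : L1 (rp g b).
  apply: (L1_le _ _ L1G); first exact: mble_continuous.
  by move=> y; apply: le_trans (gG y); exact: modulus_Re.
have ca : continuous (rp g x0) by apply: line; rewrite ?lt_eqF.
have maxE x : x0 <= x -> Num.max x x0 = x.
  by move=> h; apply/max_idPl.
have shift : rint (rp g x0) = rint (rp g b).
  apply: (@line_shift R (rp g) (ip g)
    (fun z : R * R => modulus (F (Num.max z.1 x0 +i* z.2)) ^+ 2) x0 b M N0 k) => //.
  - exact: hardy_continuous_sqr HF x00.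
  - by move=> z; exact: sqr_ge0.
  - move=> x /andP[x0x xb] /=; rewrite maxE//; apply: HF.2; exact: lt_le_trans x0x.
  - move=> c d cN dN; apply: (@goursat_removable _ _ _ _ _ _ _
      (complex.Re s) (complex.Im s) K (r / 2)).
    + by rewrite x0s sb.
    + by move: sN0; rewrite ler_norml; lra.
    + move=> x y /andP[x0x xb] ycd xys; apply: holomorphic_cr_at; apply: Hg => //.
      exact: complex_neq.
    + by rewrite divr_gt0.
    + move=> x y xr yr.
      have H : modulus (g (x +i* y)) <= K.
        apply: HK; case: (s) xr yr => p q /= xr yr.
        by apply: (le_trans (modulus_le_sum _ _)); lra.
      by split; apply: le_trans H; [exact: modulus_Re|exact: modulus_Im].
  - move=> x y /andP[x0x xb] yN /=; rewrite maxE//.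
    by apply: le_trans (Hk x y x0x yN); exact: modulus_Im.
  - move=> y yN x; rewrite in_itv/= => /andP[x0x xb].
    apply: (@cr_at_cvgV _ (rp g)); apply: holomorphic_cr_at; apply: Hg => //.
    apply: complex_neq; apply/orP; right; apply/eqP => ys.
    by move: yN; rewrite ys ltNge sN0.
have : `|rint (rp g b)| <= rint G.
  apply: le_norm_rint => // y; apply: le_trans (gG y); exact: modulus_Re.
rewrite -shift; lra.
Qed.

Lemma cderiv_bound g s l : has_cderiv g s l -> exists2 r : R, 0 < r &
  forall z, modulus (z - s) <= r ->
    modulus (g z - g s) <= (modulus l + 1) * modulus (z - s).
Proof.
move=> /(_ 1 ltr01)[r r0 H]; exists r => // z zr.
have -> : g z - g s = g z - g s - l * (z - s) + l * (z - s) by rewrite subrK.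
apply: (le_trans (modulusD _ _)); rewrite modulusM; have := H z zr; lra.
Qed.

End StripVanish.

Section CauchyPoisson.
Context {R : realType}.
Implicit Types (F g : R[i] -> R[i]) (M x y : R) (s z c : R[i]).

Lemma modulus_kernel (x w0 w : R) z : z = x +i* (w - w0) ->
  (modulus z ^+ 2)^-1 = kernel x w0 w.
Proof. by move=> ->; rewrite modulus_sqr. Qed.

Lemma hardy_L1_sqr F M x : hardy_bound F M -> 0 < x ->
  L1 (fun y => modulus (F (x +i* y)) ^+ 2) /\
  rint (fun y => modulus (F (x +i* y)) ^+ 2) <= `|M|.
Proof.
move=> HF x0; have [[_ h1] [_ h2] _ _] := hardy_L2 HF x0.
have i1 : L1 (fun y => modulus (F (x +i* y)) ^+ 2).
  by under eq_fun do rewrite modulus_sqr; exact: L1D.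
by split=> //; apply: (le_trans (rint_le i1 (HF.2 x x0))); exact: ler_norm.
Qed.

Lemma weighted_amgm (t a b : R) : 0 < t -> a * b <= t * a ^+ 2 + t^-1 * b ^+ 2.
Proof.
move=> t0; have -> : t * a ^+ 2 + t^-1 * b ^+ 2 = a * b +
    t^-1 * ((t * a - b / 2) ^+ 2 + 3 / 4 * b ^+ 2) by field; rewrite gt_eqF.
rewrite lerDl mulr_ge0 ?invr_ge0 ?(ltW t0)// addr_ge0 ?sqr_ge0//.
by rewrite mulr_ge0 ?sqr_ge0//; lra.
Qed.

(** The function z |-> F z / (z + c) is holomorphic on Re >= x0. On the line Re = b
    it is dominated by t |F|^2 + 1 / (t |z + c|^2) for every t > 0, with integral at
    most t M + pi / (t (b + Re c)): this is small for t small and then b large. *)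
Lemma hardy_orthogonal F M x0 c : hardy_bound F M -> 0 < x0 -> 0 < x0 + complex.Re c ->
  let g z := F z / (z + c) in L1 (rp g x0) /\ rint (rp g x0) = 0.
Proof.
move=> HF x00 c0 g; set p := complex.Re c in c0; set q := complex.Im c.
have cE : c = p +i* q by rewrite /p /q; case: (c).
have zcE x y : modulus ((x +i* y) + c) ^+ 2 = (x + p) ^+ 2 + (y + q) ^+ 2.
  by rewrite cE modulus_sqr.
have zc0 x y : x0 <= x -> (x +i* y) + c != 0.
  move=> x0x; rewrite -modulus_gt0 -(@ltr_pXn2r _ 2%N) ?nnegrE ?modulus_ge0//.
  by rewrite expr0n zcE ltr_pwDl ?sqr_ge0// exprn_gt0//; lra.
have Hg x y : x0 <= x -> holomorphic_at g (x +i* y).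
  move=> x0x; apply: holomorphicM; first by apply: HF.1; rewrite /=; lra.
  apply: holomorphicV; first exact: zc0.
  by apply: holomorphicD; [exact: holomorphic_id|exact: holomorphic_cst].
have gE x y : modulus (g (x +i* y)) = modulus (F (x +i* y)) * (modulus ((x +i* y) + c))^-1.
  by rewrite /g modulusM modulusV.
have kE x y : (modulus ((x +i* y) + c))^-1 ^+ 2 = kernel (x + p) (- q) y.
  by rewrite exprVn zcE /kernel opprK.
have gbound t x y : 0 < t -> modulus (g (x +i* y)) <=
    t * modulus (F (x +i* y)) ^+ 2 + t^-1 * kernel (x + p) (- q) y.
  by move=> t0; rewrite gE -kE; exact: weighted_amgm.
have L1b t x : x0 <= x -> L1 (fun y => t * modulus (F (x +i* y)) ^+ 2 +
    t^-1 * kernel (x + p) (- q) y).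
  move=> x0x; apply: L1D; apply: L1Z; last by apply: L1_kernel; lra.
  by apply: (hardy_L1_sqr HF _).1; lra.
have L1g : L1 (rp g x0).
  apply: (L1_le _ _ (L1b 1 x0 (lexx _))).
    apply: mble_continuous => y; apply: (@cr_at_cvgU _ _ (ip g)).
    exact/holomorphic_cr_at/Hg.
  move=> y; apply: le_trans (gbound 1 x0 y ltr01); exact: modulus_Re.
split=> //.
have Hs : holomorphic_at g ((x0 + 1) +i* 0) by apply: Hg; lra.
have [l /cderiv_bound[r r0 Hr]] := holomorphic_cderiv Hs.
(* g has no singularity, so any point to the right of the line can play that role *)
apply: (@strip_vanish _ F g M x0 ((x0 + 1) +i* 0) (2 * `|q| + 1) 2
  ((modulus l + 1) * r + modulus (g ((x0 + 1) +i* 0))) r HF x00).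
- by rewrite /= ltrDl.
- by rewrite /= normr0; have := normr_ge0 q; lra.
- by have := normr_ge0 q; lra.
- by move=> [x y] /= x0x _; exact: Hg.
- exact: r0.
- move=> z zr; rewrite -[g z](subrK (g ((x0 + 1) +i* 0))).
  apply: (le_trans (modulusD _ _)); rewrite lerD2r; apply: (le_trans (Hr z zr)).
  by rewrite ler_wpM2l// addr_ge0// modulus_ge0.
- move=> x y x0x yN; rewrite gE.
  have y0 : 0 < `|y| by have := normr_ge0 q; lra.
  have h1 : (modulus ((x +i* y) + c))^-1 <= 2 / `|y|.
    have h2 : `|y| / 2 <= modulus ((x +i* y) + c).
      apply: le_trans (modulus_Im _); rewrite cE /=.
      have := ler_normB (y + q) q; rewrite addrK; lra.
    rewrite -[leRHS]invf_div lef_pV2// ?posrE; last by rewrite divr_gt0.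
    by rewrite modulus_gt0; exact: zc0.
  have h3 := modulus_ge0 (F (x +i* y)); rewrite mulrC.
  have h4 : modulus (F (x +i* y)) <= 1 + modulus (F (x +i* y)) ^+ 2.
    by have := sqr_ge0 (modulus (F (x +i* y)) - 1); nra.
  by apply: ler_pM => //; rewrite invr_ge0 modulus_ge0.
- exact: L1g.
- move=> e e0; pose t := e / 2 / (`|M| + 1).
  have M1 : 0 < `|M| + 1 by have := normr_ge0 M; lra.
  have t0 : 0 < t by rewrite !divr_gt0.
  have pi0 := @pi_gt0 R.
  have d0 : 0 < 2 * pi / (t * e) by rewrite divr_gt0 ?mulr_gt0.
  (* t and b make each of the two terms of the bound at most e / 2 *)
  pose b := x0 + 1 + `|p| + 2 * pi / (t * e).
  have bx0 : x0 <= b by rewrite /b; have := normr_ge0 p; lra.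
  exists b; exists (fun y => t * modulus (F (b +i* y)) ^+ 2 + t^-1 * kernel (b + p) (- q) y).
  have b0 : 0 < b by lra.
  have bp : 2 * pi / (t * e) <= b + p.
    by rewrite /b; have := ler_norm (- p); rewrite normrN; lra.
  split; [by rewrite /b/=; have := normr_ge0 p; lra|exact: L1b|by move=> y; exact: gbound|].
  have [i1 i2] := hardy_L1_sqr HF b0.
  have k0 : 0 < b + p by lra.
  have i3 := @L1_kernel R _ (- q) k0.
  rewrite rintD ?rintZ//; try exact: L1Z.
  rewrite rint_kernel//.
  have : t * rint (fun y => modulus (F (b +i* y)) ^+ 2) <= e / 2.
    rewrite /t mulrAC ler_pdivrMr// ler_pM2l ?divr_gt0//; lra.
  have : t^-1 * (pi / (b + p)) <= e / 2.
    rewrite mulrA ler_pdivrMr// mulrC ler_pdivrMr//.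
    move: bp; rewrite ler_pdivrMr ?mulr_gt0//; lra.
  lra.
Qed.

End CauchyPoisson.

(** * Poisson's formula *)

Section Poisson.
Context {R : realType}.
Implicit Types (F g : R[i] -> R[i]) (M x y : R) (s z c : R[i]).

(** Let s' be the mirror image of s in the line Re = x0. The difference quotient
    (F z - F s) / ((z - s) (z - s')) has a removable singularity at s and its
    integral over the line vanishes by [strip_vanish]; on that line the denominator
    is real and equal to minus the inverse of the kernel. *)
Lemma hardy_poisson F M x0 s : hardy_bound F M -> 0 < x0 -> x0 < complex.Re s ->
  L1 (fun w => rp F x0 w * kernel (complex.Re s - x0) (complex.Im s) w) /\
  rint (fun w => rp F x0 w * kernel (complex.Re s - x0) (complex.Im s) w) =
    complex.Re (F s) * (pi / (complex.Re s - x0)).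
Proof.
move=> HF x00 x0s; set p := complex.Re s in x0s *; set q := complex.Im s.
have sE : s = p +i* q by rewrite /p /q; case: (s).
pose s' := (2 * x0 - p) +i* q.
pose g z := (F z - F s) / ((z - s) * (z - s')).
pose x := p - x0; have xp : 0 < x by rewrite subr_gt0.
rewrite -/x; pose fs := modulus (F s); have fs0 : 0 <= fs by exact: modulus_ge0.
have m1 a b : modulus ((a +i* b) - s) ^+ 2 = (a - p) ^+ 2 + (b - q) ^+ 2.
  by rewrite sE modulus_sqr.
have m2 a b : modulus ((a +i* b) - s') ^+ 2 = (a - p + 2 * x) ^+ 2 + (b - q) ^+ 2.
  by rewrite /s' modulus_sqr /x /=; ring.
have m2p a b : x0 <= a -> 0 < modulus ((a +i* b) - s').
  move=> x0a; rewrite -(@ltr_pXn2r _ 2%N) ?nnegrE ?modulus_ge0//.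
  by rewrite expr0n m2 ltr_pwDl ?sqr_ge0// exprn_gt0// /x; lra.
have hs a b : 0 < a -> holomorphic_at F (a +i* b) by move=> a0; exact: HF.1.
have Hg a b : x0 <= a -> a +i* b != s -> holomorphic_at g (a +i* b).
  move=> x0a abs; apply: holomorphicM.
    by apply: holomorphicB; [apply: hs; lra|exact: holomorphic_cst].
  apply: holomorphicV.
    by apply: mulf_neq0; [rewrite subr_eq0|rewrite -modulus_gt0; exact: m2p].
  by apply: holomorphicM; (apply: holomorphicB; [exact: holomorphic_id|exact: holomorphic_cst]).
have gE z : modulus (g z) = modulus (F z - F s) * (modulus (z - s) * modulus (z - s'))^-1.
  by rewrite /g modulusM modulusV modulusM.
have num z : modulus (F z - F s) <= (1 + fs) * (1 + modulus (F z) ^+ 2).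
  apply: (le_trans (modulusD _ _)); rewrite modulusN -/fs.
  have h3 := modulus_ge0 (F z).
  have h4 : modulus (F z) <= 1 + modulus (F z) ^+ 2.
    by have := sqr_ge0 (modulus (F z) - 1); nra.
  have := mulr_ge0 fs0 (sqr_ge0 (modulus (F z))); lra.
(* z - s' is minus the conjugate of z - s on the line *)
have gx0 w : rp g x0 w = - ((rp F x0 w - complex.Re (F s)) * kernel x q w).
  rewrite /rp /g.
  have -> : ((x0 +i* w) - s) * ((x0 +i* w) - s') = (- (x ^+ 2 + (w - q) ^+ 2))%:C.
    by rewrite sE /s' /x; apply/eqP; rewrite eq_complex/=; apply/andP; split; apply/eqP; ring.
  rewrite -rmorphV/=; last by rewrite unitfE oppr_eq0 gt_eqF// kernel_den_gt0.
  case: (F (x0 +i* w)) => u1 v1; case: (F s) => u2 v2 /=.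
  by rewrite invrN /kernel; ring.
have L1k := @L1_kernel R x q xp.
have [i1 _] := hardy_L1_sqr HF x00.
have cF : continuous (rp F x0) := (hardy_continuous HF x00).1.
have L1Fk : L1 (fun w => rp F x0 w * kernel x q w).
  apply: (L1_le (g := fun w => kernel x q w + (x ^+ 2)^-1 * modulus (F (x0 +i* w)) ^+ 2)).
  - apply: mbleM; apply: mble_continuous => //; exact: continuous_kernel.
  - move=> w; rewrite normrM (ger0_norm (kernel_ge0 _ _ _)).
    have h1 : `|rp F x0 w| <= modulus (F (x0 +i* w)) by exact: modulus_Re.
    have h4 : modulus (F (x0 +i* w)) <= 1 + modulus (F (x0 +i* w)) ^+ 2.
      by have := sqr_ge0 (modulus (F (x0 +i* w)) - 1); have := modulus_ge0 (F (x0 +i* w)); nra.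
    have h5 := @kernel_le R x q w xp; have h6 := kernel_ge0 x q w.
    apply: (@le_trans _ _ ((1 + modulus (F (x0 +i* w)) ^+ 2) * kernel x q w)).
      by rewrite ler_wpM2r// (le_trans h1).
    by rewrite mulrDl mul1r lerD2l mulrC ler_wpM2r// sqr_ge0.
  - by apply: L1D => //; exact: L1Z.
split=> //.
have L1g : L1 (rp g x0).
  have -> : rp g x0 = fun w => - (rp F x0 w * kernel x q w - complex.Re (F s) * kernel x q w).
    by apply/funext => w; rewrite gx0 mulrBl.
  by apply/L1N/L1B => //; exact: L1Z.
have Hs : holomorphic_at F s by rewrite sE; apply: hs; lra.
have [l /cderiv_bound[r r0 Hr]] := holomorphic_cderiv Hs.
have l0 := modulus_ge0 l.
suff : rint (rp g x0) = 0.
  have -> : rp g x0 = fun w => (- 1) * (rp F x0 w * kernel x q w - complex.Re (F s) * kernel x q w).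
    by apply/funext => w; rewrite gx0 mulrBl mulN1r.
  rewrite rintZ; last by apply: L1B => //; exact: L1Z.
  rewrite rintB ?rintZ ?rint_kernel//; last exact: L1Z.
  lra.
apply: (@strip_vanish _ F g M x0 s (2 * `|q| + 2) (2 * (1 + fs))
  ((modulus l + 1) / x) (Num.min r x) HF x00).
- exact: x0s.
- by rewrite -/q; have := normr_ge0 q; lra.
- by have := normr_ge0 q; lra.
- by move=> [a b] /= x0a zs; exact: Hg.
- by rewrite lt_min r0 xp.
- move=> z; rewrite le_min => /andP[zr zx]; rewrite gE.
  have [->|zs] := eqVneq z s.
    rewrite !subrr {1}/modulus ComplexField.Normc.normc0 mul0r divr_ge0 ?(ltW xp)//; lra.
  have zs0 : 0 < modulus (z - s) by rewrite modulus_gt0 subr_eq0.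
  have zx' : x <= modulus (z - s').
    apply: le_trans (modulus_Re _); move: zx (modulus_Re (z - s)).
    case: (z) => a b; rewrite sE /s' /= => zx.
    rewrite ler_norml => /andP[h1 h2]; have := ler_norm (a - (2 * x0 - p)); rewrite /x in zx *; lra.
  have zs'0 : 0 < modulus (z - s') by exact: lt_le_trans zx'.
  rewrite ler_pdivrMr ?mulr_gt0//; apply: (le_trans (Hr z zr)).
  have -> : (modulus l + 1) / x * (modulus (z - s) * modulus (z - s')) =
    ((modulus l + 1) * modulus (z - s)) * (modulus (z - s') / x) by ring.
  rewrite ler_peMr ?mulr_ge0 ?modulus_ge0//; first lra.
  by rewrite ler_pdivlMr// mul1r.
- move=> a b x0a bN; rewrite gE.
  have y0 : 0 < `|b| by have := normr_ge0 q; lra.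
  have b2 : 1 <= `|b| / 2 by have := normr_ge0 q; lra.
  have q1 : `|b| / 2 <= `|b - q|.
    have := ler_normD (b - q) q; rewrite subrK; lra.
  have h1 : `|b| / 2 <= modulus ((a +i* b) - s).
    by apply: le_trans q1 _; rewrite sE; exact: le_trans (modulus_Im _).
  have h2 : 1 <= modulus ((a +i* b) - s').
    apply: (le_trans b2); apply: (le_trans q1); rewrite /s'; exact: le_trans (modulus_Im _).
  have h3 : `|b| / 2 <= modulus ((a +i* b) - s) * modulus ((a +i* b) - s').
    by rewrite -[leLHS]mulr1; apply: ler_pM => //; lra.
  have -> : 2 * (1 + fs) / `|b| * (1 + modulus (F (a +i* b)) ^+ 2) =
      (1 + fs) * (1 + modulus (F (a +i* b)) ^+ 2) * (`|b| / 2)^-1.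
    by field; rewrite gt_eqF.
  apply: ler_pM; [exact: modulus_ge0| |exact: num|].
    by rewrite invr_ge0 mulr_ge0 ?modulus_ge0.
  by rewrite lef_pV2 ?posrE//; move: b2 h3; clear; lra.
- exact: L1g.
- move=> e e0.
  have M1 : 0 < pi + `|M| + 1 :> R by have := normr_ge0 M; have := @pi_gt0 R; lra.
  have K0 : 0 < (1 + fs) * (pi + `|M| + 1) by rewrite mulr_gt0//; lra.
  (* on the line Re = p + B the integral of |g| is at most
     (1 + fs) (pi + |M| + 1) / B *)
  pose B := 1 + (1 + fs) * (pi + `|M| + 1) / e.
  have Be : (1 + fs) * (pi + `|M| + 1) / e <= B by rewrite /B; lra.
  have B1 : 1 <= B by rewrite lerDl divr_ge0// ltW.
  have B0 : 0 < B by lra.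
  pose b := p + B; have b0 : 0 < b := addr_gt0 (lt_trans x00 x0s) B0.
  have x0b : x0 <= b by move: (ltW (ltr_wpDr (ltW B0) x0s)).
  have [j1 j2] := hardy_L1_sqr HF b0.
  have kB := @L1_kernel R B q B0.
  exists b; exists (fun y => (1 + fs) * (kernel B q y + (B ^+ 2)^-1 * modulus (F (b +i* y)) ^+ 2)).
  split.
  + by rewrite /b -/p ltrDl.
  + by apply: L1Z; apply: L1D => //; exact: L1Z.
  + move=> y; rewrite gE.
    have h0 : 0 < modulus ((b +i* y) - s).
      by rewrite -(@ltr_pXn2r _ 2%N) ?nnegrE ?modulus_ge0// expr0n m1 ltr_pwDl ?sqr_ge0// exprn_gt0// /b; move: B0; clear; lra.
    have h1 : modulus ((b +i* y) - s) <= modulus ((b +i* y) - s').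
      rewrite -(@ler_pXn2r _ 2%N) ?nnegrE ?modulus_ge0// m1 m2 lerD2r.
      rewrite ler_pXn2r ?nnegrE//; rewrite /b; move: B0 xp; clear; lra.
    have h2 : (modulus ((b +i* y) - s) * modulus ((b +i* y) - s'))^-1 <= kernel B q y.
      rewrite -(@modulus_kernel R B q y ((b +i* y) - s)); last first.
        by rewrite sE /b; apply/eqP; rewrite eq_complex/= eqxx andbT; apply/eqP; ring.
      rewrite lef_pV2 ?posrE ?mulr_gt0// ?exprn_gt0//; last exact: lt_le_trans h1.
      by rewrite expr2 ler_pM2l.
    have h5 := @kernel_le R B q y B0; have h6 := kernel_ge0 B q y.
    apply: (@le_trans _ _ ((1 + fs) * (1 + modulus (F (b +i* y)) ^+ 2) * kernel B q y)).
      apply: ler_pM; [exact: modulus_ge0| |exact: num|exact: h2].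
      by rewrite invr_ge0 mulr_ge0 ?modulus_ge0.
    rewrite -mulrA ler_wpM2l//; first lra.
    by rewrite mulrDl mul1r lerD2l mulrC ler_wpM2r// sqr_ge0.
  + rewrite rintZ; last by apply: L1D => //; exact: L1Z.
    rewrite rintD//; last exact: L1Z.
    rewrite rintZ// rint_kernel//.
    set I := rint _ in j2 *.
    have I0 : 0 <= I by apply: rint_ge0 => y; exact: sqr_ge0.
    have h1 : (B ^+ 2)^-1 * I <= `|M| / B.
      rewrite mulrC ler_pM// ?invr_ge0 ?exprn_ge0// ?(ltW B0)//.
      by rewrite lef_pV2 ?posrE ?exprn_gt0// expr2 ler_peMr// ltW.
    apply: (@le_trans _ _ ((1 + fs) * (pi + `|M| + 1) / B)).
      rewrite -mulrA ler_wpM2l//; first lra.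
      rewrite !mulrDl; have : 0 <= 1 / B by rewrite divr_ge0// ltW.
      lra.
    by rewrite ler_pdivrMr// [e * B]mulrC -ler_pdivrMr.
Qed.

End Poisson.

(** * Real fields with the Poisson property *)

Section PoissonField.
Context {R : realType}.
Local Notation mu := (@lebesgue_measure R).
Implicit Types (u : R -> R -> R) (M x w t a b : R).

(** The trace that a Hardy function leaves on the lines Re = x, once holomorphy has
    been used. Real and imaginary parts are of this kind, and so are the
    differences [u x - u (x + d)] to which the maximal inequality is applied. *)
Definition poisson_field u M :=
  [/\ forall x, 0 < x -> continuous (u x),
      forall x, 0 < x -> L2 (u x),
      forall x, 0 < x -> rint (fun w => u x w ^+ 2) <= M,
      forall x w, 0 < x -> {for x, continuous (u^~ w)} &
      forall a x w, 0 < a -> 0 < x ->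
        u (a + x) w * (pi / x) = rint (fun t => u a t * kernel x w t)].

Lemma kernel_sym x w t : kernel x w t = kernel x t w.
Proof. by rewrite /kernel -[(t - w) ^+ 2]sqrrN opprB. Qed.

Lemma L2_kernel x w : 0 < x -> L2 (kernel x w).
Proof.
move=> x0; have mk := mble_continuous (@continuous_kernel R x w x0); split=> //.
apply: (L1_le (mble_sqr mk) _ (L1Z (x ^+ 2)^-1 (@L1_kernel R x w x0))) => t.
rewrite ger0_norm ?sqr_ge0// expr2; have := kernel_ge0 x w t => k0.
by rewrite ler_wpM2r// kernel_le.
Qed.

Lemma L1_mul_kernel f x w : L2 f -> 0 < x -> L1 (fun t => f t * kernel x w t).
Proof. by move=> Lf x0; apply: L2M => //; exact: L2_kernel. Qed.

Lemma L1_sqr_mul_kernel f x w : L2 f -> 0 < x -> L1 (fun t => f t ^+ 2 * kernel x w t).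
Proof.
move=> [mf f2] x0; apply: (L1_le _ _ (L1Z (x ^+ 2)^-1 f2)).
  by apply: mbleM; [exact: mble_sqr|exact: mble_continuous (continuous_kernel x0)].
move=> t; rewrite (ger0_norm (mulr_ge0 (sqr_ge0 _) (kernel_ge0 _ _ _))).
by rewrite mulrC ler_wpM2r ?sqr_ge0// kernel_le.
Qed.

Lemma measurable_kernel_plane x : 0 < x ->
  measurable_fun setT (fun z : R * R => kernel x z.2 z.1).
Proof.
move=> x0; apply: continuous_measurable_plane => z; apply: cvgV.
  by rewrite gt_eqF// kernel_den_gt0.
apply: cvgD; first exact: cvg_cst.
under eq_fun do rewrite expr2; rewrite expr2.
by apply: cvgM; apply: cvgB; [exact: cvg_fst|exact: cvg_snd|exact: cvg_fst|exact: cvg_snd].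
Qed.

(** The integrand is dominated by (f t ^+ 2 + g w ^+ 2) times the kernel, and the
    kernel has the integral pi / x in either variable. *)
Lemma fubini_kernel f g x : L2 f -> L2 g -> 0 < x ->
  rint (fun t => rint (fun w => f t * kernel x w t * g w)) =
  rint (fun w => rint (fun t => f t * kernel x w t * g w)).
Proof.
move=> Lf Lg x0; have [mf f2] := Lf; have [mg g2] := Lg.
pose h (z : R * R) : R := f z.1 * kernel x z.2 z.1 * g z.2.
have mk := measurable_kernel_plane x0.
have mf1 : measurable_fun setT (fun z : R * R => f z.1).
  by apply: (measurableT_comp mf); exact: measurable_fst.
have mg2 : measurable_fun setT (fun z : R * R => g z.2).
  by apply: (measurableT_comp mg); exact: measurable_snd.
have mh : measurable_fun setT h by apply: measurable_funM => //; exact: measurable_funM.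
have i1 : (mu \x mu)%E.-integrable setT (fun z => (f z.1 ^+ 2 * kernel x z.2 z.1)%:E).
  apply/integrable12ltyP.
    by apply/measurable_EFinP; apply: measurable_funM => //; exact: measurable_funX.
  rewrite [ltLHS](_ : _ = \int[mu]_t ((pi / x) * f t ^+ 2)%:E)%E.
    rewrite EFin_rint ?ltry//; exact: L1Z.
  apply: eq_integral => t _ /=; under eq_integral do
    rewrite (ger0_norm (mulr_ge0 (sqr_ge0 _) (kernel_ge0 _ _ _))) kernel_sym.
  rewrite EFin_rint; last by apply: L1Z; exact: L1_kernel.
  by rewrite (rintZ _ (L1_kernel t x0)) (rint_kernel t x0) mulrC.
have i2 : (mu \x mu)%E.-integrable setT (fun z => (g z.2 ^+ 2 * kernel x z.2 z.1)%:E).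
  apply/integrable21ltyP.
    by apply/measurable_EFinP; apply: measurable_funM => //; exact: measurable_funX.
  rewrite [ltLHS](_ : _ = \int[mu]_t ((pi / x) * g t ^+ 2)%:E)%E.
    rewrite EFin_rint ?ltry//; exact: L1Z.
  apply: eq_integral => t _ /=; under eq_integral do
    rewrite (ger0_norm (mulr_ge0 (sqr_ge0 _) (kernel_ge0 _ _ _))).
  rewrite EFin_rint; last by apply: L1Z; exact: L1_kernel.
  by rewrite (rintZ _ (L1_kernel t x0)) (rint_kernel t x0) mulrC.
have ih : (mu \x mu)%E.-integrable setT (EFin \o h).
  apply: (le_integrable _ _ _ (integrableD _ i1 i2)) => //; first exact/measurable_EFinP.
  move=> z _ /=; rewrite lee_fin -mulrDl /h mulrAC normrM.
  rewrite [in leRHS]normrM ler_wpM2r// normrM [leRHS]ger0_norm ?addr_ge0 ?sqr_ge0//.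
  rewrite -(real_normK (num_real (f z.1))) -(real_normK (num_real (g z.2))).
  have := normr_ge0 (f z.1); have := normr_ge0 (g z.2).
  have := sqr_ge0 (`|f z.1| - `|g z.2|); nra.
have E := Fubini ih.
rewrite /rint /Rintegral; congr fine.
have L1t t : L1 (fun w => f t * kernel x w t * g w).
  under eq_fun do rewrite -mulrA [kernel _ _ _ * _]mulrC kernel_sym.
  by apply: L1Z; exact: L1_mul_kernel.
have L1w w : L1 (fun t => f t * kernel x w t * g w).
  by under eq_fun do rewrite mulrC; apply: L1Z; exact: L1_mul_kernel.
under eq_integral do rewrite -[fine _]/(rint _) -EFin_rint//.
under [RHS]eq_integral do rewrite -[fine _]/(rint _) -EFin_rint//.
exact: E.
Qed.

Section Field.
Variables (u : R -> R -> R) (M : R).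
Hypothesis Pu : poisson_field u M.

Let inner p q := rint (fun w => u p w * u q w).
Let phi p := rint (fun w => u p w ^+ 2).

(** Convolution with the kernel is a self-adjoint operation because the kernel is
    symmetric. *)
Lemma field_selfadjoint a b x : 0 < a -> 0 < b -> 0 < x -> inner (a + x) b = inner a (b + x).
Proof.
case: Pu => _ HL _ _ HP a0 b0 x0.
have px : pi / x != 0 :> R by rewrite gt_eqF// divr_gt0// pi_gt0.
apply: (mulfI px).
have E1 : pi / x * inner (a + x) b = rint (fun w => rint (fun t => u a t * kernel x w t * u b w)).
  rewrite -rintZ; last by apply: L2M; apply: HL => //; exact: addr_gt0.
  apply: eq_rint => w; rewrite mulrA [_ * u (a + x) w]mulrC HP//.
  rewrite mulrC -rintZ; last by apply: L1_mul_kernel => //; exact: HL.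
  by apply: eq_rint => t; rewrite mulrC.
have E2 : pi / x * inner a (b + x) = rint (fun t => rint (fun w => u a t * kernel x w t * u b w)).
  rewrite -rintZ; last by apply: L2M; apply: HL => //; exact: addr_gt0.
  apply: eq_rint => t; rewrite mulrCA [_ * u (b + x) t]mulrC HP//.
  rewrite -rintZ; last by apply: L1_mul_kernel => //; exact: HL.
  by apply: eq_rint => w; rewrite kernel_sym; ring.
by rewrite E1 E2 fubini_kernel//; exact: HL.
Qed.

(** By self-adjointness the inner product of [u p] and [u (p + d *+ 2)] is the
    squared norm of [u (p + d)]. *)
Lemma field_dist p d : 0 < p -> 0 < d ->
  rint (fun w => (u p w - u (p + d *+ 2) w) ^+ 2) =
  phi p - 2 * phi (p + d) + phi (p + d *+ 2).
Proof.
case: Pu => _ HL _ _ _ p0 d0.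
rewrite rint_sqrB; [|exact: HL|by apply: HL; lra].
congr (_ - 2 * _ + _).
transitivity (inner p (p + d + d)); first by apply: eq_rint => w; rewrite mulr2n addrA.
by rewrite -field_selfadjoint//; exact: addr_gt0.
Qed.

(** The function phi is midpoint convex by [field_dist], so that a single increase
    would propagate with at least the same slope; but phi is bounded. *)
Lemma field_norm_noninc p q : 0 < p -> p <= q -> phi q <= phi p.
Proof.
move=> p0; rewrite le_eqVlt => /predU1P[->//|pq]; rewrite leNgt; apply/negP => lt.
pose h := q - p; have h0 : 0 < h by rewrite subr_gt0.
pose f n := phi (p + h *+ n).
(* convexity along the progression p, p + h, p + 2 h and so on *)
have conv n : f n.+1 - f n <= f n.+2 - f n.+1.
  have pn : 0 < p + h *+ n by rewrite ltr_pwDl// mulrn_wge0// ltW.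
  have := field_dist pn h0; have := rint_ge0 (fun w => sqr_ge0 (u (p + h *+ n) w - u (p + h *+ n + h *+ 2) w)).
  have e1 : p + h *+ n + h = p + h *+ n.+1 by rewrite -addrA -mulrSr.
  have e2 : p + h *+ n + h *+ 2 = p + h *+ n.+2 by rewrite -addrA -mulrnDr addn2.
  move=> + E; rewrite E e1 e2 -/(f n) -/(f n.+1) -/(f n.+2); lra.
have step n : phi q - phi p <= f n.+1 - f n.
  elim: n => [|n IH]; last exact: le_trans (conv n).
  by rewrite /f mulr0n addr0 mulr1n (_ : p + h = q)// /h; ring.
have grow n : phi p + (phi q - phi p) *+ n <= f n.
  elim: n => [|n IH]; first by rewrite /f mulr0n !addr0.
  by rewrite mulrSr; have := step n; lra.
have [n hn] : exists n, M - phi p < (phi q - phi p) *+ n.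
  have d0 : 0 < phi q - phi p by lra.
  exists (Num.truncn (`|M - phi p| / (phi q - phi p))).+1.
  rewrite -mulr_natl -ltr_pdivrMr//.
  apply: (@le_lt_trans _ _ (`|M - phi p| / (phi q - phi p))).
    by rewrite ler_wpM2r ?invr_ge0 ?(ltW d0)// ler_norm.
  exact: truncnS_gt.
case: Pu => _ _ HM _ _.
have pn : 0 < p + h *+ n by rewrite ltr_pwDl// mulrn_wge0// ltW.
have := HM _ pn; have := grow n; rewrite -/(phi (p + h *+ n)) -/(f n); lra.
Qed.

(** The function phi is monotone and bounded, so its second differences near 0 are
    small. *)
Lemma field_cauchy : forall e : R, 0 < e -> exists2 d : R, 0 < d &
  forall p q, 0 < p -> p < q -> q <= d -> rint (fun w => (u p w - u q w) ^+ 2) <= e.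
Proof.
move=> e e0; pose S := [set phi x | x in [set x : R | 0 < x]].
have hS : has_sup S.
  split; first by exists (phi 1); exists 1 => //=.
  by exists M => _ [x x0 <-]; case: Pu => _ _ + _ _; apply.
have [_ [d d0 <-] hd] := sup_adherent e0 hS.
exists d => // p q p0 pq qd.
have hp : phi p <= sup S by apply: ub_le_sup; [exact: hS.2|exists p].
have q0 : 0 < q by lra.
have dE : p + ((q - p) / 2) *+ 2 = q by rewrite mulr2n; lra.
have qp0 : 0 < (q - p) / 2 by rewrite divr_gt0//; lra.
have := field_dist p0 qp0; rewrite dE => ->.
have h1 : phi q <= phi (p + (q - p) / 2) by apply: field_norm_noninc; lra.
have h2 : phi d <= phi q by exact: field_norm_noninc.
lra.
Qed.

End Field.
End PoissonField.

(** * Limits almost everywhere by a maximal inequality *)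

Section Maximal.
Context {R : realType}.
Local Notation mu := (@lebesgue_measure R).

Lemma L1_mul_indic (g : R -> R) (A : set R) : L1 g -> measurable A ->
  L1 (fun t => g t * \1_A t).
Proof.
move=> g1 mA; apply: (L1_le _ _ (L1_norm g1)).
  by apply: mbleM; [exact: L1_mble|exact: measurable_indic].
by move=> t; rewrite normrM indicE; case: (t \in A); rewrite ?normr1 ?normr0 ?mulr1 ?mulr0.
Qed.

(** On the ring between the balls of radii 2^N x and 2^(N+1) x the kernel is at most
    (2^N x)^-2; bounding the integral of g over each ring by the average over the
    larger ball leaves a geometric series. *)
Lemma poisson_le_averages (g : R -> R) (x w c : R) : L1 g -> (forall t, 0 <= g t) -> 0 < x ->
  (forall r, 0 < r -> rint (fun t => g t * \1_(ball w r) t) <= c * (2 * r)) ->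
  rint (fun t => g t * kernel x w t) <= 16 * c / x.
Proof.
move=> g1 g0 x0 Hc.
have c0 : 0 <= c.
  have := Hc 1 ltr01; rewrite mulr1 => /(le_trans _) H.
  have : 0 <= c * 2.
    by apply: H; apply: rint_ge0 => t; rewrite mulr_ge0// indicE.
  lra.
have e4 N : (4 : R) ^+ N = 2 ^+ N * 2 ^+ N.
  by rewrite -expr2 -exprM mulnC exprM; congr (_ ^+ _); ring.
have mB r : measurable (ball w r) by exact: measurable_ball.
have gk1 : L1 (fun t => g t * kernel x w t).
  apply: (L1_le _ _ (L1Z (x ^+ 2)^-1 g1)).
    by apply: mbleM; [exact: L1_mble|exact: mble_continuous (continuous_kernel x0)].
  move=> t; rewrite (ger0_norm (mulr_ge0 (g0 _) (kernel_ge0 _ _ _))).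
  by rewrite mulrC ler_wpM2r// kernel_le.
pose S N := rint (fun t => g t * kernel x w t * \1_(ball w (2 ^+ N * x)) t).
have p2 N : 0 < 2 ^+ N * x by rewrite mulr_gt0// exprn_gt0.
(* summing the rings up to N leaves the tail of the geometric series *)
have SN N : S N <= 16 * c / x - 8 * c / x / 2 ^+ N.
  elim: N => [|N IH].
    have -> : 16 * c / x - 8 * c / x / 2 ^+ 0 = 8 * c / x by rewrite expr0; field; rewrite gt_eqF.
    apply: (@le_trans _ _ ((x ^+ 2)^-1 * rint (fun t => g t * \1_(ball w (2 ^+ 0 * x)) t))).
      rewrite -rintZ; last exact: L1_mul_indic.
      apply: le_rint; [exact: L1_mul_indic|by apply: L1Z; exact: L1_mul_indic|].
      move=> t; rewrite mulrA ler_wpM2r// mulrC ler_wpM2r//; exact: kernel_le.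
    have := Hc _ (p2 0%N); rewrite expr0 mul1r => H.
    apply: (@le_trans _ _ ((x ^+ 2)^-1 * (c * (2 * x)))).
      by rewrite ler_wpM2l// invr_ge0 sqr_ge0.
    have -> : (x ^+ 2)^-1 * (c * (2 * x)) = 2 * (c / x) by field; rewrite gt_eqF.
    rewrite -mulrA ler_wpM2r ?divr_ge0 ?(ltW x0)//; lra.
  have q0 : 0 < 4 / (x ^+ 2 * 4 ^+ N.+1) by rewrite divr_gt0// mulr_gt0// exprn_gt0.
  apply: (@le_trans _ _ (S N + 4 / (x ^+ 2 * 4 ^+ N.+1) *
      rint (fun t => g t * \1_(ball w (2 ^+ N.+1 * x)) t))).
    rewrite -rintZ; last exact: L1_mul_indic.
    rewrite /S -rintD; [|exact: L1_mul_indic|by apply: L1Z; exact: L1_mul_indic].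
    apply: le_rint; [exact: L1_mul_indic| |].
      by apply: L1D; [exact: L1_mul_indic|apply: L1Z; exact: L1_mul_indic].
    move=> t; rewrite !indicE; case: (boolP (t \in (ball w (2 ^+ N * x) : set R))) => tN.
      rewrite mulr1 (le_trans (_ : _ <= g t * kernel x w t))//.
        by rewrite -[leRHS]mulr1 ler_wpM2l ?mulr_ge0 ?kernel_ge0//; case: (_ \in _).
      by rewrite lerDl; apply: mulr_ge0; [exact: ltW|exact: mulr_ge0].
    rewrite mulr0 add0r mulrA; apply: ler_wpM2r => //.
    rewrite mulrC ler_wpM2r// /kernel.
    have : 2 ^+ N * x <= `|w - t|.
      by move: tN; rewrite notin_setE /ball/= => /negP; rewrite -leNgt.
    move=> wt0; have wt : (2 ^+ N * x) ^+ 2 <= (w - t) ^+ 2.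
      rewrite -(real_normK (num_real (w - t))) ler_pXn2r ?nnegrE//; exact: ltW.
    rewrite -[leRHS]invf_div lef_pV2 ?posrE ?kernel_den_gt0//; last first.
      by rewrite divr_gt0// mulr_gt0// exprn_gt0.
    have -> : x ^+ 2 * 4 ^+ N.+1 / 4 = (2 ^+ N * x) ^+ 2.
      by rewrite [4 ^+ N.+1]exprS e4; move: (2 ^+ N) => y; field.
    rewrite (le_trans wt)// -[(t - w) ^+ 2]sqrrN opprB lerDr sqr_ge0//.
  apply: (le_trans (lerD IH (ler_wpM2l (ltW q0) (Hc _ (p2 N.+1))))).
  have -> : 4 / (x ^+ 2 * 4 ^+ N.+1) * (c * (2 * (2 ^+ N.+1 * x))) = 8 * c / x / 2 ^+ N.+1.
    by rewrite e4; field; rewrite expf_neq0// gt_eqF.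
  rewrite exprS invfM; set y := (2 ^+ N)^-1.
  rewrite le_eqVlt; apply/orP; left; apply/eqP; lra.
have C0 : rint (fun t => g t * kernel x w t * (1 - \1_(ball w (2 ^+ N * x)) t)) @[N --> \oo] --> 0.
  apply: (rint_cvg0 _ gk1).
  - by move=> N; apply: mbleM; [exact: L1_mble|apply: mbleB; [exact: measurable_cst|exact: measurable_indic]].
  - move=> N t; rewrite normrM (ger0_norm (mulr_ge0 (g0 _) (kernel_ge0 _ _ _))).
    rewrite -[leRHS]mulr1 ler_wpM2l ?mulr_ge0 ?kernel_ge0//.
    by rewrite indicE; case: (_ \in _); rewrite ?subrr ?subr0 ?normr0 ?normr1.
  - move=> t; apply/cvgrPdist_le => /= e e0; near=> N.
    rewrite indicE mem_set ?subrr ?mulr0 ?subrr ?normr0 ?ltW//.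
    have : `|w - t| / x < N%:R by near: N; exact: nbhs_infty_gtr.
    rewrite /ball/= ltr_pdivrMr// => /lt_le_trans; apply.
    by rewrite ler_wpM2r ?(ltW x0)// -natrX ler_nat ltnW// ltn_expl.
apply/ler_addgt0Pr => e e0.
have [N _ /(_ N (leqnn N))] := (cvgrPdist_le _ _).1 C0 e e0.
rewrite /= sub0r normrN.
have -> : rint (fun t => g t * kernel x w t * (1 - \1_(ball w (2 ^+ N * x)) t)) =
    rint (fun t => g t * kernel x w t) - S N.
  by rewrite /S -rintB//; [apply: eq_rint => t; ring|exact: L1_mul_indic].
have := SN N; have : 0 <= 8 * c / x / 2 ^+ N.
  by rewrite !divr_ge0 ?exprn_ge0 ?mulr_ge0 ?(ltW x0).
move=> h1 h2 /(le_trans (ler_norm _)); lra.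
Unshelve. all: by end_near. Qed.

End Maximal.

Section FatouReal.
Context {R : realType}.
Local Notation mu := (@lebesgue_measure R).
Implicit Types (u : R -> R -> R) (M x w t a b c : R).

(** Jensen's inequality for the probability density x / pi * kernel, obtained by
    expanding the variance. *)
Lemma field_jensen u M a x w : poisson_field u M -> 0 < a -> 0 < x ->
  u (a + x) w ^+ 2 * (pi / x) <= rint (fun t => u a t ^+ 2 * kernel x w t).
Proof.
move=> [_ HL _ _ HP] a0 x0; set c := u (a + x) w.
have Lu := HL a a0.
have k1 := @L1_kernel R x w x0.
have i1 := L1_mul_kernel w Lu x0.
have i2 := L1_sqr_mul_kernel w Lu x0.
have : 0 <= rint (fun t => (u a t - c) ^+ 2 * kernel x w t).
  by apply: rint_ge0 => t; rewrite mulr_ge0 ?sqr_ge0// kernel_ge0.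
have -> : rint (fun t => (u a t - c) ^+ 2 * kernel x w t) =
    rint (fun t => u a t ^+ 2 * kernel x w t) - 2 * c * rint (fun t => u a t * kernel x w t)
    + c ^+ 2 * rint (kernel x w).
  rewrite -!rintZ// -rintB//; last exact: L1Z.
  rewrite -rintD; [by apply: eq_rint => t; ring|by apply: L1B => //; exact: L1Z|exact: L1Z].
rewrite -HP// -/c rint_kernel//; lra.
Qed.

Lemma field_le_HL u M a x w c : poisson_field u M -> 0 < a -> 0 < x -> 0 < c ->
  (HL_maximal (fun t => (u a t ^+ 2)%R) w <= c%:E)%E -> u (a + x) w ^+ 2 <= 8 * c.
Proof.
move=> Pu a0 x0 c0 HLc; have [_ HL _ _ _] := Pu.
have g1 : L1 (fun t => u a t ^+ 2) := L2_sqr (HL a a0).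
have pi2 := @pi_ge2 R; have pi0 := @pi_gt0 R.
have H : rint (fun t => u a t ^+ 2 * kernel x w t) <= 16 * c / x.
  apply: poisson_le_averages => //; first by move=> t; exact: sqr_ge0.
  move=> r r0.
  have : (iavg (fun t => (u a t ^+ 2)%R) (ball w r) <= c%:E)%E.
    apply: le_trans HLc; apply: ereal_sup_ubound; exists r => //=.
    by rewrite in_itv/= r0.
  rewrite /iavg lebesgue_measure_ball ?(ltW r0)//.
  have -> : (\int[mu]_(y in ball w r) `|(u a y ^+ 2)%:E| =
      (rint (fun t => u a t ^+ 2 * \1_(ball w r) t))%:E)%E.
    rewrite -EFin_rint; last by apply: L1_mul_indic => //; exact: measurable_ball.
    rewrite integral_mkcond; apply: eq_integral => t _.
    rewrite patchE indicE; case: ifP => _; rewrite ?mulr1 ?mulr0//.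
    by rewrite abse_EFin ger0_norm ?sqr_ge0.
  rewrite inver gt_eqF ?pmulrn_lgt0// -EFinM lee_fin ler_pdivrMl ?pmulrn_lgt0//.
  by rewrite mulrC mulr_natl.
have := le_trans (field_jensen w Pu a0 x0) H.
rewrite mulrA ler_pdivrMr// divfK ?gt_eqF// => h.
have : u (a + x) w ^+ 2 * 2 <= u (a + x) w ^+ 2 * pi by rewrite ler_wpM2l// sqr_ge0.
lra.
Qed.

(** The factor 8 is the one lost in [field_le_HL] between the maximal function and
    the field. *)
Definition exceed u c a := [set w : R | exists2 x, a < x & 8 * c < u x w ^+ 2].

Lemma measurable_exceed u M c a : poisson_field u M -> 0 <= a -> measurable (exceed u c a).
Proof.
move=> [cu _ _ _ _] a0; apply: open_measurable.
rewrite (_ : exceed u c a = \bigcup_(x in [set x | a < x]) [set w | 8 * c < u x w ^+ 2]); last first.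
  by apply/seteqP; split=> w [x ax h]; exists x.
apply: bigcup_open => x /= ax; have x0 : 0 < x by exact: le_lt_trans ax.
apply: (@open_comp _ _ (fun w => u x w ^+ 2) [set y | 8 * c < y]); last exact: open_gt.
move=> w _; apply: (@continuous_comp _ _ _ (u x) (fun y => y ^+ 2)); first exact: cu.
exact: exprn_continuous.
Qed.

(** The set lies in the one where the maximal function of [u a ^+ 2] exceeds c, whose
    measure is bounded by the weak-type inequality. *)
Lemma measure_exceed u M c a : poisson_field u M -> 0 < a -> 0 < c ->
  (mu (exceed u c a) <= (3 / c * rint (fun w => u a w ^+ 2))%:E)%E.
Proof.
move=> Pu a0 c0; have [_ HL _ _ _] := Pu.
have g1 : L1 (fun t => u a t ^+ 2) := L2_sqr (HL a a0).
have lg : locally_integrable [set: R] (fun t => u a t ^+ 2).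
  by have := integrable_locally measurableT g1; rewrite patch_setT.
have mHL := measurable_HL_maximal lg.
have mS : measurable [set w | (c%:E < HL_maximal (fun t => (u a t ^+ 2)%R) w)%E].
  by rewrite -[X in measurable X]setTI; apply: emeasurable_fun_o_infty.
apply: (@le_trans _ _ (mu [set w | (c%:E < HL_maximal (fun t => (u a t ^+ 2)%R) w)%E])).
  apply: le_measure; rewrite ?inE//.
    by apply: (measurable_exceed _ Pu); exact: ltW.
  move=> w [x ax h] /=; rewrite ltNge; apply/negP => le.
  move: h; apply/negP; rewrite -leNgt.
  rewrite -(subrK a x) [x - a + a]addrC; apply: (field_le_HL Pu) => //.
  by rewrite subr_gt0.
apply: (le_trans (maximal_inequality lg c0)).
rewrite (_ : (\int[mu]_y `|(u a y ^+ 2)%:E|)%E = (rint (fun w => u a w ^+ 2))%:E).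
  by rewrite -EFinM.
by rewrite -EFin_rint//; apply: eq_integral => t _; rewrite abse_EFin ger0_norm ?sqr_ge0.
Qed.

(** The line Re = 0 itself carries no function yet, so the bound is obtained by
    exhausting the set from lines to the right of it. *)
Lemma measure_exceed0 u M c a0 (e : R) : poisson_field u M -> 0 < c -> 0 < a0 ->
  (forall a, 0 < a -> a < a0 -> rint (fun w => u a w ^+ 2) <= e) ->
  (mu (exceed u c 0) <= (3 / c * e)%:E)%E.
Proof.
move=> Pu c0 a00 He.
pose F n := exceed u c (a0 / n.+2%:R).
have pos n : 0 < a0 / n.+2%:R by rewrite divr_gt0.
have mF n : measurable (F n) by apply: (measurable_exceed _ Pu); exact: ltW.
have E : exceed u c 0 = \bigcup_n F n.
  apply/seteqP; split=> [w [x x0 h]|w [n _ [x nx h]]]; last by exists x => //; exact: lt_trans nx.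
  have : \forall n \near \oo, a0 / x < n%:R by exact: nbhs_infty_gtr.
  move=> [n _ /(_ n (leqnn n))] /= xn; exists n => //; exists x => //.
  rewrite ltr_pdivrMr// mulrC -ltr_pdivrMr// (lt_le_trans xn)// ler_nat.
  by rewrite (leq_trans (leqnSn n)).
have C := @nondecreasing_cvg_mu _ _ _ mu F mF.
have {}C : (mu \o F) x @[x --> \oo] --> mu (exceed u c 0).
  rewrite E; apply: C.
    by rewrite -E; apply: (measurable_exceed _ Pu).
  move=> n m nm; apply/subsetPset => w [x nx h]; exists x => //.
  apply: le_lt_trans nx; rewrite ler_wpM2l ?(ltW a00)// lef_pV2 ?posrE//.
  by rewrite ler_nat !ltnS.
rewrite -(cvg_lim _ C)//; apply: lime_le; first by apply/cvg_ex; exists (mu (exceed u c 0)).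
apply: nearW => n; apply: (le_trans (measure_exceed Pu (pos n) c0)).
rewrite lee_fin ler_wpM2l ?divr_ge0 ?(ltW c0)// He//.
by rewrite ltr_pdivrMr// ltr_pMr// ltr1n.
Qed.

Lemma field_diff u M d : poisson_field u M -> 0 <= d ->
  poisson_field (fun x w => u x w - u (x + d) w) (4 * M).
Proof.
move=> [cu HL HM cx HP] d0.
have pd x : 0 < x -> 0 < x + d by move=> ?; exact: ltr_wpDr.
split.
- by move=> x x0 w; apply: cvgB; apply: cu => //; exact: pd.
- by move=> x x0; apply: L2B; apply: HL => //; exact: pd.
- move=> x x0; have L1 := HL _ x0; have L2' := HL _ (pd _ x0).
  apply: (@le_trans _ _ (2 * rint (fun w => u x w ^+ 2) + 2 * rint (fun w => u (x + d) w ^+ 2))).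
    rewrite -rintZ; last exact: L2_sqr. rewrite -rintZ; last exact: L2_sqr.
    rewrite -rintD; [|by apply: L1Z; exact: L2_sqr..].
    apply: le_rint; [by apply: L2_sqr; exact: L2B|by apply: L1D; apply: L1Z; exact: L2_sqr|].
    by move=> w; have := sqr_ge0 (u x w + u (x + d) w); nra.
  by have := HM _ x0; have := HM _ (pd _ x0); lra.
- move=> x w x0; apply: cvgB; first exact: cx.
  apply: (@continuous_comp _ _ _ (fun x => x + d) (u^~ w)); last exact/cx/pd.
  by apply: cvgD; [exact: cvg_id|exact: cvg_cst].
- move=> a x w a0 x0.
  rewrite mulrBl HP// addrAC HP//; last exact: pd.
  rewrite -rintB; [by apply: eq_rint => t; ring|..]; apply: L1_mul_kernel => //; apply: HL => //.
  exact: pd.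
Qed.

(** The field [x |-> u x - u (x + d)] has a small norm when d is small, so the
    set of heights where it is large for some x has a small measure. Off the
    resulting null set, u x w stays close to u (x + d) w uniformly in x, and the
    latter converges as x tends to 0 because x + d stays away from 0. *)
Lemma field_limit u M : poisson_field u M -> exists N : set R,
  [/\ measurable N, mu N = 0%E & forall w, ~ N w -> cvg (u x w @[x --> 0^'+])].
Proof.
move=> Pu; have [_ _ _ cx _] := Pu.
pose v d x w := u x w - u (x + d) w.
have Pv d : 0 < d -> poisson_field (v d) (4 * M) by move=> d0; apply: field_diff => //; exact: ltW.
have small c e : 0 < c -> 0 < e -> exists2 d, 0 < d & (mu (exceed (v d) c 0) <= e%:E)%E.
  move=> c0 e0.
  have ce0 : 0 < c * e / 3 by rewrite divr_gt0// mulr_gt0.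
  have [d d0 Hd] := field_cauchy Pu ce0.
  have d20 : 0 < d / 2 by rewrite divr_gt0.
  exists (d / 2) => //.
  have -> : e = 3 / c * (c * e / 3) by field; rewrite gt_eqF.
  apply: (measure_exceed0 (Pv _ d20) c0 d20) => a a0 ad; apply: Hd; lra.
have pos n : 0 < n.+1%:R^-1 :> R by rewrite invr_gt0.
have /choice[D HD] : forall k : nat * nat, exists d : R, 0 < d /\
    (mu (exceed (v d) (k.1.+1%:R^-1) 0) <= (k.2.+1%:R^-1)%:E)%E.
  move=> -[j n] /=; have [d d0 h] := small _ _ (pos j) (pos n).
  by exists d.
(* E j n is a set of measure at most 1 / (n + 1) off which the oscillation
   between x and x + D (j, n) is at most 8 / (j + 1), in square *)
pose E j n := exceed (v (D (j, n))) (j.+1%:R^-1) 0.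
have mE j n : measurable (E j n) by apply: (measurable_exceed _ (Pv _ (HD (j, n)).1)).
have mI j : measurable (\bigcap_n E j n) by apply: bigcapT_measurable.
have mN : measurable (\bigcup_j \bigcap_n E j n) by apply: bigcupT_measurable.
exists (\bigcup_j \bigcap_n E j n); split=> //.
- apply: (proj1 (negligibleP mu mN)); apply: negligible_bigcup => j; apply: (proj2 (negligibleP mu (mI j))).
  apply/eqP; rewrite eq_le measure_ge0 andbT; apply/lee_addgt0Pr => e e0; rewrite add0e.
  have [n _ /(_ n (leqnn n)) /= hn] := near_infty_natSinv_lt (PosNum e0).
  have sub : \bigcap_n E j n `<=` E j n by apply: bigcap_inf.
  have h : (mu (\bigcap_n E j n) <= mu (E j n))%E by apply: le_measure => //; rewrite inE; [exact: mI|exact: mE].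
  apply: (le_trans h).
  by apply: (le_trans (HD (j, n)).2); rewrite lee_fin ltW.
- move=> w Nw; apply/cauchy_cvgP; apply: cauchy_exP => /= e e0.
  have e40 : 0 < (e / 4) ^+ 2 / 8 by rewrite divr_gt0// exprn_gt0// divr_gt0.
  have [j _ /(_ j (leqnn j)) /= hj] := near_infty_natSinv_lt (PosNum e40).
  have [n hn] : exists n, ~ E j n w.
    by apply/not_existsP => H; apply: Nw; exists j => // n _; exact: contrapT.
  pose d := D (j, n); have d0 : 0 < d := (HD (j, n)).1.
  have vb x : 0 < x -> `|v d x w| <= e / 4.
    move=> x0; have : v d x w ^+ 2 <= 8 * j.+1%:R^-1.
      by rewrite leNgt; apply/negP => h; apply: hn; exists x.
    move=> h; have h2 : v d x w ^+ 2 <= (e / 4) ^+ 2.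
      by apply: (le_trans h); rewrite mulrC -ler_pdivlMr//; exact: ltW.
    rewrite -(real_normK (num_real (v d x w))) in h2.
    by rewrite -(@ler_pXn2r _ 2%N) ?nnegrE// divr_ge0// ltW.
  exists (u d w).
  have cd : u (x + d) w @[x --> 0^'+] --> u d w.
    have := cx d w d0; rewrite /prop_for /continuous_at -{1}(add0r d) => H.
    apply: (@cvg_comp _ _ _ (fun x => x + d) (u^~ w) _ _ _ _ H).
    apply: cvg_at_right_filter; apply: cvgD; [exact: cvg_id|exact: cvg_cst].
  have e4 : 0 < e / 4 by rewrite divr_gt0.
  near=> x; rewrite /ball/=.
  have x0 : 0 < x by near: x; exact: nbhs_right_gt.
  have h1 : `|u d w - u (x + d) w| <= e / 4 by near: x; exact: (cvgrPdist_le _ _).1 cd _ e4.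
  have := vb x x0; rewrite /v distrC => h2.
  have := ler_normD (u d w - u (x + d) w) (u (x + d) w - u x w); rewrite addrA subrK; lra.
Unshelve. all: by end_near. Qed.

End FatouReal.

(** * Boundary functions *)

Section BoundaryFunction.
Context {R : realType}.
Local Notation mu := (@lebesgue_measure R).
Implicit Types (u : R -> R -> R) (M x w : R) (N : set R).

Lemma cvg_sqr {T : Type} (F : set_system T) {FF : Filter F} (f : T -> R) (l : R) :
  f @ F --> l -> (fun t => f t ^+ 2) @ F --> l ^+ 2.
Proof.
move=> fl; rewrite expr2 (_ : (fun t => f t ^+ 2) = fun t => f t * f t).
  exact: cvgM.
by apply/funext => t; rewrite expr2.
Qed.

Lemma limn_einf_le (v : nat -> \bar R) (e : \bar R) :
  (forall n, (v n <= e)%E) -> (limn_einf v <= e)%E.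
Proof.
move=> ve; rewrite limn_einf_lim; apply: lime_le; first exact: is_cvg_einfs.
by apply: nearW => n; apply: le_trans (ve n); apply: ereal_inf_lbound; exists n => /=.
Qed.

Lemma integral_off_null (f : R -> R) N : measurable N -> mu N = 0%E -> mble f ->
  (forall w, 0 <= f w) ->
  (\int[mu]_w (f w)%:E = \int[mu]_(w in setT `\` N) (f w)%:E)%E.
Proof.
move=> mN N0 mf f0; apply: ge0_negligible_integral => //.
- exact/measurable_EFinP.
- by move=> w _; rewrite lee_fin.
Qed.

Lemma fatou_ae (f_ : nat -> R -> R) (f : R -> R) N (e : R) :
  measurable N -> mu N = 0%E -> (forall n, mble (f_ n)) -> mble f ->
  (forall n w, 0 <= f_ n w) -> (forall w, 0 <= f w) ->
  (forall w, ~ N w -> f_ n w @[n --> \oo] --> f w) ->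
  (forall n, (\int[mu]_w (f_ n w)%:E <= e%:E)%E) -> (\int[mu]_w (f w)%:E <= e%:E)%E.
Proof.
move=> mN N0 mf_ mf f_0 f0 cf He.
have mD : measurable (setT `\` N) by apply: measurableD.
rewrite (integral_off_null mN)//.
have F := @fatou _ _ _ mu _ mD (fun n w => (f_ n w)%:E).
apply: (le_trans (le_trans _ (F _ _))).
- rewrite le_eqVlt; apply/orP; left; apply/eqP; apply: eq_integral => w.
  rewrite inE => -[_ Nw]; apply/esym.
  have C : (f_ n w)%:E @[n --> \oo] --> (f w)%:E.
    by apply: cvg_EFin; [exact: nearW|exact: cf].
  by have [-> _] := cvg_limn_einf_sup C.
- by move=> n; apply/measurable_EFinP; exact: measurable_funTS (mf_ n).
- by move=> n w _; rewrite lee_fin.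
- apply: limn_einf_le => n; apply: le_trans (He n).
  by rewrite (integral_off_null mN).
Qed.

(** Fatou's lemma, applied to the squared differences between the lines, transfers
    [field_cauchy] to the pointwise limit. *)
Lemma field_boundary u M : poisson_field u M -> exists N h,
  [/\ measurable N, mu N = 0%E, L2 h,
      forall w, ~ N w -> u x w @[x --> 0^'+] --> h w &
      forall e : R, 0 < e -> exists2 d : R, 0 < d & forall x, 0 < x -> x < d ->
        rint (fun w => (u x w - h w) ^+ 2) <= e].
Proof.
move=> Pu; have [N [mN N0 Hlim]] := field_limit Pu; have [cu HL HM _ _] := Pu.
pose a n : R := n.+1%:R^-1.
have a0 n : 0 < a n by rewrite invr_gt0.
have ac : a n @[n --> \oo] --> 0.
  apply/cvgrPdist_lt => /= e e0; near=> n; rewrite sub0r normrN gtr0_norm//.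
  by near: n; exact: (near_infty_natSinv_lt (PosNum e0)).
pose h w := if pselect (N w) then 0 else lim (u x w @[x --> 0^'+]).
have hE w : ~ N w -> u x w @[x --> 0^'+] --> h w.
  by move=> Nw; rewrite /h; case: pselect => //= ?; exact: Hlim.
have hseq w : ~ N w -> u (a n) w @[n --> \oo] --> h w.
  by move=> /hE/cvg_at_rightP; apply.
have mh : mble h.
  apply: (@measurable_fun_cvg _ _ _ setT (fun n w => u (a n) w * \1_(~` N) w)).
    move=> n; apply: mbleM; first exact: mble_continuous (cu _ (a0 n)).
    by apply: measurable_indic; exact: measurableC.
  move=> w _; have [Nw|Nw] := pselect (N w).
    have -> : h w = 0 by rewrite /h; case: pselect.
    rewrite indicE memNset; last by move=> /(_ Nw).
    by under eq_fun do rewrite mulr0; exact: cvg_cst.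
  rewrite indicE mem_set//; under eq_fun do rewrite mulr1; exact: hseq.
have sq (f g : R -> R) : mble f -> mble g -> mble (fun w => (f w - g w) ^+ 2).
  by move=> mf mg; apply: mble_sqr; exact: mbleB.
have L2h : L2 h.
  apply: (@ltoo_L2 _ _ M) => //.
  apply: (fatou_ae (f_ := fun n w => u (a n) w ^+ 2) mN N0) => //.
  - by move=> n; apply: mble_sqr; exact: L2_mble (HL _ (a0 n)).
  - exact: mble_sqr.
  - by move=> n w; exact: sqr_ge0.
  - by move=> w; exact: sqr_ge0.
  - move=> w Nw; by apply: cvg_sqr; exact: hseq.
  - by move=> n; rewrite (EFin_rint (L2_sqr (HL _ (a0 n)))) lee_fin; exact: HM.
exists N, h; split=> // e e0.
have [d d0 Hd] := field_cauchy Pu e0.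
exists d => // x x0 xd.
have Lx := HL x x0.
apply: rint_le; first by apply: L2_sqr; exact: L2B.
have [m _ Hm] : \forall n \near \oo, a n < x.
  exact: (near_infty_natSinv_lt (PosNum x0)).
apply: (fatou_ae (f_ := fun n w => (u x w - u (a (n + m)%N) w) ^+ 2) mN N0) => //.
- by move=> n; apply: sq; [exact: L2_mble Lx|exact: L2_mble (HL _ (a0 _))].
- by apply: sq => //; exact: L2_mble Lx.
- by move=> n w; exact: sqr_ge0.
- by move=> w; exact: sqr_ge0.
- move=> w Nw.
  have C : u x w - u (a (n + m)%N) w @[n --> \oo] --> u x w - h w.
    apply: cvgB; first exact: cvg_cst.
    by rewrite (cvg_shiftn m (fun n => u (a n) w)); exact: hseq.
  exact: cvg_sqr.
- move=> n; rewrite EFin_rint; last by apply: L2_sqr; apply: L2B => //; exact: HL.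
  rewrite lee_fin; apply: (@le_trans _ _ (rint (fun w => (u (a (n + m)%N) w - u x w) ^+ 2))).
    rewrite le_eqVlt; apply/orP; left; apply/eqP; apply: eq_rint => w.
    by rewrite -[(u x w - _) ^+ 2]sqrrN opprB.
  by apply: Hd => //; [apply: Hm; exact: leq_addl|exact: ltW].
Unshelve. all: by end_near. Qed.

Lemma boundary_product (u : R -> R -> R) (h k : R -> R) (l : R -> R) (L : R) :
  (forall x, 0 < x -> L2 (u x)) -> L2 h -> L2 k ->
  (forall e : R, 0 < e -> exists2 d : R, 0 < d & forall x, 0 < x -> x < d ->
        rint (fun w => (u x w - h w) ^+ 2) <= e) ->
  (forall x, 0 < x -> rint (fun w => u x w * k w) = l x) ->
  l x @[x --> 0^'+] --> L -> rint (fun w => h w * k w) = L.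
Proof.
move=> Hu Lh Lk Hd Hl lL.
apply: (cvg_unique _ _ lL) => //.
apply/cvgrPdist_le => /= e e0.
set K := rint (fun w => k w ^+ 2).
have K0 : 0 <= K by apply: rint_ge0 => w; exact: sqr_ge0.
have eK : 0 < e ^+ 2 / (K + 1) by rewrite divr_gt0 ?exprn_gt0//; lra.
have [d d0 {}Hd] := Hd _ eK.
near=> x.
have x0 : 0 < x by near: x; exact: nbhs_right_gt.
have xd : x < d by near: x; exact: nbhs_right_lt.
have Lx := Hu x x0.
rewrite -Hl// distrC -rintB; [|exact: L2M|exact: L2M].
have -> : rint (fun w => u x w * k w - h w * k w) = rint (fun w => (u x w - h w) * k w).
  by apply: eq_rint => w; rewrite mulrBl.
rewrite -(@ler_pXn2r _ 2%N) ?nnegrE ?(ltW e0)// real_normK ?num_real//.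
apply: (le_trans (cauchy_schwarz (L2B Lx Lh) Lk)); rewrite -/K.
apply: (@le_trans _ _ (e ^+ 2 / (K + 1) * K)).
  by rewrite ler_wpM2r//; exact: Hd.
rewrite mulrAC ler_pdivrMr; last lra.
by rewrite ler_wpM2l ?sqr_ge0//; lra.
Unshelve. all: by end_near. Qed.

End BoundaryFunction.

Section HardyBoundary.
Context {R : realType}.
Local Notation mu := (@lebesgue_measure R).
Implicit Types (F : R[i] -> R[i]) (M x w p q : R) (N : set R).

(** Multiplication by - i turns imaginary parts into real parts; statements on the
    former follow from statements on the latter. *)
Lemma hardy_bound_mul F M (k : R[i]) : modulus k = 1 -> hardy_bound F M ->
  hardy_bound (fun z => F z * k) M.
Proof.
move=> k1 [hF HM]; split=> [s s0|x x0].
  by apply: holomorphicM; [exact: hF|exact: holomorphic_cst].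
by under eq_integral do rewrite modulusM k1 mulr1; exact: HM.
Qed.

Lemma ip_rp F : ip F = rp (fun z => F z * (0 -i* 1)).
Proof.
apply/funext => x; apply/funext => w; rewrite /ip /rp.
by case: (F _) => a b /=; ring.
Qed.

Lemma rp_ip F : ip (fun z => F z * (0 -i* 1)) = fun x w => - rp F x w.
Proof.
apply/funext => x; apply/funext => w; rewrite /ip /rp.
by case: (F _) => a b /=; ring.
Qed.

Lemma modulus_mi : modulus (0 -i* 1 : R[i]) = 1.
Proof. by rewrite modulus_imag normrN normr1. Qed.

Lemma hardy_field F M : hardy_bound F M -> poisson_field (rp F) M.
Proof.
move=> HF; split.
- by move=> x x0; exact: (hardy_continuous HF x0).1.
- by move=> x x0; have [] := hardy_L2 HF x0.
- by move=> x x0; have [] := hardy_L2 HF x0.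
- move=> x w x0; apply/cvgrPdist_le => /= e e0.
  have [r r0 H] := cr_at_joint (hardy_cr w HF x0) (or_introl erefl) e0.
  near=> y; rewrite distrC; apply: H; last by rewrite subrr normr0 ltW.
  by rewrite distrC; near: y; apply: cvgr_dist_le => //; exact: cvg_id.
- move=> a x w a0 x0.
  have xE : complex.Re ((a + x) +i* w) - a = x by rewrite /= addrAC subrr add0r.
  have [|_] := @hardy_poisson R F M a ((a + x) +i* w) HF a0; first by rewrite /= ltrDl.
  by rewrite xE => ->.
Unshelve. all: by end_near. Qed.

Lemma hardy_field_im F M : hardy_bound F M -> poisson_field (ip F) M.
Proof. by move=> HF; rewrite ip_rp; apply/hardy_field/hardy_bound_mul/HF/modulus_mi. Qed.

(** The real and imaginary parts of the Cauchy kernel 1 / (sigma - i w), for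
    sigma = p + i q. *)
Definition cauchy_re p q w := p * kernel p q w.
Definition cauchy_im p q w := (w - q) * kernel p q w.

Lemma cauchy_kernelE p q w : 0 < p ->
  ((p +i* q) - (0 +i* w))^-1 = cauchy_re p q w +i* cauchy_im p q w.
Proof.
move=> p0; have d0 := @kernel_den_gt0 R p q w p0.
apply: (mulfI (x := (p +i* q) - (0 +i* w))).
  by rewrite eq_complex negb_and/= subr0 gt_eqF.
rewrite divff; last by rewrite eq_complex negb_and/= subr0 gt_eqF.
rewrite /cauchy_re /cauchy_im /kernel; apply/eqP; rewrite eq_complex/=.
by apply/andP; split; apply/eqP; field; rewrite gt_eqF.
Qed.

Lemma L2_cauchy_re p q : 0 < p -> L2 (cauchy_re p q).
Proof. by move=> p0; apply: L2Z; exact: L2_kernel. Qed.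

Lemma L2_cauchy_im p q : 0 < p -> L2 (cauchy_im p q).
Proof.
move=> p0; have mk := mble_continuous (@continuous_kernel R p q p0).
have m : mble (cauchy_im p q).
  apply: mbleM => //; apply: mble_continuous => w.
  by apply: cvgB; [exact: cvg_id|exact: cvg_cst].
split=> //; apply: (L1_le (mble_sqr m) _ (@L1_kernel R p q p0)) => w.
rewrite ger0_norm ?sqr_ge0// /cauchy_im /kernel exprMn.
have d0 := @kernel_den_gt0 R p q w p0; rewrite exprVn ler_pdivrMr ?exprn_gt0//.
by rewrite expr2 mulrA mulVf ?gt_eqF// mul1r lerDr sqr_ge0.
Qed.

(** The first identity is Poisson's formula. The second one is [hardy_orthogonal] for
    the c that makes z + c equal to the conjugate of sigma - i w on the line. *)
Lemma cauchy_level_re F M x p q : hardy_bound F M -> 0 < x -> 0 < p ->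
  rint (fun w => rp F x w * cauchy_re p q w) = pi * rp F (x + p) q /\
  rint (fun w => rp F x w * cauchy_re p q w) + rint (fun w => ip F x w * cauchy_im p q w) = 0.
Proof.
move=> HF x0 p0; have [L2r L2i _ _] := hardy_L2 HF x0.
have [_ _ _ _ HP] := hardy_field HF.
split.
  rewrite /cauchy_re -[RHS](_ : p * rint (fun w => rp F x w * kernel p q w) = _).
    rewrite -rintZ; first by apply: eq_rint => w; ring.
    by apply: L2M => //; exact: L2_kernel.
  by rewrite -HP//; field; rewrite gt_eqF.
have c0 : 0 < x + complex.Re ((p - x) +i* - q) by rewrite /= addrC subrK.
have [_] := hardy_orthogonal HF x0 c0.
rewrite -rintD; [|by apply: L2M => //; exact: L2_cauchy_re|by apply: L2M => //; exact: L2_cauchy_im].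
move=> <-; apply: eq_rint => w; rewrite [RHS]/rp.
have -> : (x +i* w) + ((p - x) +i* - q) = (p +i* q)^* + (0 +i* w).
  by apply/eqP; rewrite eq_complex/=; apply/andP; split; apply/eqP; ring.
have -> : (p +i* q)^* + (0 +i* w) = ((p +i* q) - (0 +i* w))^*.
  by apply/eqP; rewrite eq_complex/=; apply/andP; split; apply/eqP; ring.
rewrite -conjc_inv cauchy_kernelE//= /rp /ip.
by case: (F (x +i* w)) => a b /=; ring.
Qed.

Lemma cauchy_level F M x p q : hardy_bound F M -> 0 < x -> 0 < p ->
  [/\ rint (fun w => rp F x w * cauchy_re p q w) = pi * rp F (x + p) q,
      rint (fun w => ip F x w * cauchy_re p q w) = pi * ip F (x + p) q,
      rint (fun w => rp F x w * cauchy_im p q w) = pi * ip F (x + p) q &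
      rint (fun w => ip F x w * cauchy_im p q w) = - pi * rp F (x + p) q].
Proof.
move=> HF x0 p0; have [L2r L2i _ _] := hardy_L2 HF x0.
have [E1 E2] := cauchy_level_re q HF x0 p0.
have [] := cauchy_level_re q (hardy_bound_mul modulus_mi HF) x0 p0.
rewrite -ip_rp rp_ip => E3.
rewrite (_ : (fun w => - rp F x w * cauchy_im p q w) =
  (fun w => (-1) * (rp F x w * cauchy_im p q w))); last first.
  by apply/funext => w; rewrite mulN1r mulNr.
rewrite rintZ; last by apply: L2M => //; exact: L2_cauchy_im.
by move=> E4; split=> //; lra.
Qed.

Lemma field_cvg_shift (u : R -> R -> R) M p q : poisson_field u M -> 0 < p ->
  u (x + p) q @[x --> 0^'+] --> u p q.
Proof.
move=> [_ _ _ cx _] p0; have := cx p q p0; rewrite /prop_for /continuous_at -{1}(add0r p) => H.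
apply: (@cvg_comp _ _ _ (fun x => x + p) (u^~ q) _ _ _ _ H).
by apply: cvg_at_right_filter; apply: cvgD; [exact: cvg_id|exact: cvg_cst].
Qed.

(** The identities of [cauchy_level] pass to the limit x = 0 since the two parts
    converge in mean square. *)
Theorem hardy_boundary F M : hardy_bound F M -> exists N h1 h2,
  [/\ measurable N, mu N = 0%E, L2 h1 /\ L2 h2,
      forall w, ~ N w -> rp F x w @[x --> 0^'+] --> h1 w /\ ip F x w @[x --> 0^'+] --> h2 w &
      forall p q, 0 < p ->
        [/\ rint (fun w => h1 w * cauchy_re p q w) = pi * rp F p q,
            rint (fun w => h2 w * cauchy_re p q w) = pi * ip F p q,
            rint (fun w => h1 w * cauchy_im p q w) = pi * ip F p q &
            rint (fun w => h2 w * cauchy_im p q w) = - pi * rp F p q] ].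
Proof.
move=> HF; have F1 := hardy_field HF; have F2 := hardy_field_im HF.
have [N1 [h1 [mN1 N10 Lh1 c1 d1]]] := field_boundary F1.
have [N2 [h2 [mN2 N20 Lh2 c2 d2]]] := field_boundary F2.
have H1 x : 0 < x -> L2 (rp F x) by move=> x0; have [] := hardy_L2 HF x0.
have H2 x : 0 < x -> L2 (ip F x) by move=> x0; have [] := hardy_L2 HF x0.
exists (N1 `|` N2), h1, h2; split=> //.
- exact: measurableU.
- by apply: null_set_setU.
- by move=> w Nw; split; [apply: c1|apply: c2] => ?; apply: Nw; [left|right].
- move=> p q p0; have k1 := @L2_cauchy_re p q p0; have k2 := @L2_cauchy_im p q p0.
  have l1 (k : R) : k * rp F (x + p) q @[x --> 0^'+] --> k * rp F p q.
    by apply: cvgM; [exact: cvg_cst|exact: field_cvg_shift F1 p0].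
  have l2 (k : R) : k * ip F (x + p) q @[x --> 0^'+] --> k * ip F p q.
    by apply: cvgM; [exact: cvg_cst|exact: field_cvg_shift F2 p0].
  split; [apply: (boundary_product H1 Lh1 k1 d1 _ (l1 _))|
          apply: (boundary_product H2 Lh2 k1 d2 _ (l2 _))|
          apply: (boundary_product H1 Lh1 k2 d1 _ (l2 _))|
          apply: (boundary_product H2 Lh2 k2 d2 _ (l1 _))] => x x0;
  by have [] := cauchy_level q HF x0 p0.
Qed.

End HardyBoundary.

(** * Complex square-integrable functions and simple poles *)

Section OffNull.
Context {R : realType}.
Local Notation mu := (@lebesgue_measure R).
Import HBNNSimple.

(** The integral of f is a supremum over simple functions below f, which cannot
    exploit a null set even when f is not measurable; boundary values are such
    functions, arbitrary where the limit does not exist. *)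
Lemma ge0_integral_eq_off_null (f g : R -> R) (N : set R) : measurable N -> mu N = 0%E ->
  (forall w, 0 <= f w) -> (forall w, 0 <= g w) -> mble g -> (forall w, ~ N w -> f w = g w) ->
  (\int[mu]_w (f w)%:E = \int[mu]_w (g w)%:E)%E.
Proof.
move=> mN N0 f0 g0 mg fg.
have mD : measurable (setT `\` N) by apply: measurableD.
apply/eqP; rewrite eq_le; apply/andP; split.
  rewrite ge0_integralTE; last by move=> w; rewrite lee_fin.
  apply: ge_ereal_sup => _ [h /= hf <-]; rewrite -integralT_nnsfun.
  have mh' : measurable_fun setT h by exact: measurable_funPT.
  have mh : mble (h : R -> R) := mh'.
  have h0 w : 0 <= h w by exact: fun_ge0.
  rewrite (integral_off_null mN N0 mh h0) (integral_off_null mN N0 mg g0).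
  apply: ge0_le_integral => //.
  - by move=> w _; rewrite lee_fin.
  - by apply/measurable_EFinP; exact: measurable_funTS mh.
  - by apply/measurable_EFinP; exact: measurable_funTS mg.
  - by move=> w [_ /fg <-]; exact: hf.
pose g' w := g w * \1_(~` N) w.
have g'0 w : 0 <= g' w by rewrite mulr_ge0// indicE.
have mg' : mble g' by apply: mbleM => //; apply: measurable_indic; exact: measurableC.
have -> : (\int[mu]_w (g w)%:E = \int[mu]_w (g' w)%:E)%E.
  rewrite (integral_off_null mN N0 mg g0) (integral_off_null mN N0 mg' g'0).
  apply: eq_integral => w; rewrite inE => -[_ Nw].
  by rewrite /g' indicE mem_set// mulr1.
rewrite !ge0_integralTE; [|by move=> w; rewrite lee_fin..].
apply: ereal_sup_le => _ [h /= hg <-]; exists h => // w; apply: (le_trans (hg w)).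
rewrite lee_fin /g' indicE; have [Nw|Nw] := pselect (N w).
  by rewrite memNset ?mulr0// => /(_ Nw).
by rewrite mem_set// mulr1 fg.
Qed.

End OffNull.

Section ComplexL2.
Context {R : realType}.
Local Notation mu := (@lebesgue_measure R).
Implicit Types (f g h : R -> R[i]) (k l : R[i]).

Definition CL2 f := L2 (fun w => complex.Re (f w)) /\ L2 (fun w => complex.Im (f w)).
Definition cint f : R[i] := rint (fun w => complex.Re (f w)) +i* rint (fun w => complex.Im (f w)).
Definition sqnorm f : R := rint (fun w => modulus (f w) ^+ 2).

Lemma CL2Z k f : CL2 f -> CL2 (fun w => k * f w).
Proof.
case: k => a b [f1 f2]; split.
- rewrite (_ : (fun w => _) = fun w => a * complex.Re (f w) - b * complex.Im (f w)).
    by apply: L2B; exact: L2Z.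
  by apply/funext => w; case: (f w).
- rewrite (_ : (fun w => _) = fun w => a * complex.Im (f w) + b * complex.Re (f w)).
    by apply: L2D; exact: L2Z.
  by apply/funext => w; case: (f w).
Qed.

Lemma CL2B f g : CL2 f -> CL2 g -> CL2 (fun w => f w - g w).
Proof.
move=> [f1 f2] [g1 g2]; split.
- rewrite (_ : (fun w => _) = fun w => complex.Re (f w) - complex.Re (g w)); first exact: L2B.
  by apply/funext => w; case: (f w) => a b; case: (g w).
- rewrite (_ : (fun w => _) = fun w => complex.Im (f w) - complex.Im (g w)); first exact: L2B.
  by apply/funext => w; case: (f w) => a b; case: (g w).
Qed.

Lemma L1_sqnorm f : CL2 f -> L1 (fun w => modulus (f w) ^+ 2).
Proof. by move=> [[_ f1] [_ f2]]; under eq_fun do rewrite modulus_sqr; exact: L1D. Qed.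

Lemma L1_mulJ f g : CL2 f -> CL2 g -> L1 (fun w => complex.Re (f w * (g w)^*)) /\
  L1 (fun w => complex.Im (f w * (g w)^*)).
Proof.
move=> [f1 f2] [g1 g2]; split.
- rewrite (_ : (fun w => _) = fun w => complex.Re (f w) * complex.Re (g w) +
    complex.Im (f w) * complex.Im (g w)); first by apply: L1D; exact: L2M.
  by apply/funext => w; case: (f w) => a b; case: (g w) => c d /=; ring.
- rewrite (_ : (fun w => _) = fun w => complex.Im (f w) * complex.Re (g w) -
    complex.Re (f w) * complex.Im (g w)); first by apply: L1B; exact: L2M.
  by apply/funext => w; case: (f w) => a b; case: (g w) => c d /=; ring.
Qed.

Lemma sqnormB f g : CL2 f -> CL2 g ->
  sqnorm (fun w => f w - g w) =
  sqnorm f - 2 * complex.Re (cint (fun w => f w * (g w)^*)) + sqnorm g.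
Proof.
move=> Lf Lg; have [i1 _] := L1_mulJ Lf Lg; rewrite /sqnorm /= -rintZ//.
have i2 := L1_sqnorm Lf; have i3 := L1_sqnorm Lg.
rewrite -rintB//; last exact: L1Z.
rewrite -rintD//; last by apply: L1B => //; exact: L1Z.
apply: eq_rint => w; rewrite !modulus_sqr.
by case: (f w) => a b; case: (g w) => c d /=; ring.
Qed.

Lemma cint_mulJ_lin f g h (a b : R[i]) : CL2 f -> CL2 g -> CL2 h ->
  cint (fun w => f w * (a * g w - b * h w)^*) =
  a^* * cint (fun w => f w * (g w)^*) - b^* * cint (fun w => f w * (h w)^*).
Proof.
move=> Lf Lg Lh; have [r1 i1] := L1_mulJ Lf Lg; have [r2 i2] := L1_mulJ Lf Lh.
case: a => a1 a2; case: b => b1 b2; apply/eqP; rewrite /cint eq_complex /=.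
apply/andP; split; apply/eqP.
- have -> : a1 * rint (fun w => complex.Re (f w * (g w)^*)) -
      (- a2) * rint (fun w => complex.Im (f w * (g w)^*)) -
      (b1 * rint (fun w => complex.Re (f w * (h w)^*)) -
      (- b2) * rint (fun w => complex.Im (f w * (h w)^*))) =
    (a1 * rint (fun w => complex.Re (f w * (g w)^*)) +
      a2 * rint (fun w => complex.Im (f w * (g w)^*))) -
      (b1 * rint (fun w => complex.Re (f w * (h w)^*)) +
       b2 * rint (fun w => complex.Im (f w * (h w)^*))) by ring.
  rewrite -!rintZ// -!rintD; try exact: L1Z.
  rewrite -rintB; try by apply: L1D; exact: L1Z.
  apply: eq_rint => w; case: (f w) => u1 u2; case: (g w) => v1 v2; case: (h w) => w1 w2 /=; ring.
- have -> : a1 * rint (fun w => complex.Im (f w * (g w)^*)) +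
      (- a2) * rint (fun w => complex.Re (f w * (g w)^*)) -
      (b1 * rint (fun w => complex.Im (f w * (h w)^*)) +
      (- b2) * rint (fun w => complex.Re (f w * (h w)^*))) =
    (a1 * rint (fun w => complex.Im (f w * (g w)^*)) -
      a2 * rint (fun w => complex.Re (f w * (g w)^*))) -
      (b1 * rint (fun w => complex.Im (f w * (h w)^*)) -
       b2 * rint (fun w => complex.Re (f w * (h w)^*))) by ring.
  rewrite -!rintZ// -!rintB; try exact: L1Z; try by apply: L1B; exact: L1Z.
  apply: eq_rint => w; case: (f w) => u1 u2; case: (g w) => v1 v2; case: (h w) => w1 w2 /=; ring.
Qed.

(** The boundary values of 1 / (s - l) on the imaginary axis. *)
Definition pole (l : R[i]) (w : R) : R[i] := ((0 +i* w) - l)^-1.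

Lemma poleJ l w : (pole l w)^* = ((- l^*) - (0 +i* w))^-1.
Proof.
rewrite /pole conjc_inv; congr (_^-1); case: l => a b.
by apply/eqP; rewrite eq_complex/=; apply/andP; split; apply/eqP; ring.
Qed.

Lemma pole_cauchy l w : complex.Re l < 0 ->
  pole l w = cauchy_re (- complex.Re l) (complex.Im l) w -i* cauchy_im (- complex.Re l) (complex.Im l) w.
Proof.
move=> l0; rewrite -[pole l w]conjcK poleJ.
have -> : - l^* = (- complex.Re l) +i* complex.Im l.
  by case: (l) => a b; apply/eqP; rewrite eq_complex/= opprK !eqxx.
by rewrite cauchy_kernelE ?oppr_gt0.
Qed.

Lemma CL2_pole l : complex.Re l < 0 -> CL2 (pole l).
Proof.
move=> l0; have l0' : 0 < - complex.Re l by rewrite oppr_gt0.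
split; under eq_fun do rewrite pole_cauchy//=; first exact: L2_cauchy_re.
by apply: L2N; exact: L2_cauchy_im.
Qed.

Lemma modulus_pole l w : modulus (pole l w) ^+ 2 = kernel (- complex.Re l) (complex.Im l) w.
Proof. by case: l => a b; rewrite /pole modulusV exprVn modulus_sqr /kernel /= sub0r. Qed.

(** The reproducing property: pairing with a simple fraction evaluates at the
    reflected pole. *)
Theorem hardy_boundary_complex (F : R[i] -> R[i]) (M : R) : hardy_bound F M -> exists N e,
  [/\ measurable N, mu N = 0%E, CL2 e,
      forall w, ~ N w -> rp F x w @[x --> 0^'+] --> complex.Re (e w) /\
                         ip F x w @[x --> 0^'+] --> complex.Im (e w) &
      forall l : R[i], complex.Re l < 0 ->
        cint (fun w => e w * (pole l w)^*) = (2 * pi)%:C * F (- l^*)].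
Proof.
move=> /hardy_boundary[N [h1 [h2 [mN N0 [Lh1 Lh2] lim Hk]]]].
exists N, (fun w => h1 w +i* h2 w); split=> // l l0.
have p0 : 0 < - complex.Re l by rewrite oppr_gt0.
have [k1 k2 k3 k4] := Hk _ (complex.Im l) p0.
have -> : - l^* = (- complex.Re l) +i* complex.Im l.
  by case: (l) => a b; apply/eqP; rewrite eq_complex/= opprK !eqxx.
move: k1 k2 k3 k4; set p := - complex.Re l; set q := complex.Im l => k1 k2 k3 k4.
have Lc := L2_cauchy_re q p0; have Ls := L2_cauchy_im q p0.
have E w : (pole l w)^* = cauchy_re p q w +i* cauchy_im p q w.
  by rewrite pole_cauchy//= opprK.
apply/eqP; rewrite /cint eq_complex/=; apply/andP; split; apply/eqP.
- transitivity (rint (fun w => h1 w * cauchy_re p q w - h2 w * cauchy_im p q w)).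
    by apply: eq_rint => w; move: (E w); case: (pole l w) => a b /= [<- <-].
  rewrite rintB; [|exact: L2M|exact: L2M].
  by rewrite k1 k4 /rp /ip; case: (F _) => a b /=; ring.
- transitivity (rint (fun w => h1 w * cauchy_im p q w + h2 w * cauchy_re p q w)).
    by apply: eq_rint => w; move: (E w); case: (pole l w) => a b /= [<- <-].
  rewrite rintD; [|exact: L2M|exact: L2M].
  by rewrite k2 k3 /rp /ip; case: (F _) => a b /=; ring.
Qed.

End ComplexL2.

(** * Diagonal models *)

Section Models.
Context {R : realType}.
Variables r n : nat.
Implicit Types (m : ph_model R r n) (lam : 'I_r -> R[i]) (B : 'M[R[i]]_(r, n)).

Lemma conjcE (z : R[i]) : Num.conj z = z^*.
Proof. by []. Qed.

(** The entries of the transfer function of a diagonal model, as a sum of simple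
    fractions with residues of rank one. *)
Definition residue_sum lam B (p q : 'I_n) (s : R[i]) : R[i] :=
  \sum_(l < r) ((B l p)^* * B l q) * (s - lam l)^-1.

Lemma transferE m lam s p q : (phJ m - phR m = diag_mx (\row_l lam l)) ->
  (forall l, s != lam l) ->
  transfer m s p q = residue_sum lam (phB m) p q s.
Proof.
move=> hl hs; rewrite /transfer.
have -> : s%:M - phJ m + phR m = diag_mx (\row_l (s - lam l)).
  have -> : s%:M - phJ m + phR m = s%:M - (phJ m - phR m) by rewrite opprB addrA addrAC.
  rewrite hl; apply/matrixP => i j; rewrite !mxE; case: eqVneq => [->|_]; rewrite ?mulr1n//.
  by rewrite !mulr0n subr0.
set A := diag_mx _; pose A' := diag_mx (\row_l (s - lam l)^-1).
have AA' : A *m A' = 1%:M.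
  rewrite mulmx_diag; apply/matrixP => i j; rewrite !mxE; case: eqVneq => [->|_].
    by rewrite !mulr1n divff// subr_eq0.
  by rewrite !mulr0n.
have -> : invmx A = A'.
  have [uA _] := mulmx1_unit AA'.
  by rewrite -[RHS](mulKmx uA) AA' mulmx1.
rewrite mxE; apply: eq_bigr => l _; rewrite mul_mx_diag !mxE conjcE.
by rewrite mulrAC.
Qed.

Definition diag_model lam B : ph_model R r n :=
  PHModel (diag_mx (\row_l (0 +i* complex.Im (lam l))))
          (diag_mx (\row_l (- complex.Re (lam l))%:C)) B.

Lemma diag_modelE lam B :
  phJ (diag_model lam B) - phR (diag_model lam B) = diag_mx (\row_l lam l).
Proof.
apply/matrixP => i j; rewrite !mxE; case: eqVneq => _; rewrite ?mulr1n ?mulr0n ?subr0//.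
by apply/eqP; rewrite eq_complex/= add0r opprK subr0 !eqxx.
Qed.

Lemma posdef_diag_model lam B : (forall l, complex.Re (lam l) < 0) ->
  posdefmx (phR (diag_model lam B)).
Proof.
move=> l0; split.
  apply/matrixP => i j; rewrite !mxE [j == i]eq_sym conjcE.
  case: eqVneq => [->|_]; first by rewrite !mulr1n conjc_real.
  by rewrite !mulr0n conjc0.
move=> x x0; rewrite mxE.
have E (j : 'I_r) : (x^t* *m phR (diag_model lam B)) 0 j * x j 0 =
    (- complex.Re (lam j) * modulus (x j 0) ^+ 2)%:C.
  rewrite /= mul_mx_diag !mxE conjcE; case: (x j 0) => a b.
  rewrite modulus_sqr; apply/eqP; rewrite eq_complex/=; apply/andP; split; apply/eqP; ring.
under eq_bigr do rewrite E.
rewrite -rmorph_sum /= ltcR.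
have [j xj] : exists j, x j 0 != 0.
  apply/existsP; rewrite -negb_forall; apply: contra x0 => /forallP H.
  by apply/eqP/matrixP => i j; rewrite ord1 [in RHS]mxE; apply/eqP.
rewrite (bigD1 j)//= ltr_pwDl//.
  by rewrite mulr_gt0 ?oppr_gt0// exprn_gt0// modulus_gt0.
by apply: sumr_ge0 => i _; rewrite mulr_ge0 ?sqr_ge0// oppr_ge0 ltW.
Qed.

Lemma diag_model_in lam B : (forall l, complex.Re (lam l) < 0) ->
  @diag_ph R r n (diag_model lam B).
Proof.
move=> l0; split.
- exact: diag_mx_is_diag.
- exact: diag_mx_is_diag.
- apply/matrixP => i j; rewrite !mxE [j == i]eq_sym conjcE.
  case: eqVneq => [->|_]; last by rewrite !mulr0n conjc0 oppr0.
  rewrite !mulr1n.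
  by apply/eqP; rewrite eq_complex/= oppr0 opprK !eqxx.
- exact: posdef_diag_model.
Qed.

Lemma diag_ph_stable m lam : @diag_ph R r n m ->
  phJ m - phR m = diag_mx (\row_l lam l) -> forall l, complex.Re (lam l) < 0.
Proof.
move=> [_ _ hJ [hR hpos]] hl l.
pose d : 'cV[R[i]]_r := delta_mx l 0.
have d0 : d != 0.
  by apply/eqP => /matrixP/(_ l 0); rewrite !mxE !eqxx => /eqP; rewrite oner_eq0.
have := hpos d d0.
have -> : (d^t* *m phR m *m d) 0 0 = phR m l l.
  rewrite -mulmxA -colE mxE (bigD1 l)//= big1 ?addr0 => [|i il].
    by rewrite /d !mxE !eqxx /= conjcE conjc1 mul1r.
  by rewrite /d !mxE (negbTE il) /= conjcE conjc0 mul0r.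
rewrite ltcE => /andP[_ /= R0].
have JE : complex.Re (phJ m l l) = 0.
  have := congr1 (fun A : 'M[R[i]]_r => complex.Re (A l l)) hJ.
  by rewrite /= !mxE conjcE; case: (phJ m l l) => a b /=; lra.
have := congr1 (fun A : 'M[R[i]]_r => complex.Re (A l l)) hl.
rewrite /= !mxE eqxx mulr1n; move: JE R0; case: (phJ m l l) => a b; case: (phR m l l) => a' b' /=.
by case: (lam l) => e f /=; lra.
Qed.

End Models.

(** * The objective on the imaginary axis *)

Section HardyClass.
Context {R : realType}.
Local Notation mu := (@lebesgue_measure R).
Implicit Types (F G : R[i] -> R[i]) (M : R).

Definition is_hardy F := exists M, hardy_bound F M.

Lemma hardy_mble F M x : hardy_bound F M -> 0 < x ->
  mble (rp F x) /\ mble (ip F x).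
Proof. by move=> HF x0; have [c1 c2] := hardy_continuous HF x0; split; exact: mble_continuous. Qed.

Lemma is_hardyB F G : is_hardy F -> is_hardy G -> is_hardy (fun s => F s - G s).
Proof.
move=> [M HF] [M' HG]; exists (2 * `|M| + 2 * `|M'|); split=> [s s0|x x0].
  by apply: holomorphicB; [exact: HF.1|exact: HG.1].
have [i1 j1] := hardy_L1_sqr HF x0; have [i2 j2] := hardy_L1_sqr HG x0.
have [a1 b1] := hardy_mble HF x0; have [a2 b2] := hardy_mble HG x0.
have L : L1 (fun w => 2 * modulus (F (x +i* w)) ^+ 2 + 2 * modulus (G (x +i* w)) ^+ 2).
  by apply: L1D; exact: L1Z.
apply: (@le_trans _ _ (\int[mu]_w (2 * modulus (F (x +i* w)) ^+ 2 + 2 * modulus (G (x +i* w)) ^+ 2)%:E)%E).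
  apply: ge0_le_integral => //.
  - by move=> w _; rewrite lee_fin sqr_ge0.
  - apply/measurable_EFinP.
    rewrite (_ : (fun w => _) = fun w => (rp F x w - rp G x w) ^+ 2 + (ip F x w - ip G x w) ^+ 2).
      by apply: mbleD; apply: mble_sqr; exact: mbleB.
    apply/funext => w; rewrite modulus_sqr /rp /ip.
    by case: (F _) => a b; case: (G _).
  - by apply/measurable_EFinP; exact: L1_mble L.
  - move=> w _; rewrite lee_fin.
    have := modulusD (F (x +i* w)) (- G (x +i* w)); rewrite modulusN.
    have := modulus_ge0 (F (x +i* w) - G (x +i* w)).
    move: (modulus _) (modulus (F _)) (modulus (G _)) => a b c a0 abc.
    have h1 : a ^+ 2 <= (b + c) ^+ 2 by rewrite ler_pXn2r ?nnegrE//; exact: le_trans abc.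
    by have := sqr_ge0 (b - c); nra.
rewrite EFin_rint// lee_fin rintD ?rintZ//; try exact: L1Z.
lra.
Qed.

Lemma is_hardyZ (k : R[i]) F : is_hardy F -> is_hardy (fun s => k * F s).
Proof.
move=> [M HF]; exists (modulus k ^+ 2 * `|M|); split=> [s s0|x x0].
  by apply: holomorphicM; [exact: holomorphic_cst|exact: HF.1].
have [i1 j1] := hardy_L1_sqr HF x0.
under eq_integral do rewrite modulusM exprMn.
rewrite EFin_rint; last exact: L1Z.
by rewrite lee_fin rintZ// ler_wpM2l ?sqr_ge0.
Qed.

Lemma is_hardy0 : is_hardy (fun=> 0).
Proof.
exists 0; split=> [s _|x x0]; first exact: holomorphic_cst.
rewrite /modulus ComplexField.Normc.normc0; under eq_integral do rewrite expr0n /=.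
by rewrite integral0.
Qed.

Lemma is_hardyD F G : is_hardy F -> is_hardy G -> is_hardy (fun s => F s + G s).
Proof.
move=> HF HG.
rewrite (_ : (fun s => _) = fun s => F s - (-1) * G s); last first.
  by apply/funext => s; rewrite mulN1r opprK.
by apply: is_hardyB => //; exact: is_hardyZ.
Qed.

Lemma is_hardy_sum (I : Type) (s : seq I) (f : I -> R[i] -> R[i]) :
  (forall i, is_hardy (f i)) -> is_hardy (fun z => \sum_(i <- s) f i z).
Proof.
move=> Hf; elim: s => [|i s IH].
  by under eq_fun do rewrite big_nil; exact: is_hardy0.
by under eq_fun do rewrite big_cons; exact: is_hardyD.
Qed.

Lemma holomorphic_pole (l s : R[i]) : s != l -> holomorphic_at (fun z => (z - l)^-1) s.
Proof.
move=> sl; apply: holomorphicV; first by rewrite subr_eq0.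
by apply: holomorphicB; [exact: holomorphic_id|exact: holomorphic_cst].
Qed.

Lemma neq_of_Re (l s : R[i]) : complex.Re l < complex.Re s -> s != l.
Proof. by move=> h; rewrite eq_complex negb_and gt_eqF. Qed.

Lemma is_hardy_pole (l : R[i]) : complex.Re l < 0 -> is_hardy (fun s => (s - l)^-1).
Proof.
move=> l0; exists (pi / - complex.Re l); split=> [s s0|x x0].
  by apply: holomorphic_pole; apply: neq_of_Re; exact: lt_trans s0.
have xl : 0 < x - complex.Re l by rewrite subr_gt0; exact: lt_trans x0.
rewrite (_ : (\int[mu]_w _)%E = (\int[mu]_w (kernel (x - complex.Re l) (complex.Im l) w)%:E)%E).
  rewrite integral_kernel// lee_fin ler_wpM2l ?pi_ge0// lef_pV2 ?posrE//; last by rewrite oppr_gt0.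
  by rewrite lerDr ltW.
apply: eq_integral => w _; congr (_%:E); rewrite modulusV exprVn modulus_sqr /kernel.
by case: (l).
Qed.

Lemma is_hardy_residue_sum r n (lam : 'I_r -> R[i]) (B : 'M[R[i]]_(r, n)) p q :
  (forall l, complex.Re (lam l) < 0) -> is_hardy (residue_sum lam B p q).
Proof.
by move=> l0; apply: is_hardy_sum => l; apply: is_hardyZ; exact: is_hardy_pole.
Qed.

Lemma is_hardy_entry n (H : R[i] -> 'M[R[i]]_n) p q : hardy2 H -> is_hardy (fun s => H s p q).
Proof.
move=> [hol [M HM]].
have hol' s : 0 < complex.Re s -> forall i j, holomorphic_at (fun z => H z i j) s.
  by move=> s0 i j; exact: hol.
have mb i j x : 0 < x -> mble (fun w => modulus (H (x +i* w) i j) ^+ 2).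
  move=> x0; under eq_fun do rewrite modulus_sqr.
  have c (f : R[i] -> R[i]) : (forall s, 0 < complex.Re s -> holomorphic_at f s) -> mble (rp f x).
    move=> hf; apply: mble_continuous => y; apply: (@cr_at_cvgU _ _ (ip f)).
    exact/holomorphic_cr_at/hf.
  apply: mbleD; apply: mble_sqr; first by apply: (c (fun z => H z i j)) => s s0; exact: hol'.
  rewrite -[fun w => _]/(ip (fun z => H z i j) x) ip_rp; apply: c => s s0.
  by apply: holomorphicM; [exact: hol'|exact: holomorphic_cst].
exists M; split=> [s s0|x x0]; first exact: hol'.
apply: le_trans (HM x x0); apply: ge0_le_integral => //.
- by move=> w _; rewrite lee_fin sqr_ge0.
- by apply/measurable_EFinP; exact: mb.
- apply/measurable_EFinP; apply: measurable_sum => i; apply: measurable_sum => j; exact: mb.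
- move=> w _; rewrite lee_fin /frobenius2 (bigD1 p)//= (bigD1 q)//= -addrA lerDl addr_ge0//.
    by apply: sumr_ge0 => j _; exact: sqr_ge0.
  by apply: sumr_ge0 => i _; apply: sumr_ge0 => j _; exact: sqr_ge0.
Qed.

End HardyClass.

Section Objective.
Context {R : realType}.
Local Notation mu := (@lebesgue_measure R).

Lemma cvg_complex (T : Type) (A : set_system T) {FA : Filter A} (f : T -> R[i]) (l : R[i]) :
  (fun t => complex.Re (f t)) @ A --> complex.Re l ->
  (fun t => complex.Im (f t)) @ A --> complex.Im l -> (f : T -> R[i]^o) @ A --> (l : R[i]^o).
Proof.
move=> cR cI; apply/cvgrPdist_le => /= e; case: e => e e'; rewrite ltcE/= => /andP[/eqP -> e0].
have e20 : 0 < e / 2 by rewrite divr_gt0.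
near=> t.
have h1 : `|complex.Re l - complex.Re (f t)| <= e / 2.
  by near: t; exact: (cvgrPdist_le _ _).1 cR _ e20.
have h2 : `|complex.Im l - complex.Im (f t)| <= e / 2.
  by near: t; exact: (cvgrPdist_le _ _).1 cI _ e20.
rewrite normC_modulus complexr0 lecR.
case: (l) h1 h2 => a b; case: (f t) => c d /= h1 h2.
by apply: (le_trans (modulus_le_sum _ _)); lra.
Unshelve. all: by end_near. Qed.

Lemma holomorphic_cvg_right (f : R[i] -> R[i]) x w : holomorphic_at f (x +i* w) ->
  rp f t w @[t --> x^'+] --> rp f x w /\ ip f t w @[t --> x^'+] --> ip f x w.
Proof.
move=> /holomorphic_cr_at H.
suff P W : W = rp f \/ W = ip f -> W t w @[t --> x^'+] --> W x w.
  by split; apply: P; [left|right].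
move=> WE; apply: cvg_at_right_filter; apply/cvgrPdist_le => /= e e0.
have [r r0 Hr] := cr_at_joint H WE e0.
near=> y; rewrite distrC; apply: Hr; last by rewrite subrr normr0 ltW.
by rewrite distrC; near: y; apply: cvgr_dist_le => //; exact: cvg_id.
Unshelve. all: by end_near. Qed.

Lemma L1_sum (I : Type) (s : seq I) (f : I -> R -> R) : (forall i, L1 (f i)) ->
  L1 (fun w => \sum_(i <- s) f i w) /\
  rint (fun w => \sum_(i <- s) f i w) = \sum_(i <- s) rint (f i).
Proof.
move=> Hf; elim: s => [|i s [IH1 IH2]].
  rewrite big_nil; under eq_fun do rewrite big_nil.
  by split; [exact: integrable0|rewrite /rint /Rintegral integral0].
under eq_fun do rewrite big_cons; rewrite big_cons -IH2.
by split; [exact: L1D|rewrite -rintD].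
Qed.

Lemma null_union (I : eqType) (s : seq I) (N : I -> set R) :
  (forall i, measurable (N i) /\ mu (N i) = 0%E) ->
  exists N', [/\ measurable N', mu N' = 0%E & forall i, i \in s -> N i `<=` N'].
Proof.
move=> HN; elim: s => [|i s [N' [mN' N'0 sub]]]; first by exists set0; split.
exists (N i `|` N'); split.
- by apply: measurableU => //; exact: (HN i).1.
- by apply: null_set_setU => //; [exact: (HN i).1|exact: (HN i).2].
- move=> j; rewrite inE => /predU1P[->|/sub js] w jw; [by left|by right; exact: js].
Qed.

(** All the models that differ from [(lam, B)] by one simple fraction are treated
    with the same boundary error e, so that the objective becomes a quadratic
    function of the difference. The transfer function T is only constrained on the
    open half-plane: on the axis it enters through boundary limits. *)
Lemma objective_boundary r n (H : R[i] -> 'M[R[i]]_n) (lam : 'I_r -> R[i]) (B : 'M[R[i]]_(r, n)) :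
  hardy2 H -> (forall l, complex.Re (lam l) < 0) ->
  exists e : 'I_n * 'I_n -> R -> R[i],
  [/\ forall k, CL2 (e k),
      forall k (l : R[i]), complex.Re l < 0 -> cint (fun w => e k w * (pole l w)^*) =
        (2 * pi)%:C * (H (- l^*) k.1 k.2 - residue_sum lam B k.1 k.2 (- l^*)) &
      forall (T : R[i] -> 'M[R[i]]_n) (l l' : R[i]) (a a' : 'I_n * 'I_n -> R[i]),
        complex.Re l < 0 -> complex.Re l' < 0 ->
        (forall s p q, 0 < complex.Re s -> T s p q = residue_sum lam B p q s +
           (a' (p, q) * (s - l')^-1 - a (p, q) * (s - l)^-1)) ->
        (\int[mu]_w (frobenius2 (boundary_value (fun s => H s - T s)%R w))%:E =
         (\sum_k sqnorm (fun w => e k w - (a' k * pole l' w - a k * pole l w)))%:E)%E].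
Proof.
move=> hH l0; pose E (k : 'I_n * 'I_n) s := H s k.1 k.2 - residue_sum lam B k.1 k.2 s.
have hE k : is_hardy (E k).
  by apply: is_hardyB; [exact: is_hardy_entry|exact: is_hardy_residue_sum].
have /choice[Ne HNe] : forall k, exists Ne : set R * (R -> R[i]),
  [/\ measurable Ne.1, mu Ne.1 = 0%E, CL2 Ne.2,
      forall w, ~ Ne.1 w -> rp (E k) x w @[x --> 0^'+] --> complex.Re (Ne.2 w) /\
                         ip (E k) x w @[x --> 0^'+] --> complex.Im (Ne.2 w) &
      forall l : R[i], complex.Re l < 0 ->
        cint (fun w => Ne.2 w * (pole l w)^*) = (2 * pi)%:C * E k (- l^*)].
  by move=> k; have [M /hardy_boundary_complex[N [e h]]] := hE k; exists (N, e).
have [|N [mN N0 sub]] := @null_union _ (enum {: 'I_n * 'I_n}) (fun k => (Ne k).1).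
  by move=> k; have [] := HNe k.
have Le k : CL2 (Ne k).2 by have [] := HNe k.
exists (fun k => (Ne k).2); split=> //.
  by move=> k l h; have [_ _ _ _ ->] := HNe k.
move=> T l l' a a' ll ll' HT.
pose D k w := a' k * pole l' w - a k * pole l w.
have LD k : CL2 (D k) by apply: CL2B; apply: CL2Z; exact: CL2_pole.
have L k : L1 (fun w => modulus ((Ne k).2 w - D k w) ^+ 2) by apply: L1_sqnorm; exact: CL2B.
have [L1S rS] := L1_sum (index_enum ('I_n * 'I_n)%type) L.
rewrite -[in RHS]rS -EFin_rint//.
apply: (ge0_integral_eq_off_null mN N0).
- by move=> w; apply: sumr_ge0 => i _; apply: sumr_ge0 => j _; exact: sqr_ge0.
- by move=> w; apply: sumr_ge0 => k _; exact: sqr_ge0.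
- exact: L1_mble.
move=> w Nw; rewrite /frobenius2 pair_bigA; apply: eq_bigr => -[p q] _ /=; congr (modulus _ ^+ 2).
rewrite mxE; apply: (@cvg_lim R[i]^o (@norm_hausdorff _ R[i]^o)).
pose g s := a' (p, q) * (s - l')^-1 - a (p, q) * (s - l)^-1.
have hg : holomorphic_at g (0 +i* w).
  have hp (c l1 : R[i]) : complex.Re l1 < 0 -> holomorphic_at (fun s => c * (s - l1)^-1) (0 +i* w).
    move=> h; apply: holomorphicM; first exact: holomorphic_cst.
    by apply: holomorphic_pole; exact: neq_of_Re.
  by apply: holomorphicB; exact: hp.
have gE : g (0 +i* w) = D (p, q) w by [].
have [g1 g2] := holomorphic_cvg_right hg.
have nN : ~ (Ne (p, q)).1 w by move=> h; apply: Nw; apply: (sub (p, q)) h; rewrite mem_enum.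
have [_ _ _ /(_ w nN)[c1 c2] _] := HNe (p, q).
have X (x : R) : 0 < x -> (H (x +i* w) - T (x +i* w)) p q = E (p, q) (x +i* w) - g (x +i* w).
  by move=> x0; rewrite !mxE HT// /E /g /= opprD addrA.
apply: cvg_complex.
- rewrite (_ : complex.Re _ = complex.Re ((Ne (p, q)).2 w) - rp g 0 w); last first.
    by rewrite /rp gE; case: ((Ne _).2 w) => u1 u2; case: (D _ _).
  apply: cvg_trans (cvgB c1 g1); apply: near_eq_cvg; near=> x.
  have x0 : 0 < x by near: x; exact: nbhs_right_gt.
  rewrite X// -[LHS]/(complex.Re (E (p, q) (x +i* w)) - complex.Re (g (x +i* w))).
  by case: (E _ _) => u1 u2; case: (g _).
- rewrite (_ : complex.Im _ = complex.Im ((Ne (p, q)).2 w) - ip g 0 w); last first.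
    by rewrite /ip gE; case: ((Ne _).2 w) => u1 u2; case: (D _ _).
  apply: cvg_trans (cvgB c2 g2); apply: near_eq_cvg; near=> x.
  have x0 : 0 < x by near: x; exact: nbhs_right_gt.
  rewrite X// -[LHS]/(complex.Im (E (p, q) (x +i* w)) - complex.Im (g (x +i* w))).
  by case: (E _ _) => u1 u2; case: (g _).
Unshelve. all: by end_near. Qed.

End Objective.

(** * First-order tools *)

Section Wirtinger.
Context {R : realType}.
Implicit Types (f g : R[i] -> R[i]) (s : R[i]).

Lemma derive1_of_bound (phi : R -> R) (x a : R) :
  (forall e : R, 0 < e -> exists2 r : R, 0 < r & forall u, `|u - x| <= r ->
     `|phi u - phi x - a * (u - x)| <= e * `|u - x|) ->
  derive1 phi x = a.
Proof.
move=> H; rewrite derive1E /derive; apply: cvg_lim => //.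
apply/cvgrPdist_le => /= e e0; have [r r0 Hr] := H e e0.
near=> h; have h0 : h != 0 by near: h; exact: nbhs_dnbhs_neq.
have hr : `|h| <= r by near: h; exact: dnbhs0_le.
have -> : h%:A = h :> R by rewrite [LHS]mulr1.
rewrite [_ *: _]/(_ * _).
have := Hr (h + x); rewrite addrK => /(_ hr) H1.
have -> : a - h^-1 * (phi (h + x) - phi x) = - (h^-1 * (phi (h + x) - phi x - a * h)) by field.
by rewrite normrN normrM normfV ler_pdivrMl ?normr_gt0// [`|h| * e]mulrC.
Unshelve. all: by end_near.
Qed.

(** Along a direction v the function has the derivative lf v + (lg v)^* . The
    combination of the directions 1 and i that defines the Wirtinger derivative
    keeps the linear part and cancels the antilinear one. *)
Lemma wirtingerE f g s (lf lg : R[i]) : has_cderiv f s lf -> has_cderiv g s lg ->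
  wirtinger (fun z => f z + (g z)^*) s = lf.
Proof.
case: s => x y Hf Hg.
pose S (z : R[i]) := f z + (g z)^*.
pose d (v : R[i]) := lf * v + (lg * v)^*.
have est (v : R[i]) (t0 : R) (z : R -> R[i]) : modulus v = 1 ->
    (forall t, z t - (x +i* y) = (t - t0)%:C * v) ->
    forall e : R, 0 < e -> exists2 r : R, 0 < r & forall t, `|t - t0| <= r ->
      modulus (S (z t) - S (x +i* y) - (t - t0)%:C * d v) <= e * `|t - t0|.
  move=> v1 zE e e0; have e20 : 0 < e / 2 by rewrite divr_gt0.
  have [r1 r10 H1] := Hf _ e20; have [r2 r20 H2] := Hg _ e20.
  exists (Num.min r1 r2); first by rewrite lt_min r10.
  move=> t; rewrite le_min => /andP[t1 t2].
  have m : modulus (z t - (x +i* y)) = `|t - t0| by rewrite zE modulusM modulus_real v1 mulr1.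
  have {H1} := H1 (z t); have {H2} := H2 (z t); rewrite m => /(_ t2) H2 /(_ t1) H1.
  rewrite zE in H1 H2.
  have -> : S (z t) - S (x +i* y) - (t - t0)%:C * d v =
    (f (z t) - f (x +i* y) - lf * ((t - t0)%:C * v)) +
    (g (z t) - g (x +i* y) - lg * ((t - t0)%:C * v))^*.
    rewrite /S /d; case: (f (z t)) => a1 a2; case: (f (x +i* y)) => b1 b2.
    case: (g (z t)) => c1 c2; case: (g (x +i* y)) => d1 d2.
    case: (lf) => l1 l2; case: (lg) => m1 m2; case: (v) => v1' v2'.
    by apply/eqP; rewrite eq_complex/=; apply/andP; split; apply/eqP; ring.
  apply: (le_trans (modulusD _ _)).
  have -> : e * `|t - t0| = e / 2 * `|t - t0| + e / 2 * `|t - t0| by field.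
  apply: lerD => //; apply: le_trans H2; rewrite le_eqVlt; apply/orP; left; apply/eqP.
  by apply: complexI; rewrite -!normC_modulus normcJ.
have dRe (v : R[i]) (t0 : R) (z : R -> R[i]) : modulus v = 1 -> z t0 = x +i* y ->
    (forall t, z t - (x +i* y) = (t - t0)%:C * v) -> rderiv (fun t => S (z t)) t0 = d v.
  move=> v1 z0 zE; rewrite /rderiv.
  rewrite (@derive1_of_bound _ _ (complex.Re (d v))); last first.
    move=> e e0; have [r r0 H] := est v t0 z v1 zE e e0; exists r => // t tr.
    apply: le_trans (H t tr); apply: le_trans (modulus_Re _); rewrite z0.
    rewrite le_eqVlt; apply/orP; left; apply/eqP; congr `|_|.
    by case: (S (z t)) => a1 a2; case: (S _) => b1 b2; case: (d v) => d1 d2 /=; ring.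
  rewrite (@derive1_of_bound _ _ (complex.Im (d v))); first by case: (d v).
  move=> e e0; have [r r0 H] := est v t0 z v1 zE e e0; exists r => // t tr.
  apply: le_trans (H t tr); apply: le_trans (modulus_Im _); rewrite z0.
  rewrite le_eqVlt; apply/orP; left; apply/eqP; congr `|_|.
  by case: (S (z t)) => a1 a2; case: (S _) => b1 b2; case: (d v) => d1 d2 /=; ring.
rewrite /wirtinger.
rewrite (@dRe 1 x (fun u => u +i* y)) => //; first last.
- by move=> t; apply/eqP; rewrite eq_complex/=; apply/andP; split; apply/eqP; ring.
- by rewrite /modulus ComplexField.Normc.normc1.
rewrite (@dRe 'i%C y (fun u => x +i* u)) => //; first last.
- by move=> t; apply/eqP; rewrite eq_complex/=; apply/andP; split; apply/eqP; ring.
- by rewrite modulus_imag normr1.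
have -> : d 1 - 'i%C * d 'i%C = 2 * lf.
  rewrite /d; case: (lf) => l1 l2; case: (lg) => m1 m2.
  by apply/eqP; rewrite eq_complex/=; apply/andP; split; apply/eqP; ring.
by rewrite mulKf// pnatr_eq0.
Qed.

End Wirtinger.

Section FirstOrder.
Context {R : realType}.

(** For small e of the sign of a, the first-order term |a| |e| would exceed the
    quadratic upper bound. *)
Lemma first_order (g : R -> R) (a C r : R) : 0 < r ->
  (forall e, `|e| <= r -> g e <= C * e ^+ 2) ->
  (forall eta : R, 0 < eta -> exists2 d : R, 0 < d & forall e, `|e| <= d ->
     `|g e - a * e| <= eta * `|e|) -> a = 0.
Proof.
move=> r0 HC Ha; apply/eqP/negPn/negP => a0.
have A0 : 0 < `|a| by rewrite normr_gt0.
have [d d0 Hd] := Ha (`|a| / 4) (divr_gt0 A0 (ltr0Sn _ 3)).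
have C0 : 0 < `|C| + 1 by have := normr_ge0 C; lra.
(* at this size the quadratic bound is at most half of the first-order term *)
pose t := Num.min (Num.min r d) (`|a| / (2 * (`|C| + 1))).
have t0 : 0 < t by rewrite !lt_min r0 d0 divr_gt0// mulr_gt0.
have : [/\ t <= r, t <= d & t <= `|a| / (2 * (`|C| + 1))].
  by rewrite /t; split; rewrite !ge_min lexx ?orbT.
move=> [tr td]; rewrite ler_pdivlMr ?mulr_gt0// => tC.
pose e := Num.sg a * t.
have en : `|e| = t by rewrite /e normrM normr_sg a0 mul1r gtr0_norm.
have ae : a * e = `|a| * t by rewrite /e mulrA [a * _]mulrC -normrEsg.
have e2 : e ^+ 2 = t ^+ 2 by rewrite -(real_normK (num_real e)) en.
have h1 := HC e; have h2 := Hd e; rewrite en in h1 h2.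
have {}h1 := h1 tr; have {}h2 := h2 td.
rewrite ae in h2; rewrite e2 in h1.
move: h2; rewrite ler_norml => /andP[h2 _].
have h3 : C * t ^+ 2 <= `|C| * t ^+ 2 by rewrite ler_wpM2r ?sqr_ge0// ler_norm.
have h4 : t * (2 * (`|C| + 1)) * t <= `|a| * t by rewrite ler_pM2r.
have h5 : 0 < `|a| * t by rewrite mulr_gt0.
have h6 : 0 < t ^+ 2 by rewrite exprn_gt0.
rewrite expr2 in h1 h3 h6; lra.
Qed.

Lemma has_cderiv_sum (I : Type) (s : seq I) (f : I -> R[i] -> R[i]) (k l : I -> R[i]) (z : R[i]) :
  (forall i, has_cderiv (f i) z (l i)) ->
  has_cderiv (fun w => \sum_(i <- s) k i * f i w) z (\sum_(i <- s) k i * l i).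
Proof.
move=> Hf; elim: s => [|i s IH] e e0.
  exists 1 => // w _; rewrite !big_nil mul0r !subrr {1}/modulus ComplexField.Normc.normc0.
  by rewrite mulr_ge0 ?modulus_ge0// ltW.
have k0 : 0 < modulus (k i) + 1 by have := modulus_ge0 (k i); lra.
have e1 : 0 < e / 2 / (modulus (k i) + 1) by rewrite !divr_gt0.
have [r1 r10 H1] := Hf i _ e1; have [r2 r20 H2] := IH _ (divr_gt0 e0 (ltr0Sn _ 1)).
exists (Num.min r1 r2); first by rewrite lt_min r10.
move=> w; rewrite le_min => /andP[w1 w2]; rewrite !big_cons.
set A := \sum_(j <- s) k j * f j w; set A' := \sum_(j <- s) k j * f j z.
set D := \sum_(j <- s) k j * l j.
have -> : k i * f i w + A - (k i * f i z + A') - (k i * l i + D) * (w - z) =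
  k i * (f i w - f i z - l i * (w - z)) + (A - A' - D * (w - z)) by ring.
apply: (le_trans (modulusD _ _)); rewrite modulusM.
have -> : e * modulus (w - z) = e / 2 * modulus (w - z) + e / 2 * modulus (w - z) by field.
apply: lerD; last exact: H2.
apply: (@le_trans _ _ (modulus (k i) * (e / 2 / (modulus (k i) + 1) * modulus (w - z)))).
  by rewrite ler_wpM2l ?modulus_ge0//; exact: H1.
rewrite mulrA ler_wpM2r ?modulus_ge0// mulrA ler_pdivrMr// mulrC.
by rewrite ler_wpM2l ?divr_ge0 ?(ltW e0)// lerDl.
Qed.

Lemma has_cderivB (f g : R[i] -> R[i]) z (a b : R[i]) : has_cderiv f z a -> has_cderiv g z b ->
  has_cderiv (fun w => f w - g w) z (a - b).
Proof.
move=> Hf Hg e e0.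
have [r1 r10 H1] := Hf _ (divr_gt0 e0 (ltr0Sn _ 1)).
have [r2 r20 H2] := Hg _ (divr_gt0 e0 (ltr0Sn _ 1)).
exists (Num.min r1 r2); first by rewrite lt_min r10.
move=> w; rewrite le_min => /andP[w1 w2].
have -> : f w - g w - (f z - g z) - (a - b) * (w - z) =
  (f w - f z - a * (w - z)) + - (g w - g z - b * (w - z)) by ring.
apply: (le_trans (modulusD _ _)); rewrite modulusN.
have -> : e * modulus (w - z) = e / 2 * modulus (w - z) + e / 2 * modulus (w - z) by field.
by apply: lerD; [exact: H1|exact: H2].
Qed.

Lemma has_cderiv_local (f g : R[i] -> R[i]) z (a : R[i]) (r : R) : 0 < r ->
  (forall w, modulus (w - z) <= r -> f w = g w) -> has_cderiv f z a -> has_cderiv g z a.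
Proof.
move=> r0 fg Hf e e0; have [r1 r10 H1] := Hf e e0.
exists (Num.min r1 r); first by rewrite lt_min r10.
move=> w; rewrite le_min => /andP[w1 w2]; rewrite -!fg//; first exact: H1.
by rewrite subrr /modulus ComplexField.Normc.normc0 ltW.
Qed.

End FirstOrder.

(** * Stationarity of an optimal model *)

Section Optimality.
Context {R : realType}.
Local Notation mu := (@lebesgue_measure R).

Lemma h2_power_le (u v : R) : 0 <= u -> 0 <= v ->
  (((((2 * pi)^-1)%:E * u%:E) `^ (2^-1)%R) <= ((((2 * pi)^-1)%:E * v%:E) `^ (2^-1)%R))%E ->
  u <= v.
Proof.
have c0 : 0 < (2 * pi : R)^-1 by rewrite invr_gt0 mulr_gt0// pi_gt0.
move=> u0 v0; rewrite -!EFinM !poweR_EFin lee_fin => h.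
rewrite leNgt; apply/negP => vu; move: h; rewrite leNgt => /negP; apply.
by apply: gt0_ltr_powR; rewrite ?invr_gt0 ?nnegrE ?mulr_ge0 ?(ltW c0)// ltr_pM2l.
Qed.

Lemma Re_sum (I : Type) (s : seq I) (F : I -> R[i]) :
  complex.Re (\sum_(i <- s) F i) = \sum_(i <- s) complex.Re (F i).
Proof. by apply: (big_morph _ (id1 := 0)) => // -[a b] [c d]. Qed.

Variables (r n : nat) (H : R[i] -> 'M[R[i]]_n) (m : ph_model R r n) (lam : 'I_r -> R[i]).
Hypothesis hH : hardy2 H.
Hypothesis hm : h2_optimal H (@diag_ph R r n) m.
Hypothesis hlam : phJ m - phR m = diag_mx (\row_l lam l).

Let B := phB m.
Definition error (k : 'I_n * 'I_n) (s : R[i]) : R[i] := H s k.1 k.2 - residue_sum lam B k.1 k.2 s.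
Definition outer (c : 'I_n -> R[i]) (k : 'I_n * 'I_n) : R[i] := (c k.1)^* * c k.2.

Lemma optimal_stable l : complex.Re (lam l) < 0.
Proof. exact: diag_ph_stable hm.1 hlam l. Qed.

Lemma residue_sum_update (i : 'I_r) (c : 'I_n -> R[i]) l' p q s :
  residue_sum (fun l => if l == i then l' else lam l)
    (\matrix_(l, q) if l == i then c q else B l q) p q s =
  residue_sum lam B p q s +
   (outer c (p, q) * (s - l')^-1 - outer (B i) (p, q) * (s - lam i)^-1).
Proof.
rewrite /residue_sum (bigD1 i)//= [in RHS](bigD1 i)//= !mxE eqxx /outer /=.
under eq_bigr => l /negbTE li do rewrite !mxE li.
by rewrite [in RHS]addrAC; ring.
Qed.

(** The squared distances to the model and to its variation are compared by
    expanding the square; the pairing with the difference is evaluated by the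
    reproducing property. *)
Lemma optimal_variation (i : 'I_r) (c : 'I_n -> R[i]) l' : complex.Re l' < 0 ->
  4 * pi * complex.Re (\sum_k ((outer c k)^* * error k (- l'^*) -
                               (outer (B i) k)^* * error k (- (lam i)^*)))
   <= \sum_k sqnorm (fun w => outer c k * pole l' w - outer (B i) k * pole (lam i) w).
Proof.
move=> l'0; have [e [Le pairing obj]] := objective_boundary B hH optimal_stable.
have CB k : CL2 (fun w => outer c k * pole l' w - outer (B i) k * pole (lam i) w).
  by apply: CL2B; apply: CL2Z; apply: CL2_pole => //; exact: optimal_stable.
have sq0 (f : R -> R[i]) : 0 <= sqnorm f by apply: rint_ge0 => w; exact: sqr_ge0.
pose lam' l := if l == i then l' else lam l.
pose B' : 'M[R[i]]_(r, n) := \matrix_(l, q) if l == i then c q else B l q.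
have st' l : complex.Re (lam' l) < 0 by rewrite /lam'; case: ifP => // _; exact: optimal_stable.
have := hm.2 _ (diag_model_in B' st').
(* the model itself is the variation with no fraction exchanged *)
rewrite /h2norm (@obj (transfer m) (lam i) (lam i) (fun=> 0) (fun=> 0)); first last.
- move=> s p q s0; rewrite !mul0r subrr addr0; apply: transferE => // l.
  by apply: neq_of_Re; exact: lt_trans (optimal_stable l) s0.
- exact: optimal_stable.
- exact: optimal_stable.
rewrite (@obj (transfer (diag_model lam' B')) (lam i) l' (outer (B i)) (outer c)); first last.
- move=> s p q s0; rewrite -residue_sum_update; apply: transferE; first exact: diag_modelE.
  by move=> l; apply: neq_of_Re; exact: lt_trans (st' l) s0.
- by [].
- exact: optimal_stable.
move=> /h2_power_le; rewrite !sumr_ge0// => /(_ isT isT).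
have E0 k : sqnorm (fun w => e k w - (0 * pole (lam i) w - 0 * pole (lam i) w)) = sqnorm (e k).
  by congr sqnorm; apply/funext => w; rewrite !mul0r !subr0.
under eq_bigr do rewrite E0.
under [X in _ <= X]eq_bigr do rewrite sqnormB//.
rewrite big_split -subr_ge0 big_split => h.
rewrite -subr_ge0; apply: le_trans h _; rewrite le_eqVlt; apply/orP; left; apply/eqP.
rewrite [X in X - _]addrAC.
set S := \sum_k sqnorm (e k); set D := \sum_k sqnorm _.
rewrite Re_sum mulr_sumr sumrN.
suff -> : \sum_k 2 * complex.Re (cint (fun w => e k w * (outer c k * pole l' w - outer (B i) k * pole (lam i) w)^*))
  = \sum_k (4 * pi * complex.Re ((outer c k)^* * error k (- l'^*) -
                               (outer (B i) k)^* * error k (- (lam i)^*))) by ring.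
apply: eq_bigr => k _; rewrite cint_mulJ_lin//; try by apply: CL2_pole => //; exact: optimal_stable.
rewrite !pairing//; last exact: optimal_stable.
rewrite -/(error k _) -/(error k _).
rewrite !conjcE; move: (outer c k) (outer (B i) k) (error k _) (error k _) => [a1 a2] [b1 b2] [c1 c2] [d1 d2] /=.
ring.
Qed.

End Optimality.

Section Stationarity.
Context {R : realType}.

Lemma sqnormZ (k : R[i]) (f : R -> R[i]) : CL2 f ->
  sqnorm (fun w => k * f w) = modulus k ^+ 2 * sqnorm f.
Proof.
move=> Lf; rewrite /sqnorm -rintZ; last exact: L1_sqnorm.
by apply: eq_rint => w; rewrite modulusM exprMn.
Qed.

Lemma stable_near (l l' : R[i]) : modulus (l' - l) <= - complex.Re l / 2 ->
  - complex.Re l / 2 <= - complex.Re l'.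
Proof.
move=> near; have := le_trans (modulus_Re (l' - l)) near.
have -> : complex.Re (l' - l) = complex.Re l' - complex.Re l by case: (l'); case: (l).
by rewrite ler_norml => /andP[_]; clear; lra.
Qed.

(** The difference of two fractions is (l' - l) times their product, and the fraction
    with the pole l' is bounded on the axis uniformly for l' near l. The squared norm is
    therefore of second order in l' - l. *)
Lemma sqnorm_pole_diff (l l' : R[i]) : complex.Re l < 0 ->
  modulus (l' - l) <= - complex.Re l / 2 ->
  sqnorm (fun w => pole l' w - pole l w) <=
    modulus (l' - l) ^+ 2 * (4 / complex.Re l ^+ 2 * sqnorm (pole l)).
Proof.
move=> l0 near; pose x := - complex.Re l; have x0 : 0 < x by rewrite oppr_gt0.
have x2 : 0 < x / 2 by rewrite divr_gt0.
have l'x : x / 2 <= - complex.Re l' by exact: stable_near.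
have l'0 : complex.Re l' < 0 by rewrite -oppr_gt0; exact: lt_le_trans l'x.
have L := L1_sqnorm (CL2_pole l0).
rewrite /sqnorm -rintZ// -rintZ; last exact: L1Z.
apply: le_rint; [|by do 2 apply: L1Z|].
  by apply: L1_sqnorm; apply: CL2B; exact: CL2_pole.
move=> w.
have n0 (k : R[i]) : complex.Re k < 0 -> (0 +i* w) - k != 0.
  by move=> k0; rewrite subr_eq0; exact: neq_of_Re.
have -> : pole l' w - pole l w = (l' - l) * (pole l' w * pole l w).
  by rewrite /pole; field; rewrite !n0.
rewrite !modulusM !exprMn ler_wpM2l ?sqr_ge0// ler_wpM2r ?sqr_ge0//.
rewrite modulus_pole; apply: le_trans (kernel_le _ _ _) _; first by rewrite oppr_gt0.
have -> : 4 / complex.Re l ^+ 2 = ((x / 2) ^+ 2)^-1.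
  by rewrite /x; field; rewrite lt_eqF.
have h1 : (x / 2) ^+ 2 <= (- complex.Re l') ^+ 2.
  by rewrite ler_pXn2r// nnegrE ltW// oppr_gt0.
by rewrite lef_pV2// posrE exprn_gt0// oppr_gt0.
Qed.

Lemma Re_mulJ (z : R[i]) : complex.Re (z^* * z) = modulus z ^+ 2.
Proof. by rewrite ?conjcE modulus_sqr; case: z => a b /=; ring. Qed.

Lemma Re_conj (z : R[i]) : complex.Re z^* = complex.Re z.
Proof. by rewrite ?conjcE; case: z. Qed.

Lemma ReM_real (x : R) (z : R[i]) : complex.Re (x%:C * z) = x * complex.Re z.
Proof. by case: z => a b /=; rewrite mul0r subr0. Qed.

Variables (r n : nat) (H : R[i] -> 'M[R[i]]_n) (m : ph_model R r n) (lam : 'I_r -> R[i]).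
Hypothesis hH : hardy2 H.
Hypothesis hm : h2_optimal H (@diag_ph R r n) m.
Hypothesis hlam : phJ m - phR m = diag_mx (\row_l lam l).
Variable i : 'I_r.
Let B := phB m.
Let E k := error H m lam k.
Let sigma := - (lam i)^*.

(** First-order condition for row i of B, moved along a real line in any direction v. The
    change of the model is of first order in the parameter, so its squared norm is
    quadratic and [first_order] applies. *)
Lemma variation_of_rows (v : 'I_n -> R[i]) :
  complex.Re (\sum_k ((v k.1)^* * B i k.2 + (B i k.1)^* * v k.2)^* * E k sigma) = 0.
Proof.
pose d (k : 'I_n * 'I_n) := (v k.1)^* * B i k.2 + (B i k.1)^* * v k.2.
rewrite -/(d _); under eq_bigr do rewrite -/(d _).
set a := complex.Re _.
pose a2 := complex.Re (\sum_k (outer v k)^* * E k sigma).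
pose S := sqnorm (pole (lam i)).
have li0 := optimal_stable hm hlam i.
have S0 : 0 <= S by apply: rint_ge0 => w; exact: sqr_ge0.
pose g e : R := 4 * pi * (e * a + e ^+ 2 * a2).
have pi0 := @pi_gt0 R.
suff : 4 * pi * a = 0.
  by move=> /eqP; rewrite mulf_eq0 (gt_eqF (mulr_gt0 _ pi0))// => /eqP.
apply: (@first_order R g _ (\sum_k (modulus (d k) + modulus (outer v k)) ^+ 2 * S) 1) => //.
  move=> e e1.
  pose c q := B i q + e%:C * v q.
  have cE k : outer c k - outer (B i) k = e%:C * (d k + e%:C * outer v k).
    rewrite /outer /c /d !conjcE; case: (B i k.1) (B i k.2) (v k.1) (v k.2) => x1 x2 [y1 y2] [z1 z2] [t1 t2].
    by apply/eqP; rewrite eq_complex/=; apply/andP; split; apply/eqP; ring.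
  have := optimal_variation hH hm hlam i c li0.
  have -> : complex.Re (\sum_k ((outer c k)^* * error H m lam k (- (lam i)^*) -
              (outer (phB m i) k)^* * error H m lam k (- (lam i)^*))) = e * a + e ^+ 2 * a2.
    rewrite /a /a2 -!ReM_real !mulr_sumr.
    have RD (x y : R[i]) : complex.Re (x + y) = complex.Re x + complex.Re y by case: x; case: y.
    rewrite -RD -big_split; congr complex.Re; apply: eq_bigr => k _.
    rewrite -mulrBl.
    have -> : (outer c k)^* - (outer (phB m i) k)^* = (outer c k - outer (B i) k)^* by rewrite rmorphB.
    rewrite cE -/sigma -/(E k) !conjcE.
    case: (d k) (outer v k) (E k sigma) => x1 x2 [y1 y2] [z1 z2].
    by apply/eqP; rewrite eq_complex/=; apply/andP; split; apply/eqP; ring.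
  move=> h; apply: le_trans h _; rewrite mulr_suml.
  apply: ler_sum => k _.
  rewrite (_ : (fun w => _) = fun w => (outer c k - outer (B i) k) * pole (lam i) w); last first.
    by apply/funext => w; rewrite mulrBl.
  rewrite sqnormZ; last exact: CL2_pole.
  rewrite cE modulusM modulus_real exprMn real_normK ?num_real//.
  rewrite -/S [leRHS]mulrC -[leLHS]mulrA; apply: ler_wpM2l; first exact: sqr_ge0.
  apply: ler_wpM2r => //; rewrite ler_pXn2r ?nnegrE ?addr_ge0 ?modulus_ge0//.
  apply: (le_trans (modulusD _ _)); rewrite lerD2l modulusM modulus_real.
  by rewrite ler_piMl ?modulus_ge0.
move=> eta eta0.
have den : 0 < 4 * pi * `|a2| + 1 by rewrite ltr_wpDl// mulr_ge0// mulr_ge0// ltW.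
exists (eta / (4 * pi * `|a2| + 1)); first exact: divr_gt0.
move=> e; rewrite ler_pdivlMr// => he.
have -> : g e - 4 * pi * a * e = (4 * pi * a2 * e) * e by rewrite /g; ring.
rewrite normrM ler_wpM2r// !normrM (gtr0_norm pi0) gtr0_norm//.
by apply: le_trans he; rewrite mulrC ler_wpM2l// lerDl.
Qed.

(** First-order condition for lambda_i. Moving lambda_i by - e l0 displaces the
    reflected point sigma by e times the conjugate of l0, the direction in which the
    first-order term of the pairing is the positive number |l0|^2, where l0 is the
    derivative that is to vanish. *)
Lemma variation_of_pole (D : 'I_n * 'I_n -> R[i]) :
  (forall k, has_cderiv (E k) sigma (D k)) -> \sum_k (outer (B i) k)^* * D k = 0.
Proof.
move=> hD; set l0 := \sum_k _.
have hf := has_cderiv_sum (index_enum _) (fun k => (outer (B i) k)^*) hD.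
rewrite -/l0 in hf; set f := (fun w => _) in hf.
have li0 := optimal_stable hm hlam i; have pi0 := @pi_gt0 R.
pose nu := l0^*; pose g e : R := 4 * pi * complex.Re (f (sigma + e%:C * nu) - f sigma).
suff : 4 * pi * modulus l0 ^+ 2 = 0.
  move=> /eqP; rewrite mulf_eq0 (gt_eqF (mulr_gt0 _ pi0))//= sqrf_eq0 => /eqP.
  exact: modulus0_eq0.
have nuE : modulus nu = modulus l0.
  by apply: complexI; rewrite -!normC_modulus normcJ.
pose x := - complex.Re (lam i); have x0 : 0 < x by rewrite oppr_gt0.
have N1 : 0 < modulus l0 + 1 by rewrite ltr_wpDl// modulus_ge0.
pose C := \sum_k modulus (outer (B i) k) ^+ 2 *
  (modulus l0 ^+ 2 * (4 / complex.Re (lam i) ^+ 2 * sqnorm (pole (lam i)))).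
apply: (@first_order R g _ C (x / 2 / (modulus l0 + 1))).
- by rewrite !divr_gt0.
- move=> e; rewrite ler_pdivlMr// => he.
  pose l' := lam i - e%:C * l0.
  have dl : modulus (l' - lam i) = `|e| * modulus l0.
    by rewrite /l' addrAC subrr add0r modulusN modulusM modulus_real.
  have small : modulus (l' - lam i) <= x / 2.
    by rewrite dl; apply: le_trans he; rewrite ler_wpM2l// lerDl.
  have l'0 : complex.Re l' < 0.
    by rewrite -oppr_gt0; apply: lt_le_trans (stable_near small); exact: divr_gt0.
  have := optimal_variation hH hm hlam i (B i) l'0.
  have -> : - l'^* = sigma + e%:C * nu.
    rewrite /l' /sigma /nu !conjcE; case: (lam i) (l0) => a1 a2 [b1 b2].
    by apply/eqP; rewrite eq_complex/=; apply/andP; split; apply/eqP; ring.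
  rewrite sumrB -/sigma -/B.
  move=> h; apply: le_trans h _; rewrite mulr_suml.
  apply: ler_sum => k _.
  rewrite (_ : (fun w => _) = fun w => outer (B i) k * (pole l' w - pole (lam i) w)); last first.
    by apply/funext => w; rewrite mulrBr.
  rewrite sqnormZ; last by apply: CL2B; exact: CL2_pole.
  rewrite -mulrA ler_wpM2l ?sqr_ge0//.
  apply: le_trans (sqnorm_pole_diff li0 small) _.
  rewrite dl exprMn real_normK ?num_real// le_eqVlt; apply/orP; left; apply/eqP.
  ring.
- move=> eta eta0.
  have den : 0 < 4 * pi * (modulus l0 + 1) by rewrite !mulr_gt0.
  have [d d0 Hd] := hf _ (divr_gt0 eta0 den).
  exists (d / (modulus l0 + 1)); first exact: divr_gt0.
  move=> e; rewrite ler_pdivlMr// => he.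
  have sh : sigma + e%:C * nu - sigma = e%:C * nu by rewrite addrAC subrr add0r.
  have := Hd (sigma + e%:C * nu); rewrite sh modulusM modulus_real nuE.
  move=> /(_ (le_trans (ler_wpM2l (normr_ge0 e) _) he)); rewrite lerDl ler01 => /(_ isT) h.
  have -> : g e - 4 * pi * modulus l0 ^+ 2 * e =
     4 * pi * complex.Re (f (sigma + e%:C * nu) - f sigma - l0 * (e%:C * nu)).
    have aux (u z : R[i]) :
        complex.Re u - modulus z ^+ 2 * e = complex.Re (u - z * (e%:C * z^*)).
      by rewrite modulus_sqr !conjcE; case: u z => u1 u2 [z1 z2] /=; ring.
    by rewrite /g -aux -!mulrA -!mulrBr.
  rewrite normrM gtr0_norm ?mulr_gt0//.
  apply: (@le_trans _ _ (4 * pi * (eta / (4 * pi * (modulus l0 + 1)) * (`|e| * modulus l0)))).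
    by rewrite ler_wpM2l ?mulr_ge0 ?(ltW pi0)//; apply: le_trans (modulus_Re _) h.
  have -> : 4 * pi * (eta / (4 * pi * (modulus l0 + 1)) * (`|e| * modulus l0)) =
     eta * `|e| * (modulus l0 / (modulus l0 + 1)).
    by move: (pi : R) pi0 => P P0; field; rewrite !gt_eqF.
  rewrite ler_piMr ?mulr_ge0 ?(ltW eta0)//.
  by rewrite ler_pdivrMr// mul1r lerDl.
Qed.

(** The direction v conjugate to the vector Z of left-hand sides makes the quantity
    of [variation_of_rows] equal to the squared norm of Z. *)
Lemma row_condition p :
  \sum_q (E (p, q) sigma + (E (q, p) sigma)^*) * (B i q)^* = 0.
Proof.
pose Z p := \sum_q (E (p, q) sigma + (E (q, p) sigma)^*) * (B i q)^*.
suff : \sum_p modulus (Z p) ^+ 2 = 0.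
  move=> /eqP; rewrite psumr_eq0; last by move=> q _; exact: sqr_ge0.
  by move=> /allP/(_ p); rewrite mem_index_enum => /(_ isT)/=; rewrite sqrf_eq0 => /eqP/modulus0_eq0.
have := variation_of_rows (fun p => (Z p)^*).
rewrite -(pair_bigA _ (fun p q => (((Z p)^*)^* * B i q + (B i p)^* * (Z q)^*)^* * E (p, q) sigma)) /=.
move=> h; apply: etrans (h) => {h}.
have -> : \sum_p0 \sum_q (((Z p0)^*)^* * B i q + (B i p0)^* * (Z q)^*)^* * E (p0, q) sigma =
  \sum_p0 ((Z p0)^* * \sum_q E (p0, q) sigma * (B i q)^* +
           Z p0 * \sum_q E (q, p0) sigma * B i q).
  rewrite [RHS]big_split /=; under [in RHS]eq_bigr do rewrite mulr_sumr.
  under [X in _ = _ + X]eq_bigr do rewrite mulr_sumr.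
  rewrite [X in _ = _ + X]exchange_big -big_split /=; apply: eq_bigr => p0 _.
  rewrite -big_split /=; apply: eq_bigr => q _.
  rewrite rmorphD !rmorphM /= !conjcE !conjcK; ring.
rewrite Re_sum; apply: eq_bigr => p0 _.
rewrite -Re_mulJ.
have RD (x y : R[i]) : complex.Re (x + y) = complex.Re x + complex.Re y by case: x; case: y.
have {2}-> : Z p0 = \sum_q E (p0, q) sigma * (B i q)^* + (\sum_q E (q, p0) sigma * B i q)^*.
  rewrite rmorph_sum -big_split /=; apply: eq_bigr => q _.
  by rewrite rmorphM mulrDl.
by rewrite mulrDr !RD; congr (_ + _); rewrite -[LHS]Re_conj rmorphM /= !conjcE !conjcK.
Qed.

End Stationarity.

(** * The interpolation conditions *)

Lemma is_hardy_cderiv (R : realType) (F : R[i] -> R[i]) (s : R[i]) :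
  is_hardy F -> 0 < complex.Re s -> exists l, has_cderiv F s l.
Proof. by move=> [M HF] s0; apply: holomorphic_cderiv; exact: HF.1. Qed.

Lemma hermitian_partE (R : realType) n (A : 'M[R[i]]_n) p q :
  (A + A^t*) p q = A p q + (A q p)^*.
Proof. by rewrite !mxE. Qed.

Lemma wirtinger_hermitian_part (R : realType) n (F : R[i] -> 'M[R[i]]_n)
    (D : 'I_n * 'I_n -> R[i]) s :
  (forall k, has_cderiv (fun z => F z k.1 k.2) s (D k)) ->
  mx_wirtinger (fun z => F z + (F z)^t*) s = \matrix_(p, q) D (p, q).
Proof.
move=> hD; apply/matrixP => p q; rewrite !mxE.
rewrite (_ : (fun z => _) = fun z => F z p q + (F z q p)^*).
  exact: wirtingerE (hD (p, q)) (hD (q, p)).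
by apply/funext => z; rewrite hermitian_partE.
Qed.

Theorem corollary5p4 (R : realType) (n r : nat) (hn : (0 < n)%N) (hr : (0 < r)%N)
    (H : R[i] -> 'M[R[i]]_n) (hH : hardy2 H)
    (m : ph_model R r n) (hm : h2_optimal H (@diag_ph R r n) m)
    (hpoles : ([set p | is_pole (transfer m) p] #= `I_r)%card)
    (lambda : 'rV[R[i]]_r) (hlambda : phJ m - phR m = diag_mx lambda)
    (b : 'I_r -> 'cV[R[i]]_n)
    (hb : forall i, (b i)^t* = delta_mx (0 : 'I_1) i *m phB m)
    (G Ghat : R[i] -> 'M[R[i]]_n)
    (hG : forall s, G s = H s + (H s)^t*)
    (hGhat : forall s, Ghat s = transfer m s + (transfer m s)^t*) :
  forall i : 'I_r,
    let sigma := - (lambda 0 i)^* in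
    [/\ G sigma *m b i = Ghat sigma *m b i,
        (b i)^t* *m G sigma = (b i)^t* *m Ghat sigma
      & (b i)^t* *m mx_wirtinger G sigma *m b i
        = (b i)^t* *m mx_wirtinger Ghat sigma *m b i].
Proof.
move=> i sigma; pose lam l := lambda 0 l.
have hlam : phJ m - phR m = diag_mx (\row_l lam l).
  by rewrite hlambda; congr diag_mx; apply/rowP => l; rewrite mxE.
have lam0 l : complex.Re (lam l) < 0 := optimal_stable hm hlam l.
have sigma0 : 0 < complex.Re sigma.
  by rewrite /sigma; move: (lam0 i); rewrite /lam; case: (lambda 0 i) => x y /=; rewrite oppr_gt0.
have bE q : b i q 0 = (phB m i q)^*.
  have := congr1 (fun A : 'rV[R[i]]_n => A 0 q) (hb i).
  by rewrite /= -rowE !mxE => <-; rewrite !conjcE conjcK.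
have tE s p q : 0 < complex.Re s -> transfer m s p q = residue_sum lam (phB m) p q s.
  by move=> s0; apply: transferE => // l; apply: neq_of_Re; exact: lt_trans (lam0 l) s0.
have GE p q : G sigma p q - Ghat sigma p q =
    error H m lam (p, q) sigma + (error H m lam (q, p) sigma)^*.
  by rewrite hG hGhat !hermitian_partE !tE// /error /= !conjcE rmorphB; ring.
have row p : \sum_q (G sigma p q - Ghat sigma p q) * (phB m i q)^* = 0.
  by under eq_bigr do rewrite GE; exact: row_condition hH hm hlam i p.
have GJ p q : (G sigma p q - Ghat sigma p q)^*%C = G sigma q p - Ghat sigma q p.
  by rewrite !GE rmorphD /= !conjcE conjcK addrC.
split.
- apply/matrixP => p j; rewrite !mxE ord1; apply/eqP; rewrite -subr_eq0 -sumrB; apply/eqP.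
  by under eq_bigr do rewrite bE -mulrBl; exact: row.
- apply/matrixP => j q; rewrite !mxE ord1; apply/eqP; rewrite -subr_eq0 -sumrB; apply/eqP.
  have := congr1 (@Num.conj R[i]) (row q); rewrite rmorph0 rmorph_sum /= => h; apply: etrans (h).
  apply: eq_bigr => p _; rewrite !mxE bE -mulrBr rmorphM /= !conjcE !conjcK GJ mulrC.
  by [].
have /choice[dH hdH] (k : 'I_n * 'I_n) : exists l, has_cderiv (fun s => H s k.1 k.2) sigma l.
  by apply: is_hardy_cderiv sigma0; exact: is_hardy_entry.
have /choice[dT hdT] (k : 'I_n * 'I_n) :
    exists l, has_cderiv (residue_sum lam (phB m) k.1 k.2) sigma l.
  by apply: is_hardy_cderiv sigma0; exact: is_hardy_residue_sum.
have hdT' (k : 'I_n * 'I_n) : has_cderiv (fun s => transfer m s k.1 k.2) sigma (dT k).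
  have s2 : 0 < complex.Re sigma / 2 by rewrite divr_gt0.
  apply: (has_cderiv_local s2) (hdT k) => w hw; rewrite tE//.
  have := le_trans (modulus_Re _) hw.
  have -> : complex.Re (w - sigma) = complex.Re w - complex.Re sigma by case: (w); case: (sigma).
  by rewrite ler_norml => /andP[h _]; move: h sigma0; clear; lra.
have -> : mx_wirtinger G sigma = \matrix_(p, q) dH (p, q).
  by rewrite (funext hG); exact: wirtinger_hermitian_part.
have -> : mx_wirtinger Ghat sigma = \matrix_(p, q) dT (p, q).
  by rewrite (funext hGhat); exact: wirtinger_hermitian_part.
have := variation_of_pole hH hm hlam (i := i) (fun k => has_cderivB (hdH k) (hdT k)).
rewrite (eq_bigr (fun k => (outer (phB m i) (k.1, k.2))^* * (dH (k.1, k.2) - dT (k.1, k.2)))); last by case.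
rewrite -(pair_bigA _ (fun p q => (outer (phB m i) (p, q))^* * (dH (p, q) - dT (p, q)))) /=.
rewrite exchange_big /= => D0.
apply/matrixP => j j'; rewrite !ord1 [LHS]mxE [RHS]mxE; apply/eqP; rewrite -subr_eq0 -sumrB.
rewrite -[X in _ == X]D0; apply/eqP/eq_bigr => q _; rewrite -mulrBl !mxE -sumrB mulr_suml.
apply: eq_bigr => p _; rewrite !mxE !bE /outer -mulrBr rmorphM /= !conjcE !conjcK.
by rewrite mulrAC.
Qed.
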